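(* Let $N\ge 3$, $1<p<N$, let $A,V,K$ satisfy hypotheses $(\mathbf A)$, $(\mathbf V)$, $(\mathbf K)$ (see context), and let $q_1,q_2>1$ be real numbers. (i) If $\mathcal S_0(q_1,R_1)<\infty$ and $\mathcal S_\infty(q_2,R_2)<\infty$ for some $R_1,R_2>0$, then $X$ is continuously embedded into $L_K^{q_1}(\mathbb R^N)+L_K^{q_2}(\mathbb R^N)$. (ii) If $\lim_{R\to 0^+}\mathcal S_0(q_1,R)=\lim_{R\to+\infty}\mathcal S_\infty(q_2,R)=0$, then $X$ is compactly embedded into $L_K^{q_1}(\mathbb R^N)+L_K^{q_2}(\mathbb R^N)$.
   Context: Notation: $\mathbb R_+=(0,+\infty)$, $B_R=\{x\in\mathbb R^N:|x|<R\}$. Hypotheses: $(\mathbf A)$ $A:\mathbb R_+\to\mathbb R_+$ is continuous and there exist real numbers $a_0,a_\infty\in(p-N,p]$ and $c_0,c_\infty>0$ such that $c_0\le\liminf_{r\to0^+}A(r)/r^{a_0}\le\limsup_{r\to0^+}A(r)/r^{a_0}<+\infty$ and $c_\infty\le\liminf_{r\to+\infty}A(r)/r^{a_\infty}\le\limsup_{r\to+\infty}A(r)/r^{a_\infty}<+\infty$. $(\mathbf V)$ $V:\mathbb R_+\to[0,+\infty)$ is measurable and $V\in L^1_{\mathrm{loc}}(\mathbb R_+)$. $(\mathbf K)$ $K:\mathbb R_+\to\mathbb R_+$ is measurable and $K\in L^s_{\mathrm{loc}}(\mathbb R_+)$ for some $s>1$. Spaces: $S_A$ is the space of radial $u\in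 C_c^\infty(\mathbb R^N)$ with $\int_{\mathbb R^N}A(|x|)|\nabla u|^p\,dx<+\infty$, with norm $\|u\|_A=\left(\int_{\mathbb R^N}A(|x|)|\nabla u|^p\,dx\right)^{1/p}$. $D_A$ is the completion of $S_A$ with respect to $\|\cdot\|_A$; its elements are identified with radial functions on $\mathbb R^N\setminus\{0\}$ (weakly differentiable there, and with $\|u\|_A$ given by the same formula). $X:=D_A\cap L^p(\mathbb R^N,V(|x|)dx)$ is a Banach space with norm $\|u\|=\left(\|u\|_A^p+\int_{\mathbb R^N}V(|x|)|u|^p\,dx\right)^{1/p}$. For $R>0$ and $q>1$, $\mathcal S_0(q,R):=\sup_{u\in X,\,\|u\|=1}\int_{B_R}K(|x|)|u|^q\,dx$ and $\mathcal S_\infty(q,R):=\sup_{u\in X,\,\|u\|=1}\int_{\mathbb R^N\setminus B_R}K(|x|)|u|^q\,dx$ (values in $[0,+\infty]$). $L^q_K(\mathbb R^N):=L^q(\mathbb R^N,K(|x|)dx)$, and $L_K^{q_1}+L_K^{q_2}:=\{u_1+u_2:u_1\in L_K^{q_1}(\mathbb R^N),\,u_2\in L_K^{q_2}(\mathbb R^N)\}$ is a Banach space with norm $\inf_{u_1+u_2=u}\max\{\|u_1\|_{L_K^{q_1}(\mathbb R^N)},\|u_2\|_{L_K^{q_2}(\mathbb R^N)}\}$. *)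

(* Defs.v *)
From HB Require Import structures.
From mathcomp Require Import all_boot all_order all_algebra.
From mathcomp Require Import all_classical all_reals all_analysis.
From mathcomp Require Import measurable_realfun.
Set Implicit Arguments.
Unset Strict Implicit.
Unset Printing Implicit Defensive.
Import Order.TTheory GRing.Theory Num.Theory.
Import numFieldNormedType.Exports.
Local Open Scope classical_set_scope.
Local Open Scope ring_scope.

Definition rV_display : measure_display -> measure_display.
Proof. exact. Qed.

Section rV_measurable.
Context (R : realType) (n : nat).

Let coord (i : 'I_n) (x : 'rV[R]_n) : measurableTypeR R := x ord0 i.

Let rV_set0 : g_sigma_preimage coord set0.
Proof. exact: sigma_algebra0. Qed.

Let rV_setC A : g_sigma_preimage coord A -> g_sigma_preimage coord (~` A).
Proof. exact: sigma_algebraC. Qed.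

Let rV_bigcup (F : _^nat) : (forall i, g_sigma_preimage coord (F i)) ->
  g_sigma_preimage coord (\bigcup_i (F i)).
Proof. exact: sigma_algebra_bigcup. Qed.

(* The sigma-algebra generated by the coordinates, as for [n.-tuple R]; this
   is the Borel sigma-algebra of ['rV[R]_n]. *)
HB.instance Definition _ :=
  @isMeasurable.Build (rV_display default_measure_display)
    'rV[R]_n (g_sigma_preimage coord) rV_set0 rV_setC rV_bigcup.

End rV_measurable.

Section rV_rcons.
Context (R : realType).

Definition rV_rcons n (p : 'rV[R]_n * measurableTypeR R) : 'rV[R]_n.+1 :=
  \row_i oapp (p.1 ord0) p.2 (unlift ord_max i).

Lemma measurable_rV_coord n (i : 'I_n) :
  measurable_fun [set: 'rV[R]_n]
    ((fun x => x ord0 i) : 'rV[R]_n -> measurableTypeR R).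
Proof.
move=> _ Y mY; rewrite setTI; apply: sub_sigma_algebra => /=.
rewrite -bigcup_seq/=; exists i => /=; first by rewrite mem_index_enum.
by exists Y => //; rewrite setTI.
Qed.

Lemma measurable_rV_rcons n : measurable_fun setT (@rV_rcons n).
Proof.
move=> _ A mA; rewrite setTI.
suff : g_sigma_preimage
    (fun (i : 'I_n.+1) (p : 'rV[R]_n * measurableTypeR R) =>
      (rV_rcons p ord0 i : measurableTypeR R)) `<=` measurable.
  apply; rewrite (g_sigma_preimage_comp
    (fun (i : 'I_n.+1) (x : 'rV[R]_n.+1) =>
      (x ord0 i : measurableTypeR R)) (@rV_rcons n)).
  by exists A => //; rewrite setTI.
apply: smallest_sub; first exact: sigma_algebra_measurable.
rewrite -bigcup_mkord_ord; apply: bigcup_sub => i Ii.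
move=> _ [B mB <-]; rewrite setTI.
case: (unliftP ord_max (inord i : 'I_n.+1)) => [j|] ->.
- rewrite (_ : _ @^-1` _ =
    setT `&` ((fun x : 'rV[R]_n => (x ord0 j : measurableTypeR R)) \o fst)
      @^-1` B).
    apply: (measurableT_comp (measurable_rV_coord j) measurable_fst) => //.
  by apply/seteqP; split => [[x t]|[x t] []]; rewrite /= !mxE liftK/=.
- rewrite (_ : _ @^-1` _ = setT `&` snd @^-1` B).
    exact: measurable_snd.
  by apply/seteqP; split => [[x t]|[x t] []]; rewrite /= !mxE unlift_none/=.
Qed.

End rV_rcons.

Section lebesgue_measure_step.
Context (R : realType) (n : nat) (m : {measure set 'rV[R]_n -> \bar R}).
Local Open Scope ereal_scope.

Definition lebesgue_step (A : set 'rV[R]_n.+1) : \bar R :=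
  pushforward (m \x @lebesgue_measure R) (@rV_rcons R n) A.

Let lebesgue_step0 : lebesgue_step set0 = 0.
Proof. by rewrite /lebesgue_step /pushforward preimage_set0 measure0. Qed.

Let lebesgue_step_ge0 A : 0 <= lebesgue_step A.
Proof.
exact: (measure_ge0 (measure_function_pushforward__canonical__measure_function_Measure
  (m \x @lebesgue_measure R) (@measurable_rV_rcons R n))).
Qed.

Let lebesgue_step_sigma_additive : semi_sigma_additive lebesgue_step.
Proof.
exact: (@measure_semi_sigma_additive _ _ _
  (measure_function_pushforward__canonical__measure_function_Measure
  (m \x @lebesgue_measure R) (@measurable_rV_rcons R n))).
Qed.

HB.instance Definition _ := isMeasure.Build _ _ _ lebesgue_step
  lebesgue_step0 lebesgue_step_ge0 lebesgue_step_sigma_additive.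

End lebesgue_measure_step.

Fixpoint lebesgueN (R : realType) (n : nat) :
    {measure set 'rV[R]_n -> \bar R} :=
  if n is n'.+1 then lebesgue_step (lebesgueN R n') else dirac (0 : 'rV[R]_0).

Lemma measurable_rV_box (R : realType) n (A : 'I_n -> set (measurableTypeR R)) :
  (forall i, measurable (A i)) ->
  measurable [set x : 'rV[R]_n | forall i, A i (x ord0 i)].
Proof.
move=> mA; rewrite (_ : mkset _ = \bigcap_(i in [set: 'I_n])
    ((fun x : 'rV[R]_n => (x ord0 i : measurableTypeR R)) @^-1` A i)).
  apply: fin_bigcap_measurable => // i _.
  by rewrite -[X in measurable X]setTI; exact: measurable_rV_coord.
by apply/seteqP; split => [x Ax i _|x Ax i]; exact: Ax.
Qed.

Lemma lebesgueN_box (R : realType) n (A : 'I_n -> set (measurableTypeR R)) :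
  (forall i, measurable (A i)) ->
  lebesgueN R n [set x | forall i, A i (x ord0 i)] =
  (\big[mule/1]_(i < n) lebesgue_measure (A i))%E.
Proof.
elim: n A => [|n IHn] A mA.
  by rewrite big_ord0/= diracE mem_set//= => -[].
rewrite big_ord_recr/= /lebesgue_step /pushforward.
have := product_measure1E (lebesgueN R n) (@lebesgue_measure R)
  (measurable_rV_box (fun i => mA (widen_ord (leqnSn n) i))) (mA ord_max).
rewrite /= (IHn (fun i => A (widen_ord (leqnSn n) i)))// => <-; congr (product_measure1 _ _ _).
have widenE (j : 'I_n) : widen_ord (leqnSn n) j = lift ord_max j.
  by apply/val_inj; rewrite /= /bump leqNgt ltn_ord.
apply/seteqP; split=> -[x t] /=.
- move=> Axt; split=> [i|]; last by have := Axt ord_max; rewrite mxE unlift_none.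
  by have := Axt (lift ord_max i); rewrite mxE liftK/= -widenE.
- move=> [Ax At] i; rewrite mxE; case: unliftP => [j|] -> //=.
  by rewrite -widenE; exact: Ax.
Qed.

(** The integral of the library is a supremum over Borel simple functions; it
    computes the usual Lebesgue integral also for the Lebesgue (not necessarily
    Borel) measurable functions below. *)

Definition lebesgue_measurable_fun d (T : measurableType d) (R : realType)
    (mu : set T -> \bar R) (D : set T) (f : T -> R) : Prop :=
  forall B : set (measurableTypeR R), measurable B ->
    completed_algebra_gen mu (D `&` f @^-1` B).

(** f belongs to L^s_loc(]0, +oo[) *)
Definition Lloc_pos (R : realType) (s : R) (f : R -> R) : Prop :=
  lebesgue_measurable_fun (@lebesgue_measure R) `]0, +oo[ f /\
  forall C : set R, compact C -> C `<=` `]0, +oo[ ->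
    (\int[@lebesgue_measure R]_(r in C) (`|f r| `^ s)%:E < +oo)%E.

Section Euclidean.
Context (R : realType) (N : nat).
Local Notation E := 'rV[R]_N.
Implicit Types (u phi : E -> R) (x : E).

(* [`|x|] on ['rV[R]_N] is the sup norm *)
Definition enorm x : R := Num.sqrt (\sum_(i < N) x ord0 i ^+ 2).

Definition eball (r : R) : set E := [set x | enorm x < r].

Definition radial u : Prop := forall x y, enorm x = enorm y -> u x = u y.

Definition partial (i : 'I_N) u : E -> R :=
  fun x => 'D_(delta_mx ord0 i) u x.

Definition partials (s : seq 'I_N) u : E -> R := foldr partial u s.

Definition smooth u : Prop := forall s : seq 'I_N,
  continuous (partials s u) /\
  forall i x, derivable (partials s u) x (delta_mx ord0 i).

Definition supp u : set E := closure [set x | u x != 0].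

Definition Cc_infty u : Prop := smooth u /\ compact (supp u).

Definition grad u : E -> E := fun x => \row_i partial i u x.

(** L^1_loc(R^N \ {0}) *)
Definition L1loc_off0 u : Prop :=
  lebesgue_measurable_fun (lebesgueN R N) [set~ 0] u /\
  forall C : set E, compact C -> C `<=` [set~ 0] ->
    (\int[lebesgueN R N]_(x in C) `|u x|%:E < +oo)%E.

(** [g] is a distributional gradient of [u] on R^N \ {0}. *)
Definition weak_gradient u (g : E -> E) : Prop :=
  [/\ L1loc_off0 u,
      forall i, L1loc_off0 (fun x => g x ord0 i) &
      forall phi, Cc_infty phi -> ~ supp phi 0 -> forall i : 'I_N,
        (\int[lebesgueN R N]_x (u x * partial i phi x)%:E =
         - \int[lebesgueN R N]_x (g x ord0 i * phi x)%:E)%E ].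

(* an arbitrary representative of the (a.e. unique) weak gradient; 0 if there
   is none *)
Definition wgrad u : E -> E := xget (fun=> 0) [set g | weak_gradient u g].

End Euclidean.

Section Embeddings.
Context (R : realType) (U : zmodType).
Implicit Types (X Y : set U) (nX nY : U -> \bar R).
Local Open Scope ereal_scope.

Definition continuously_embedded X nX Y nY : Prop :=
  X `<=` Y /\ exists C : R, forall u, X u -> nY u <= C%:E * nX u.

Definition compactly_embedded X nX Y nY : Prop :=
  continuously_embedded X nX Y nY /\
  forall u_ : nat -> U, (forall n, X (u_ n)) ->
    (exists M : R, forall n, nX (u_ n) <= M%:E) ->
    exists sigma : nat -> nat, {homo sigma : m n / (m < n)%N} /\
    exists2 v, Y v & nY (u_ (sigma n) - v)%R @[n --> \oo] --> 0.

End Embeddings.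

Section Hypotheses.
Context (R : realType) (N : nat) (p : R).
Implicit Types A V K : R -> R.

(** Functions on ]0, +oo[ are represented by functions on [R] whose values
    outside ]0, +oo[ are irrelevant. *)

Definition hypA A : Prop :=
  [/\ forall r, 0 < r -> 0 < A r,
      {within `]0, +oo[, continuous A} &
      exists a0 aoo c0 coo : R,
      [/\ p - N%:R < a0 <= p, p - N%:R < aoo <= p, 0 < c0 /\ 0 < coo,
          (let f := fun r => (A r / r `^ a0)%:E in
           c0%:E <= limf_einf f 0^'+ /\
           limf_einf f 0^'+ <= limf_esup f 0^'+ < +oo)%E &
          (let f := fun r => (A r / r `^ aoo)%:E in
           coo%:E <= limf_einf f (+oo%R : set_system R) /\
           limf_einf f (+oo%R : set_system R) <=
             limf_esup f (+oo%R : set_system R) < +oo)%E]].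

Definition hypV V : Prop :=
  (forall r, 0 < r -> 0 <= V r) /\ Lloc_pos 1 V.

Definition hypK K : Prop :=
  (forall r, 0 < r -> 0 < K r) /\ exists2 s, 1 < s & Lloc_pos s K.

End Hypotheses.

(** Spaces of functions are sets of functions [E -> R] that are stable under
    a.e. equality, except [SA]; their norms take values in [\bar R] and are
    invariant under a.e. equality. *)
Section Spaces.
Context (R : realType) (N : nat) (p : R) (A V K : R -> R).
Local Notation E := 'rV[R]_N.
Local Notation mu := (lebesgueN R N).
Local Open Scope ereal_scope.

Definition energyA (g : E -> E) : \bar R :=
  \int[mu]_x (A (enorm x) * enorm (g x) `^ p)%:E.

Definition SA : set (E -> R) :=
  [set u | [/\ Cc_infty u, radial u & energyA (grad u) < +oo]].

Definition normSA (u : E -> R) : \bar R := energyA (grad u) `^ p^-1.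

(** The completion of [SA], realised as a space of functions: the elements are
    the a.e. limits of the sequences of [SA] that are Cauchy for [normSA]. *)
Definition DA : set (E -> R) :=
  [set u | exists u_ : nat -> E -> R,
    [/\ forall n, SA (u_ n),
        forall e : R, (0 < e)%R -> exists n0 : nat, forall m n : nat,
          (n0 <= m)%N -> (n0 <= n)%N -> normSA (u_ m - u_ n)%R < e%:E &
        {ae mu, forall x, u_ n x @[n --> \oo] --> u x}]].

Definition potV (u : E -> R) : \bar R :=
  \int[mu]_x (V (enorm x) * `|u x| `^ p)%:E.

Definition spaceX : set (E -> R) := [set u | DA u /\ potV u < +oo].

Definition normX (u : E -> R) : \bar R :=
  (energyA (wgrad u) + potV u) `^ p^-1.

Definition S0 (q r : R) : \bar R :=
  ereal_sup [set \int[mu]_(x in eball r) (K (enorm x) * `|u x| `^ q)%:E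
            | u in [set u | spaceX u /\ normX u = 1]].

Definition Soo (q r : R) : \bar R :=
  ereal_sup [set \int[mu]_(x in ~` eball r) (K (enorm x) * `|u x| `^ q)%:E
            | u in [set u | spaceX u /\ normX u = 1]].

Definition normLK (q : R) (u : E -> R) : \bar R :=
  (\int[mu]_x (K (enorm x) * `|u x| `^ q)%:E) `^ q^-1.

Definition LK (q : R) : set (E -> R) :=
  [set u | lebesgue_measurable_fun mu setT u /\ normLK q u < +oo].

Definition decomposition (q1 q2 : R) (u : E -> R) :
    set ((E -> R) * (E -> R)) :=
  [set w | [/\ LK q1 w.1, LK q2 w.2 & u = (w.1 + w.2)%R %[ae mu]]].

Definition sumLK (q1 q2 : R) : set (E -> R) :=
  [set u | decomposition q1 q2 u !=set0].

Definition normsumLK (q1 q2 : R) (u : E -> R) : \bar R :=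
  ereal_inf [set maxe (normLK q1 w.1) (normLK q2 w.2)
            | w in decomposition q1 q2 u].

End Spaces.

(* Main.v *)
(** A function of D_A is a.e. equal to U(|x|), with weak gradient W(|x|) x/|x|, where U is the
    pointwise limit of the profiles of smooth radial functions and W the limit of their
    derivatives in the weighted L^p norm.  Radially the energy is one-dimensional, and on [a, b]
    in ]0, +oo[ the weight A is bounded below, so that U oscillates there by at most
    C |t - s|^(1 - 1/p) ||u||; since a_oo > p - N, the increments of U over dyadic intervals are
    summable up to infinity, hence also |U| <= C ||u|| on [a, b].  As K is locally integrable off
    the origin, the integral of K |u|^q over a spherical shell is at most C ||u||^q, and S_0 and
    S_oo are only needed near the origin and near infinity: cutting u along a sphere gives (i).

    For (ii), the profiles of a bounded sequence are bounded and equicontinuous on every [a, b],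
    so a subsequence of them converges locally uniformly in ]0, +oo[.  The integrals near the
    origin and infinity are uniformly small by homogeneity, also for the limit by Fatou's lemma;
    the limit belongs to the sum space, and it need not be shown to belong to X. *)

From HB Require Import structures.
Require Import Defs.
From mathcomp Require Import all_boot all_order all_algebra.
From mathcomp Require Import all_classical all_reals all_analysis.
From mathcomp Require Import measurable_realfun ring lra.
Set Implicit Arguments.
Unset Strict Implicit.
Unset Printing Implicit Defensive.
Import Order.TTheory GRing.Theory Num.Theory.
Import numFieldNormedType.Exports.
Local Open Scope classical_set_scope.
Local Open Scope ring_scope.

(** * Lebesgue measure and Borel sets of R^N *)

(** Three obstacles shape the proof. The measure [lebesgueN] is handled through boxes, so
    integration in polar coordinates is replaced by a two-sided comparison, on each shell, of the
    law of [|x|] with Lebesgue measure on the line; its constants come from bounding the increments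
    of [omega * r^N]. Next, [normX] involves [wgrad], an arbitrary choice among the weak gradients:
    no norm can be computed before weak gradients are shown to be unique, which takes enough smooth
    functions supported off the origin. Finally, the elements of [X] are arbitrary functions,
    determined up to null sets; every integral is therefore first shown to be insensitive to null
    sets and then moved to Borel profiles on the half-line. The Hoelder and Minkowski inequalities
    are replaced by cruder ones: [y <= d + d^(1-p) y^p], optimised in [d], and
    [(x + y)^r <= 2^r (x^r + y^r)]. The lost constants are harmless for embeddings. Since [S0] and
    [Soo] are suprema over the unit sphere of [X], using them for general [u] requires [X] to be
    stable under scaling, hence the way back from representations to [DA]. *)

Section boxes.
Context (R : realType) (n : nat).
Local Notation E := 'rV[R]_n.

Definition obox (a b : 'I_n -> R) : set E :=
  [set x | forall i, a i < x ord0 i < b i].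

Lemma oboxE (a b : 'I_n -> R) :
  obox a b = [set x | forall i, (`]a i, b i[%classic : set (measurableTypeR R)) (x ord0 i)].
Proof.
by apply/seteqP; split => x /= xab i; have := xab i; rewrite in_itv.
Qed.

Lemma measurable_obox a b : measurable (obox a b).
Proof. rewrite oboxE; apply: (measurable_rV_box (A := fun i => `]a i, b i[%classic)) => i.
exact: measurable_itv. Qed.

Lemma oboxI a b a' b' : obox a b `&` obox a' b' =
  obox (fun i => Num.max (a i) (a' i)) (fun i => Num.min (b i) (b' i)).
Proof.
apply/seteqP; split => x /=.
  move=> [h h'] i; have /andP[h1 h2] := h i; have /andP[h3 h4] := h' i.
  by rewrite gt_max lt_min h1 h2 h3 h4.
by move=> h; split=> i; have := h i; rewrite gt_max lt_min => /andP[/andP[h1 h2] /andP[h3 h4]]; rewrite ?h1 ?h2 ?h3 ?h4.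
Qed.

Definition oboxes : set (set E) := [set Q | exists a b, Q = obox a b].

Definition cube (k : nat) : set E := obox (fun=> - k%:R) (fun=> k%:R).

Lemma coord_le_norm (x : E) i : `|x ord0 i| <= `|x|.
Proof.
rewrite /Num.norm/= mx_normrE.
exact: (le_bigmax _ (fun ij => `|x ij.1 ij.2|) (ord0, i)).
Qed.

Lemma norm_le_coord (x : E) (e : R) : 0 <= e -> (forall i, `|x ord0 i| <= e) -> `|x| <= e.
Proof.
move=> e0 xe; rewrite /Num.norm/= mx_normrE; apply/bigmax_leP; split => // -[i j] _ /=.
by rewrite ord1.
Qed.

Lemma bound_coord (x : E) : exists M : nat, forall i, `|x ord0 i| < M%:R.
Proof.
exists (Num.bound `|x|) => i; apply: le_lt_trans (archi_boundP (normr_ge0 x)).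
exact: coord_le_norm.
Qed.

Lemma bigcup_cube : \bigcup_k cube k = setT.
Proof.
apply/seteqP; split => // x _; have [M xM] := bound_coord x.
by exists M => // i; have := xM i; rewrite ltr_norml.
Qed.

(** A half-space [r < x_i] is the union over [k] of the boxes bounded by [r] and [k] in direction
    [i] and by [-k] and [k] in the others. *)
Lemma measurable_oboxes : @measurable _ E = <<s oboxes >>.
Proof.
apply/seteqP; split; last first.
  apply: smallest_sub; first exact: sigma_algebra_measurable.
  by move=> _ [a [b ->]]; exact: measurable_obox.
apply: smallest_sub; first exact: smallest_sigma_algebra.
rewrite -bigcup_seq; apply: bigcup_sub => i _.
move=> _ [B mB <-].
pose T := g_sigma_algebraType oboxes.
have : measurable_fun [set: T] ((fun x : E => x ord0 i) : T -> measurableTypeR R).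
  apply: (measurability _ (RGenOInfty.measurableE R)) => _ [_ [r ->] <-].
  rewrite setTI.
  rewrite (_ : _ @^-1` _ = \bigcup_k
     (obox (fun j => if j == i then r else - k%:R) (fun=> k%:R))).
    by apply: bigcup_measurable => k _; apply: sub_sigma_algebra; do 2 eexists.
  apply/seteqP; split => x /=.
    rewrite in_itv/= andbT => rx; have [M xM] := bound_coord x.
    exists M => //= j; have := xM j; rewrite ltr_norml => /andP[h1 h2].
    by case: eqP => [->|]; rewrite ?rx ?h1/= //; have := xM i; rewrite ltr_norml => /andP[].
  by move=> [k _ /(_ i)]; rewrite eqxx in_itv/= => /andP[->].
by move=> /(_ measurableT B mB).
Qed.

(** Boxes are stable under intersection and generate the Borel sets, and the cubes, of finite
    measure, exhaust the space. *)
Lemma measure_eq_obox (m1 m2 : {measure set E -> \bar R}) :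
  (forall a b, m1 (obox a b) = m2 (obox a b)) ->
  (forall k, m1 (cube k) < +oo)%E ->
  forall A, measurable A -> m1 A = m2 A.
Proof.
move=> m12 m1oo; apply: (measure_unique oboxes cube) => //.
- exact: measurable_oboxes.
- by move=> _ _ [a [b ->]] [a' [b' ->]]; rewrite oboxI; do 2 eexists.
- by move=> k; do 2 eexists.
- exact: bigcup_cube.
- by move=> _ [a [b ->]].
Qed.

Lemma lebesgueN_obox (a b : 'I_n -> R) : (forall i, a i <= b i) ->
  lebesgueN R n (obox a b) = (\prod_(i < n) (b i - a i))%:E.
Proof.
move=> ab; rewrite oboxE (lebesgueN_box (A := fun i => `]a i, b i[%classic)); last first.
  by move=> i; exact: measurable_itv.
rewrite -prodEFin; apply: eq_bigr => i _.
rewrite [LHS](lebesgue_measure_itv `]a i, b i[)/= lte_fin.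
by have := ab i; rewrite le_eqVlt => /predU1P[->|->]; rewrite ?ltxx ?subrr ?EFinB.
Qed.

Lemma lebesgueN_cube k : (lebesgueN R n (cube k) < +oo)%E.
Proof. by rewrite lebesgueN_obox ?ltry// => i; rewrite lerNl (le_trans (y := 0)) ?oppr_le0. Qed.

End boxes.

(** * Dilations and translations *)

Section affine.
Context (R : realType).

(** As a function of [A] the left side is a measure, and it gives half-open intervals their
    length. *)
Lemma lebesgue_measure_affine (c d : R) (A : set (measurableTypeR R)) : 0 < c ->
  measurable A -> (c%:E * lebesgue_measure ((fun t => (c * t + d)%R) @^-1` A) = lebesgue_measure A)%E.
Proof.
move=> c0 mA; pose f := (fun t => c * t + d) : measurableTypeR R -> measurableTypeR R.
have mf : measurable_fun setT f.
  by apply: measurable_funD => //; exact: measurable_funM.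
pose c' := NngNum (ltW c0).
pose g := pushforward lebesgue_measure f.
apply/esym.
rewrite [LHS](lebesgue_measure_unique
  (mu := mscale c' (measure_function_pushforward__canonical__measure_function_Measure lebesgue_measure mf)))//.
move=> _ [[a b]] _ <-.
rewrite /= /mscale/= /pushforward.
rewrite (_ : f @^-1` _ = `](a - d) / c, (b - d) / c]%classic); last first.
  apply/seteqP; split => t; rewrite /f /= !in_itv/= => /andP[h1 h2].
    by rewrite ltr_pdivrMr// ler_pdivlMr// ltrBlDr lerBrDr ![t * _]mulrC h1 h2.
  by move: h1 h2; rewrite ltr_pdivrMr// ler_pdivlMr// ltrBlDr lerBrDr ![t * _]mulrC => -> ->.
rewrite [LHS](lebesgue_measure_itv `]a, b]).
rewrite (lebesgue_measure_itv `](a - d) / c, (b - d) / c])/= !lte_fin.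
rewrite ltr_pdivrMr// divfK ?gt_eqF// ltrD2r.
case: ifP => _; rewrite ?mule0// -!EFinD -EFinM; congr (_%:E).
by field; rewrite gt_eqF.
Qed.

Lemma measurable_affineN n (c : R) (d : 'rV[R]_n) :
  measurable_fun [set: 'rV[R]_n] (fun x : 'rV[R]_n => c *: x + d).
Proof.
apply: (measurability _ (@measurable_oboxes R n)) => _ [_ [a [b ->]] <-].
rewrite setTI (_ : _ @^-1` _ = [set x : 'rV[R]_n | forall i,
   ((fun t => c * t + d ord0 i) @^-1` `]a i, b i[%classic : set (measurableTypeR R)) (x ord0 i)]).
  apply: (measurable_rV_box (A := fun i => (fun t => c * t + d ord0 i) @^-1` `]a i, b i[%classic)) => i.
  rewrite -[X in measurable X]setTI.
  apply: measurable_funD => //; exact: measurable_funM.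
by apply/seteqP; split => x /= xab i; have := xab i; rewrite !mxE in_itv/=.
Qed.

(** Preimages of boxes are boxes, so the one-dimensional case applies factor by factor. Dilations
    will give the measure of balls, translations the invariance of integrals. *)
Lemma lebesgueN_affine n (c : R) (d : 'rV[R]_n) (A : set 'rV[R]_n) : 0 < c ->
  measurable A ->
  ((c ^+ n)%:E * lebesgueN R n ((fun x => (c *: x + d)%R) @^-1` A) = lebesgueN R n A)%E.
Proof.
move=> c0 mA; have c'0 := exprn_ge0 n (ltW c0).
apply/esym.
rewrite [LHS](measure_eq_obox (m1 := lebesgueN R n)
  (m2 := mscale (NngNum c'0) (measure_function_pushforward__canonical__measure_function_Measure
     (lebesgueN R n) (@measurable_affineN n c d))))//; last exact: lebesgueN_cube.
move=> a b; rewrite /= /mscale/= /pushforward.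
rewrite (_ : _ @^-1` _ = [set x : 'rV[R]_n | forall i,
   ((fun t => c * t + d ord0 i) @^-1` `]a i, b i[%classic : set (measurableTypeR R)) (x ord0 i)]); last first.
  by apply/seteqP; split => x /= xab i; have := xab i; rewrite !mxE in_itv/=.
rewrite oboxE (lebesgueN_box (A := fun i => `]a i, b i[%classic)); last first.
  by move=> i; exact: measurable_itv.
rewrite (lebesgueN_box (A := fun i => (fun t => c * t + d ord0 i) @^-1` `]a i, b i[%classic)); last first.
  move=> i; rewrite -[X in measurable X]setTI.
  by apply: measurable_funD => //; exact: measurable_funM.
rewrite (_ : c ^+ n = \prod_(i < n) c); last by rewrite prodr_const card_ord.
rewrite -prodEFin -big_split/=; apply: eq_bigr => i _.
apply/esym/lebesgue_measure_affine => //; exact: measurable_itv.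
Qed.

End affine.

(** * Borel measurability and the Euclidean norm *)

Section continuous_measurable.
Context (R : realType) (n : nat).
Local Notation E := 'rV[R]_n.

(** An open set is the union of the cubes with rational centre and half-side [1/(k+1)] that it
    contains; there are countably many of them. *)
Lemma open_measurable_rV (O : set E) : open O -> measurable O.
Proof.
move=> oO.
pose cr (c : 'rV[rat]_n) (k : nat) : set E :=
  obox (fun i => ratr (c ord0 i) - k.+1%:R^-1) (fun i => ratr (c ord0 i) + k.+1%:R^-1).
pose F (j : 'rV[rat]_n * nat) : set E := if `[< cr j.1 j.2 `<=` O >] then cr j.1 j.2 else set0.
rewrite (_ : O = \bigcup_j F j).
  apply: countable_bigcupT_measurable => // j; rewrite /F; case: ifP => _ //.
  exact: measurable_obox.
apply/seteqP; split=> [x Ox|x [j _]]; last by rewrite /F; case: ifPn => // /asboolP; exact.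
have /nbhs_ballP [e /= e0 xeO] : nbhs x O by exact: open_nbhs_nbhs.
(* A cube of half-side [1/(k+1)] that contains [x] then lies within distance [e] of [x]. *)
have [k ke] : exists k, k.+1%:R^-1 < e / 2.
  exists (Num.bound (e / 2)^-1); rewrite invf_plt ?posrE ?divr_gt0//.
  apply: lt_trans (archi_boundP _) _; first by rewrite invr_ge0 divr_ge0// ltW.
  by rewrite ltr_nat.
have k0 : 0 < k.+1%:R^-1 :> R by rewrite invr_gt0 ltr0n.
have /choice[c hc] (i : 'I_n) : exists q : rat, x ord0 i - k.+1%:R^-1 < ratr q < x ord0 i + k.+1%:R^-1.
  have : x ord0 i - k.+1%:R^-1 < x ord0 i + k.+1%:R^-1 by rewrite ltrD2l gtrN.
  by move=> /rat_in_itvoo[q]; rewrite in_itv/=; exists q.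
exists (\row_i c i, k) => //; rewrite /F /cr /=.
case: asboolP => [_ i|].
  rewrite mxE; move: (hc i); move: (ratr (c i)) (k.+1%:R^-1) => q d.
  by move=> /andP[? ?]; apply/andP; split; lra.
case=> y yc; apply: xeO; rewrite -ball_normE /ball_/=.
move: (k.+1%:R^-1) ke k0 yc hc => d ke k0 yc hc.
apply: le_lt_trans (_ : d + d < e); last by lra.
apply: norm_le_coord => [|i]; first by rewrite addr_ge0 ?ltW.
rewrite !mxE ler_norml; have := yc i; have := hc i; rewrite mxE.
move: (ratr (c i)) => q /andP[? ?] /andP[? ?].
by apply/andP; split; lra.
Qed.

Lemma continuous_measurable_rV (f : E -> R) : continuous f ->
  measurable_fun [set: E] (f : E -> measurableTypeR R).
Proof.
move=> cf; apply: (measurability _ (RGenOpens.measurableE R)) => _ [_ [a [b ->]] <-].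
rewrite setTI; apply: open_measurable_rV; apply: open_comp => // x _; exact: cf.
Qed.

Lemma measurable_enorm : measurable_fun [set: E] (@enorm R n : E -> measurableTypeR R).
Proof.
apply: measurableT_comp; first exact: (continuous_measurable_fun (@sqrt_continuous R)).
apply: measurable_sum => i; apply: measurable_funX; exact: measurable_rV_coord.
Qed.

Lemma enorm_ge0 (x : E) : 0 <= enorm x.
Proof. exact: sqrtr_ge0. Qed.

Lemma sqr_enorm (x : E) : enorm x ^+ 2 = \sum_(i < n) x ord0 i ^+ 2.
Proof. by rewrite sqr_sqrtr// sumr_ge0// => i _; rewrite sqr_ge0. Qed.

Lemma enormZ c (x : E) : enorm (c *: x) = `|c| * enorm x.
Proof.
rewrite /enorm; under eq_bigr do rewrite mxE exprMn.
by rewrite -mulr_sumr sqrtrM ?sqr_ge0// sqrtr_sqr.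
Qed.

Lemma coord_le_enorm (x : E) i : `|x ord0 i| <= enorm x.
Proof.
rewrite -sqrtr_sqr ler_wsqrtr// (bigD1 i)//= lerDl sumr_ge0// => j _.
by rewrite sqr_ge0.
Qed.

Lemma enorm_le_coord (x : E) (e : R) : (forall i, `|x ord0 i| <= e) -> enorm x <= n%:R * e.
Proof.
move=> xe; have [n0|n0] := posnP n.
  rewrite /enorm big1 => [|i _]; last by have := ltn_ord i; rewrite {2}n0.
  by rewrite n0 mul0r sqrtr0.
have e0 : 0 <= e by apply: le_trans (xe (Ordinal n0)).
rewrite -(@ger0_norm _ (n%:R * e)) ?mulr_ge0// -sqrtr_sqr ler_wsqrtr//.
rewrite exprMn; apply: (@le_trans _ _ (\sum_(i < n) e ^+ 2)).
  by apply: ler_sum => i _; rewrite -real_normK ?num_real// lerXn2r ?nnegrE.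
rewrite sumr_const card_ord -(mulr_natl (e ^+ 2)) ler_wpM2r ?sqr_ge0// expr2.
by rewrite ler_peMl// ler1n.
Qed.

Lemma enorm_eq0 (x : E) : (enorm x == 0) = (x == 0).
Proof.
apply/eqP/eqP => [x0|->]; last by rewrite -(scale0r (0 : E)) enormZ normr0 mul0r.
apply/rowP => i; rewrite mxE; apply/eqP; rewrite -normr_eq0 eq_le normr_ge0 andbT.
by rewrite -x0 coord_le_enorm.
Qed.

Lemma enorm_gt0 (x : E) : (0 < enorm x) = (x != 0).
Proof. by rewrite lt_neqAle enorm_ge0 andbT eq_sym enorm_eq0. Qed.

Lemma continuous_enorm : continuous (@enorm R n).
Proof.
move=> x; apply: continuous_comp; last exact: sqrt_continuous.
apply: (@continuous_big _ _ _ _ xpredT) => [|i _ y]; first exact: add_continuous.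
apply: (@continuous_comp _ _ _ (fun x : E => x ord0 i) (fun t : R => t ^+ 2)); last exact: exprn_continuous.
exact: coord_continuous.
Qed.

End continuous_measurable.

(** * Integrals of radial functions *)

Section interval_comparison.
Context (R : realType) (m1 m2 : {measure set (measurableTypeR R) -> \bar R}).
Variable (D : R -> R).
Hypotheses (ndD : nondecreasing D) (cD : continuous D).
Hypothesis m2E : forall s t, s <= t ->
  m2 `]s, t]%classic = (m1 `]s, t]%classic + (D t - D s)%:E)%E.
Hypothesis m1oo : forall s t, (m1 `]s, t]%classic < +oo)%E.

Let rcD : right_continuous D.
Proof. by move=> x; apply: cvg_at_right_filter; exact: cD. Qed.

HB.instance Definition _ := isCumulative.Build R _ R D ndD rcD.

(* [m2] is the sum of [m1] and of the Stieltjes measure of [D]. *)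
Lemma le_measure_of_itv A : measurable A -> (m1 A <= m2 A)%E.
Proof.
move=> mA.
have -> : m2 A = measure_add m1 (lebesgue_stieltjes_measure D) A.
  apply: (@measure_unique _ R (measurableTypeR R) (@ocitv R)
    (fun k : nat => `](- k%:R), k%:R]%classic) _ _ _ _ m2
    (measure_add m1 (lebesgue_stieltjes_measure D))) => //.
  - exact: ocitvI.
  - by move=> k; exact: is_ocitv.
  - by apply/seteqP; split => // x _; have [M] := bound_coord (\row_(i < 1) x);
      move=> /(_ ord0); rewrite mxE ltr_norml => /andP[h1 h2]; exists M => //=;
      rewrite in_itv/= h1 ltW.
  - move=> _ [[s t] _ <-]; rewrite [RHS](measure_addE m1 (lebesgue_stieltjes_measure D))/=.
    have [st|ts] := leP s t; last first.
      by rewrite set_itv_ge ?measure0 ?adde0// bnd_simp -leNgt ltW.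
    rewrite m2E//; congr (_ + _)%E.
    rewrite /lebesgue_stieltjes_measure /measure_extension measurable_mu_extE/=.
      by rewrite wlength_itv_bnd.
    exact: is_ocitv.
  - move=> k; rewrite m2E ?lte_add_pinfty ?ltry//.
    by rewrite lerNl (le_trans (y := 0)) ?oppr_le0.
by rewrite [leRHS](measure_addE m1 (lebesgue_stieltjes_measure D)) leeDl.
Qed.

End interval_comparison.

Section radial_measure.
Context (R : realType) (n : nat).
Local Notation N := n.+1.
Local Notation E := 'rV[R]_N.
Local Notation mu := (lebesgueN R N).
Local Notation lam := (@lebesgue_measure R).

(** The law of [|x|]: integrals of radial functions become integrals on the line against this
    measure. *)
Definition radm := pushforward mu (@enorm R N : E -> measurableTypeR R).
HB.instance Definition _ := Measure.copy radm
  (measure_function_pushforward__canonical__measure_function_Measure mu (@measurable_enorm R N)).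

Definition cball (t : R) : set E := [set x | enorm x <= t].

Lemma measurable_cball t : measurable (cball t).
Proof.
rewrite -[cball t]setTI (_ : cball t = @enorm R N @^-1` `]-oo, t]%classic).
  exact: (@measurable_enorm R N _ _ (measurable_itv _)).
by apply/seteqP; split => x; rewrite /cball /= in_itv.
Qed.

Lemma lebesgueN_bounded (A : set E) (M : R) : measurable A ->
  (forall x i, A x -> `|x ord0 i| <= M) -> (mu A < +oo)%E.
Proof.
move=> mA AM; have [M0|M0] := ltP M 0.
  rewrite (_ : A = set0) ?measure0 ?ltry//.
  apply/seteqP; split => // x /AM - /(_ ord0) h.
  by have := le_lt_trans h M0; rewrite normr_lt0.
apply: le_lt_trans (@lebesgueN_cube R N (Num.bound M)).
apply: le_measure; rewrite ?inE//; first exact: measurable_obox.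
move=> x Ax i; rewrite -ltr_norml; apply: le_lt_trans (archi_boundP M0).
exact: AM.
Qed.

Lemma cball_lty t : (mu (cball t) < +oo)%E.
Proof.
apply: (@lebesgueN_bounded _ t); first exact: measurable_cball.
by move=> x i; exact/le_trans/coord_le_enorm.
Qed.

(** The volume of the unit ball; [radm] has cumulative function [omega * t^N] on the half-line. *)
Definition omega : R := fine (mu (cball 1)).

Lemma omegaE : mu (cball 1) = omega%:E.
Proof. by rewrite /omega fineK// ge0_fin_numE// cball_lty. Qed.

(** The unit ball contains the open cube of half-side [1/N]. *)
Lemma omega_gt0 : 0 < omega.
Proof.
rewrite -lte_fin -omegaE; pose e : R := N%:R^-1.
have e0 : 0 < e by rewrite invr_gt0 ltr0n.
apply: (@lt_le_trans _ _ (mu (obox (fun=> - e) (fun=> e)))).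
  rewrite lebesgueN_obox => [|i]; last by rewrite ltW// gtrN.
  by rewrite lte_fin prodr_gt0// => i _; rewrite opprK addr_gt0.
apply: le_measure; rewrite ?inE; [exact: measurable_obox|exact: measurable_cball|].
move=> x xe; rewrite /cball/=.
rewrite -(@mulfV _ (N%:R : R)) ?pnatr_eq0//; apply: enorm_le_coord => i.
by rewrite -/e ler_norml; have /andP[/ltW -> /ltW ->] := xe i.
Qed.

Lemma lebesgueN_cball t : 0 < t -> mu (cball t) = (omega * t ^+ N)%:E.
Proof.
move=> t0; rewrite -(@lebesgueN_affine _ _ t 0 (cball t) t0); last exact: measurable_cball.
rewrite (_ : _ @^-1` _ = cball 1); last first.
  apply/seteqP; split => x; rewrite /cball /= addr0 enormZ gtr0_norm//;
  by rewrite -ler_pdivlMl// mulVf ?gt_eqF.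
by rewrite omegaE -EFinM mulrC.
Qed.

Lemma radm_itv s t : 0 < s -> s <= t ->
  radm `]s, t]%classic = (omega * t ^+ N - omega * s ^+ N)%:E.
Proof.
move=> s0 st; rewrite /radm/= /pushforward.
rewrite (_ : _ @^-1` _ = cball t `\` cball s); last first.
  apply/seteqP; split => x; rewrite /cball /= in_itv/=.
    by move=> /andP[h1 ->]; split=> //; apply/negP; rewrite -ltNge.
  by move=> [-> /negP]; rewrite -ltNge => ->.
rewrite measureD; [|exact: measurable_cball..|exact: cball_lty].
rewrite (_ : cball t `&` cball s = cball s); last first.
  by apply/setIidPr => x; rewrite /cball/= => /le_trans; exact.
rewrite -[LHS]/((mu (cball t) - mu (cball s))%E) !lebesgueN_cball//.
exact: lt_le_trans st.
Qed.

(** In [(t - s) * sum_i t^(k-i) s^i] the sum has [k+1] terms, each at most [t^k], and its first term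
    [t^k] is at least [s^k]. This compares the increments of [omega * t^N] with lengths. *)
Lemma exprB_le (s t : R) k : 0 <= s -> s <= t ->
  (t - s) * s ^+ k <= t ^+ k.+1 - s ^+ k.+1 <= (t - s) * (k.+1%:R * t ^+ k).
Proof.
move=> s0 st; have t0 := le_trans s0 st; rewrite subrXX.
have ts0 : 0 <= t - s by rewrite subr_ge0.
apply/andP; split; rewrite ler_wpM2l//.
  rewrite big_ord_recl/= subn0 expr0 mulr1.
  apply: (@le_trans _ _ (t ^+ k)); first by rewrite lerXn2r ?nnegrE.
  by rewrite lerDl sumr_ge0// => i _; rewrite mulr_ge0// exprn_ge0.
rewrite (_ : k.+1%:R * t ^+ k = \sum_(i < k.+1) t ^+ k); last first.
  by rewrite sumr_const card_ord mulr_natl.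
apply: ler_sum => i _.
rewrite /= -[in leRHS](subnK (ltn_ord i : (i <= k)%N)) exprD.
by rewrite ler_wpM2l ?exprn_ge0// lerXn2r ?nnegrE.
Qed.

Section clamp.
Variables (a b : R).
Hypotheses (a0 : 0 < a) (ab : a < b).
Let D := `]a, b]%classic : set (measurableTypeR R).
Let mD : measurable D. Proof. exact: measurable_itv. Qed.
(** Clamping to [[a, b]] turns the trace of []s, t]] on [D] into []c s, c t]]. Measures restricted
    to [D] thus get explicit cumulative functions on the whole line, as [le_measure_of_itv]
    requires. *)
Let c (t : R) : R := Num.max a (Num.min t b).

Let c_bnd t : a <= c t <= b.
Proof. by rewrite /c le_max lexx/= ge_max ltW//= ge_min lexx orbT. Qed.

Let c_nd s t : s <= t -> c s <= c t.
Proof.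
move=> st; rewrite /c ge_max le_max lexx/= le_max; apply/orP; right.
by rewrite le_min !ge_min lexx st !orbT.
Qed.

Let c_cont : continuous c.
Proof.
move=> t; apply: (@continuous_max R R (cst a) (fun t => Num.min t b)); first exact: cvg_cst.
by apply: (@continuous_min R R idfun (cst b)); [exact: cvg_id|exact: cvg_cst].
Qed.

Let c_itv s t : s <= t -> `]s, t]%classic `&` D = `]c s, c t]%classic.
Proof.
move=> st; apply/seteqP; split => x; rewrite /D /= !in_itv/=.
  move=> [/andP[sx xt] /andP[ax xb]].
  by rewrite /c gt_max ax gt_min sx/= le_max le_min xt xb orbT.
rewrite /c gt_max gt_min le_max le_min => /andP[/andP[ax /orP h1] /orP h2].
rewrite ax /=; case: h2 => [xa|/andP[-> xb]]; first by have := lt_le_trans ax xa; rewrite ltxx.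
by rewrite xb andbT; split => //; case: h1 => // bx; have := lt_le_trans bx xb; rewrite ltxx.
Qed.

Let lamc s t : s <= t -> lam (`]s, t]%classic `&` D) = (c t - c s)%:E.
Proof.
move=> st; rewrite c_itv// [LHS](lebesgue_measure_itv `]c s, c t])/= lte_fin.
by have := c_nd st; rewrite le_eqVlt => /predU1P[->|->]; rewrite ?ltxx ?subrr ?EFinB.
Qed.

Let radc s t : s <= t -> radm (`]s, t]%classic `&` D) = (omega * c t ^+ N - omega * c s ^+ N)%:E.
Proof.
move=> st; rewrite c_itv// radm_itv ?c_nd//.
by have /andP[+ _] := c_bnd s; exact: lt_le_trans.
Qed.

Let mul_cvg (f : R -> R) (k : R) : continuous f -> continuous (fun t => k * f t).
Proof. by move=> cf t; apply: cvgM; [exact: cvg_cst|exact: cf]. Qed.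

Let cX_cont k : continuous (fun t => c t ^+ k).
Proof.
move=> t; apply: (@continuous_comp _ _ _ c (fun x : R => x ^+ k)); first exact: c_cont.
exact: exprn_continuous.
Qed.

Let lo0 : 0 <= omega * a ^+ n.
Proof. by rewrite mulr_ge0 ?exprn_ge0 ?ltW// omega_gt0. Qed.

Let hi0 : 0 <= omega * (N%:R * b ^+ n).
Proof. by rewrite !mulr_ge0 ?exprn_ge0 ?(ltW (lt_trans a0 ab))// ltW// omega_gt0. Qed.

(** On []a, b]] the difference of the two cumulative functions is nondecreasing by [exprB_le], hence
    so compare the measures. With [radm_upper] this stands in for polar coordinates. *)
Lemma radm_lower A : measurable A -> A `<=` `]a, b]%classic ->
  ((omega * a ^+ n)%:E * lam A <= radm A)%E.
Proof.
move=> mA AD.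
have : (mscale (NngNum lo0) (mrestr lam mD) A <= mrestr radm mD A)%E.
  apply: (@le_measure_of_itv _ _ _ (fun t => omega * c t ^+ N - omega * a ^+ n * c t)) => //.
  - move=> s t st.
    have /andP[h1 h2] := c_bnd s; have /andP[h3 h4] := c_bnd t.
    have c0 := le_trans (ltW a0) h1.
    have /andP[h _] := exprB_le n c0 (c_nd st).
    have hh : (c t - c s) * a ^+ n <= (c t - c s) * c s ^+ n.
      by rewrite ler_wpM2l ?subr_ge0 ?c_nd// lerXn2r ?nnegrE// ltW.
    rewrite -subr_ge0.
    rewrite (_ : _ - _ = omega * (c t ^+ N - c s ^+ N - (c t - c s) * a ^+ n)); last by ring.
    by rewrite mulr_ge0 ?(ltW omega_gt0)// subr_ge0 (le_trans hh).
  - by move=> t; exact: (cvgB (@mul_cvg _ omega (@cX_cont N) t) (@mul_cvg _ (omega * a ^+ n) c_cont t)).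
  - move=> s t st; rewrite -[LHS]/(radm (`]s, t]%classic `&` D)).
    rewrite -[X in (X + _)%E]/((omega * a ^+ n)%:E * lam (`]s, t]%classic `&` D))%E.
    by rewrite radc// lamc// -EFinM -EFinD; congr (_%:E); ring.
  - move=> s t; rewrite -[ltLHS]/((omega * a ^+ n)%:E * lam (`]s, t]%classic `&` D))%E.
    have [st|ts] := leP s t; first by rewrite lamc// ltry.
    by rewrite set_itv_ge ?set0I ?measure0 ?mule0// bnd_simp -leNgt ltW.
rewrite -[X in (X <= _)%E]/((omega * a ^+ n)%:E * lam (A `&` D))%E -[X in (_ <= X)%E]/(radm (A `&` D)).
by rewrite (setIidl AD).
Qed.

Lemma radm_upper A : measurable A -> A `<=` `]a, b]%classic ->
  (radm A <= (omega * (N%:R * b ^+ n))%:E * lam A)%E.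
Proof.
move=> mA AD.
have : (mrestr radm mD A <= mscale (NngNum hi0) (mrestr lam mD) A)%E.
  apply: (@le_measure_of_itv _ _ _ (fun t => omega * (N%:R * b ^+ n) * c t - omega * c t ^+ N)) => //.
  - move=> s t st.
    have /andP[h1 h2] := c_bnd s; have /andP[h3 h4] := c_bnd t.
    have c0 := le_trans (ltW a0) h1; have c0' := le_trans (ltW a0) h3.
    have /andP[_ h] := exprB_le n c0 (c_nd st).
    have hh : (c t - c s) * (N%:R * c t ^+ n) <= (c t - c s) * (N%:R * b ^+ n).
      by rewrite ler_wpM2l ?subr_ge0 ?c_nd// ler_wpM2l// lerXn2r ?nnegrE// ltW// (lt_trans a0).
    rewrite -subr_ge0.
    rewrite (_ : _ - _ = omega * ((c t - c s) * (N%:R * b ^+ n) - (c t ^+ N - c s ^+ N))); last by ring.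
    by rewrite mulr_ge0 ?(ltW omega_gt0)// subr_ge0 (le_trans h).
  - by move=> t; exact: (cvgB (@mul_cvg _ (omega * (N%:R * b ^+ n)) c_cont t) (@mul_cvg _ omega (@cX_cont N) t)).
  - move=> s t st; rewrite -[X in (X + _)%E]/(radm (`]s, t]%classic `&` D)).
    rewrite -[LHS]/((omega * (N%:R * b ^+ n))%:E * lam (`]s, t]%classic `&` D))%E.
    by rewrite radc// lamc// -EFinM -EFinD; congr (_%:E); ring.
  - move=> s t; rewrite -[ltLHS]/(radm (`]s, t]%classic `&` D)).
    have [st|ts] := leP s t; first by rewrite radc// ltry.
    by rewrite set_itv_ge ?set0I ?measure0// bnd_simp -leNgt ltW.
rewrite -[X in (_ <= X)%E]/((omega * (N%:R * b ^+ n))%:E * lam (A `&` D))%E -[X in (X <= _)%E]/(radm (A `&` D)).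
by rewrite (setIidl AD).
Qed.

Definition shell (s t : R) : set E := [set x | s < enorm x <= t].

Lemma shellE s t : shell s t = @enorm R N @^-1` `]s, t]%classic.
Proof. by apply/seteqP; split => x; rewrite /shell /= in_itv. Qed.

Lemma measurable_shell s t : measurable (shell s t).
Proof.
rewrite shellE -[X in measurable X]setTI.
exact: (@measurable_enorm R N _ _ (measurable_itv _)).
Qed.

Let restr_integral (m : {measure set (measurableTypeR R) -> \bar R}) (f : R -> \bar R) :
  (\int[mrestr m mD]_(x in D) f x = \int[m]_(x in D) f x)%E.
Proof. by apply: eq_measure_integral => A mA AD; rewrite -[LHS]/(m (A `&` D)) (setIidl AD). Qed.

Let int_shell (f : R -> \bar R) : measurable_fun [set: measurableTypeR R] f ->
  (forall t, 0 <= f t)%E ->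
  (\int[mu]_(x in shell a b) f (enorm x) = \int[radm]_(t in D) f t)%E.
Proof.
move=> mf f0; rewrite shellE.
rewrite (ge0_integral_pushforward (@measurable_enorm R N))//.
exact: measurable_funS mf.
Qed.

Lemma integral_shell_lower (f : R -> \bar R) : measurable_fun [set: measurableTypeR R] f ->
  (forall t, 0 <= f t)%E ->
  ((omega * a ^+ n)%:E * \int[lam]_(t in `]a, b]) f t <= \int[mu]_(x in shell a b) f (enorm x))%E.
Proof.
move=> mf f0; rewrite int_shell// -(restr_integral radm f) -(restr_integral lam f) -[X in (X * _)%E]/((NngNum lo0)%:num%:E).
rewrite -ge0_integral_mscale//; last exact: measurable_funS mf.
apply: ge0_le_measure_integral => // A mA; rewrite /mscale/= /mrestr/=.
by apply: radm_lower => //; exact: measurableI.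
Qed.

Lemma integral_shell_upper (f : R -> \bar R) : measurable_fun [set: measurableTypeR R] f ->
  (forall t, 0 <= f t)%E ->
  (\int[mu]_(x in shell a b) f (enorm x) <= (omega * (N%:R * b ^+ n))%:E * \int[lam]_(t in `]a, b]) f t)%E.
Proof.
move=> mf f0; rewrite int_shell// -(restr_integral radm f) -(restr_integral lam f) -[X in (_ <= X * _)%E]/((NngNum hi0)%:num%:E).
rewrite -ge0_integral_mscale//; last exact: measurable_funS mf.
apply: ge0_le_measure_integral => // A mA; rewrite /mscale/= /mrestr/=.
by apply: radm_upper => //; exact: measurableI.
Qed.

End clamp.

End radial_measure.

(** * Functions that are equal almost everywhere *)

Section ae_arbitrary.
Context d (T : measurableType d) (R : realType) (mu : {measure set T -> \bar R}).
Local Open Scope ereal_scope.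
Import HBNNSimple.

(* The integrals below are those of arbitrary, possibly non measurable,
   functions: suprema of the integrals of the simple functions below them. *)
Lemma ae_ge0_le_integralT (f g : T -> \bar R) :
  (forall x, 0 <= f x) -> (forall x, 0 <= g x) ->
  {ae mu, forall x, f x <= g x} -> \int[mu]_x f x <= \int[mu]_x g x.
Proof.
move=> f0 g0 [Z [mZ Z0 fgZ]]; rewrite !ge0_integralTE//.
apply: ge_ereal_sup => _ [h hf <-].
(* Setting a simple function to 0 on the null set [Z] keeps its integral and puts it below [g]
   everywhere. *)
apply: ereal_sup_ubound; exists (mul_nnsfun h (indic_nnsfun R (measurableC mZ))).
  move=> x /=; rewrite mindicE; have [xZ|xZ] := boolP (x \in ~` Z).
    rewrite mulr1; apply: le_trans (hf x) _; apply: contrapT => fg.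
    by move: xZ; rewrite in_setE; apply; apply: fgZ.
  by rewrite mulr0.
rewrite -!integralT_nnsfun; apply: ge0_ae_eq_integral => //=.
- by apply/measurable_EFinP; apply: measurable_funM => //; exact: measurable_funPT.
- by apply/measurable_EFinP; exact: measurable_funPT.
- by move=> x _; rewrite lee_fin mulr_ge0.
- by move=> x _; rewrite lee_fin.
exists Z; split => // x /=; apply: contra_notP => /= xZ _.
by rewrite mindicE mem_set// mulr1.
Qed.

Lemma ae_ge0_le_integral_any D (f g : T -> \bar R) :
  (forall x, D x -> 0 <= f x) -> (forall x, D x -> 0 <= g x) ->
  {ae mu, forall x, D x -> f x <= g x} ->
  \int[mu]_(x in D) f x <= \int[mu]_(x in D) g x.
Proof.
move=> f0 g0 fg; rewrite integral_mkcond [leRHS]integral_mkcond.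
apply: ae_ge0_le_integralT => [x|x|].
- by rewrite erestrict_ge0.
- by rewrite erestrict_ge0.
apply: filterS fg => x fgx; rewrite /patch; case: ifPn => // /set_mem; exact: fgx.
Qed.

Lemma ae_eq_integral_any D (f g : T -> \bar R) :
  {ae mu, forall x, D x -> f x = g x} ->
  \int[mu]_(x in D) f x = \int[mu]_(x in D) g x.
Proof.
move=> fg; rewrite integralE [RHS]integralE; congr (_ - _); apply/eqP;
  rewrite eq_le; apply/andP; split; apply: ae_ge0_le_integral_any => //;
  by apply: filterS fg => x fgx Dx; rewrite ?funeposE ?funenegE fgx.
Qed.

End ae_arbitrary.

Section borel_version.
Context d (T : measurableType d) (R : realType) (mu : {measure set T -> \bar R}).

(** Each set where [f] exceeds a given rational is Borel up to a null set. Outside the union [Z] of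
    these countably many null sets, [f] is Borel; redefine it as 0 off [D] and on [Z]. *)
Lemma lebesgue_measurable_borel (D : set T) (f : T -> R) : measurable D ->
  lebesgue_measurable_fun mu D f ->
  exists2 g : T -> R, measurable_fun [set: T] (g : T -> measurableTypeR R) &
    {ae mu, forall x, D x -> f x = g x}.
Proof.
move=> mD mf.
(* An enumeration of the rationals; naturals that code no rational are sent to 0. *)
pose q (k : nat) : rat := odflt 0 (unpickle k).
have H (k : nat) : exists BZ : set T * set T,
    [/\ measurable BZ.1, measurable BZ.2, mu BZ.2 = 0%E &
      forall x, D x -> ~ BZ.2 x -> (ratr (q k) < f x <-> BZ.1 x)].
  have [B mB [M [Z [mZ Z0 MZ]] BME]] := mf `]ratr (q k), +oo[%classic (measurable_itv _).
  exists (B, Z); split => //= x Dx Zx; split=> [qf|Bx].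
    have : (B `|` M) x by rewrite BME; split => //=; rewrite in_itv/= qf.
    by case=> // /MZ.
  have : (D `&` f @^-1` `]ratr (q k), +oo[%classic) x by rewrite -BME; left.
  by move=> [_]; rewrite /= in_itv/= andbT.
have {H} [BZ hBZ] := choice H.
pose Z := \bigcup_k (BZ k).2.
have mZ : measurable Z by apply: bigcup_measurable => k _; have [] := hBZ k.
have Z0 : mu.-negligible Z.
  apply: negligible_bigcup => k; have [_ mk k0 _] := hBZ k.
  exact/negligibleP.
exists (fun x => if x \in D `\` Z then f x else 0); last first.
  apply: negligibleS Z0 => x /= hx; apply: contrapT => Zx; apply: hx => Dx.
  by rewrite mem_set.
apply: (measurability _ (RGenOInfty.measurableE R)) => _ [_ [r ->] <-].
rewrite setTI.
pose C := (D `\` Z) `&` \bigcup_(k in [set k | r < ratr (q k)]) (BZ k).1.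
have mC : measurable C.
  apply: measurableI; first exact: measurableD.
  by apply: bigcup_measurable => k _; have [] := hBZ k.
have CE x : (D `\` Z) x -> C x <-> r < f x.
  move=> [Dx Zx]; have hx k : ratr (q k) < f x <-> (BZ k).1 x.
    by have [_ _ _ h] := hBZ k; apply: h => // xk; apply: Zx; exists k.
  split=> [[_ [k /= rk /hx]]|rf]; first exact: lt_trans.
  have [p] := rat_in_itvoo rf; rewrite in_itv/= => /andP[rp pf].
  split => //; exists (pickle p); first by rewrite /= /q pickleK.
  by apply/hx; rewrite /q pickleK.
(* Off [D \ Z] the value is 0, which exceeds [r] exactly when [r < 0]. *)
rewrite (_ : _ @^-1` _ = C `|` (~` (D `\` Z) `&` (if r < 0 then setT else set0))); last first.
  apply/seteqP; split => x /=; rewrite in_itv/= andbT.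
    by case: ifPn => [/set_mem /CE <-|/negP xDZ r0]; [left|right; rewrite r0; split => // h; apply: xDZ; rewrite inE].
  move=> [Cx|[xDZ]]; first by rewrite mem_set; [apply/CE => //; exact: Cx.1|exact: Cx.1].
  by rewrite memNset//; case: ifP.
apply: measurableU => //; apply: measurableI; last by case: ifP.
by apply: measurableC; exact: measurableD.
Qed.

Lemma ae_eq_lebesgue_measurable (D : set T) (f g : T -> R) : measurable D ->
  measurable_fun [set: T] (g : T -> measurableTypeR R) ->
  {ae mu, forall x, D x -> f x = g x} -> lebesgue_measurable_fun mu D f.
Proof.
move=> mD mg [Z [mZ Z0 fgZ]] B mB.
exists ((D `&` g @^-1` B) `\` Z).
  apply: measurableD => //; apply: measurableI => //.
  by rewrite -[X in measurable X]setTI; exact: mg.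
exists ((D `&` f @^-1` B) `&` Z).
  by apply: (@negligibleS _ _ _ _ Z) => //; exists Z; split.
have fg x : D x -> ~ Z x -> f x = g x.
  by move=> Dx; apply: contra_notP => fx; apply: fgZ => /= /(_ Dx).
apply/seteqP; split => x /=.
  by move=> [[[Dx gx] Zx]|[]//]; rewrite fg.
move=> [Dx fx]; have [Zx|Zx] := pselect (Z x); [by right|left].
by split => //; rewrite -fg.
Qed.

Lemma lebesgue_measurable_ge0_borel (D : set T) (f : T -> R) : measurable D ->
  (forall x, D x -> 0 <= f x) -> lebesgue_measurable_fun mu D f ->
  exists g : T -> R, [/\ measurable_fun [set: T] (g : T -> measurableTypeR R),
    forall x, 0 <= g x & {ae mu, forall x, D x -> f x = g x}].
Proof.
move=> mD f0 /(lebesgue_measurable_borel mD)[g mg fg].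
exists (fun x => `|g x|); split => //; first exact: measurableT_comp.
by apply: filterS fg => x fgx Dx; rewrite -fgx// ger0_norm// f0.
Qed.

End borel_version.

Section radial_ae.
Context (R : realType) (n : nat).
Local Notation E := 'rV[R]_n.+1.
Local Notation mu := (lebesgueN R n.+1).

Lemma ae_enorm_gt0 : {ae mu, forall x, 0 < enorm x}.
Proof.
have h x : (0 < enorm x) = (x != 0 :> E) by exact: enorm_gt0.
exists [set 0]; split.
- rewrite (_ : [set 0] = [set x : E | forall i, [set (0:R)] (x ord0 i)]).
    by apply: (measurable_rV_box (A := fun=> [set 0])) => i; exact: measurable_set1.
  by apply/seteqP; split => [x -> i|x x0]; rewrite /= ?mxE//; apply/rowP => i; rewrite mxE x0.
- rewrite (_ : [set 0] = [set x : E | forall i, [set (0:R)] (x ord0 i)]).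
    rewrite (lebesgueN_box (A := fun=> [set 0])); last by move=> i; exact: measurable_set1.
    by rewrite big_ord_recl lebesgue_measure_set1 mul0e.
  by apply/seteqP; split => [x -> i|x x0]; rewrite /= ?mxE//; apply/rowP => i; rewrite mxE x0.
- by move=> x /=; rewrite h; case: eqP.
Qed.

(** A null set of radii pulls back to a null set of points: on each shell [radm] is at most a
    multiple of Lebesgue measure, and countably many shells cover the space minus the origin. *)
Lemma ae_radial (P : R -> Prop) : {ae @lebesgue_measure R, forall t, 0 < t -> P t} ->
  {ae mu, forall x, 0 < enorm x -> P (enorm x)}.
Proof.
move=> [Z [mZ Z0 PZ]].
(* The outer radius [k+2] keeps the shell nondegenerate at [k = 0]. *)
pose S k := @shell R n (k.+1%:R^-1) (k.+2%:R) `&` (@enorm R n.+1) @^-1` Z.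
have mS k : measurable (S k).
  apply: measurableI; first exact: measurable_shell.
  by rewrite -[X in measurable X]setTI; exact: (@measurable_enorm R n.+1).
have k1 k : k.+1%:R^-1 < k.+2%:R :> R.
  by rewrite (@le_lt_trans _ _ 1) ?ltr1n// invf_le1 ?ltr0n// ler1n.
apply: (@negligibleS _ _ _ _ (\bigcup_k S k)); last first.
  apply: negligible_bigcup => k; apply/negligibleP => //.
  have k0 : 0 < k.+1%:R^-1 :> R by rewrite invr_gt0 ltr0n.
  have := @radm_upper R n _ _ k0 (k1 k) (`]k.+1%:R^-1, k.+2%:R]%classic `&` Z).
  rewrite -[X in (X <= _)%E]/(mu (@enorm R n.+1 @^-1` _)) => h; apply/eqP.
  rewrite eq_le measure_ge0 andbT.
  have -> : S k = @enorm R n.+1 @^-1` (`]k.+1%:R^-1, k.+2%:R]%classic `&` Z).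
    by rewrite /S shellE.
  apply: le_trans (h _ _) _; [exact: measurableI|exact: subIsetl|].
  rewrite (_ : lebesgue_measure _ = 0%E) ?mule0//.
  by apply: (@subset_measure0 _ _ _ _ _ Z) => //; exact: measurableI.
move=> x /= hx; have x0 : 0 < enorm x by apply: contra_notT hx => /negbTE ->.
have Zx : Z (enorm x) by apply: PZ => /= h; exact/hx/h.
exists (maxn (Num.bound (enorm x)) (Num.bound (enorm x)^-1)) => //; split => //=.
apply/andP; split.
  rewrite invf_plt ?posrE// (lt_le_trans (archi_boundP _))// ?invr_ge0 ?ltW//.
  by rewrite ltr_nat ltnS leq_maxr.
rewrite ltW// (lt_le_trans (archi_boundP (ltW x0)))//.
by rewrite ler_nat !leqW// leq_maxl.
Qed.

End radial_ae.

(** * Test functions *)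

Section smooth_line.
Context (R : realType).
Implicit Types (f g : R -> R) (p : {poly R}).

(** The derivatives are exhibited rather than computed, so that closure under sums, products and
    composition goes by plain induction. *)
Fixpoint Ck k f : Prop :=
  if k is k'.+1 then exists2 f', (forall x, is_derive x (1:R) f (f' x)) & Ck k' f'
  else continuous f.

Lemma is_derive_continuous f f' : (forall x, is_derive x (1:R) f (f' x)) -> continuous f.
Proof.
move=> ff' x; apply: differentiable_continuous; apply/derivable1_diffP.
by have [] := ff' x.
Qed.

Lemma Ck_continuous k f : Ck k f -> continuous f.
Proof. by case: k => // k [f' ff' _]; exact: is_derive_continuous ff'. Qed.

Lemma CkW k f : Ck k.+1 f -> Ck k f.
Proof.
elim: k f => [|k IHk] f; first exact: (@Ck_continuous 1).
by move=> [f' ff' cf']; exists f' => //; exact: IHk.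
Qed.

Lemma CkD k f g : Ck k f -> Ck k g -> Ck k (f + g).
Proof.
elim: k f g => [|k IHk] f g; first by move=> cf cg x; apply: cvgD; [exact: cf|exact: cg].
move=> [f' ff' cf'] [g' gg' cg']; exists (f' + g'); last exact: IHk.
by move=> x; exact: is_deriveD.
Qed.

Lemma CkM k f g : Ck k f -> Ck k g -> Ck k (f * g).
Proof.
elim: k f g => [|k IHk] f g; first by move=> cf cg x; apply: cvgM; [exact: cf|exact: cg].
move=> cf cg; have [f' ff' cf'] := cf; have [g' gg' cg'] := cg.
exists (f * g' + g * f') => [x|]; first exact: is_deriveM.
by apply: CkD; apply: IHk => //; exact: CkW.
Qed.

Lemma Ck_affine k f (c d : R) : Ck k f -> Ck k (fun t => f (c * t + d)).
Proof.
have dcd x : is_derive x (1:R) (fun t : R => c * t + d) c.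
  by apply: is_derive_eq; rewrite /GRing.scale/= !(mulr0,mulr1,add0r,addr0,mul0r).
elim: k f => [|k IHk] f.
  move=> cf x; apply: (@continuous_comp _ _ _ (fun t : R => c * t + d) f); last exact: cf.
  exact: is_derive_continuous dcd x.
move=> [f' ff' cf']; exists (fun t => f' (c * t + d) * c) => [x|].
  exact: (@is_derive1_comp _ f (fun t : R => c * t + d)).
apply: (@CkM k (fun t => f' (c * t + d)) (cst c)); first exact: IHk.
have cc j : forall c, Ck j (cst c).
  elim: j => [|j IHj] e; first exact: cst_continuous.
  by exists (cst 0) => // x; exact: is_derive_cst.
exact: cc.
Qed.

(** For [p = 1] this is the classical function that is flat at 0; the polynomial in [1/t] makes the
    family stable under differentiation. *)
Definition bump0 (c : R) p (t : R) : R :=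
  if 0 < t then p.[t^-1] * expR (- (c * t^-1)) else 0.

(** Induction on [p]: half of the exponential absorbs the extra factor [s], because
    [s * e^(-cs/2) <= 2/c], and the other half bounds the remaining polynomial. *)
Lemma poly_expR_bounded p c : 0 < c ->
  exists C, forall s, 0 < s -> `|p.[s]| * expR (- (c * s)) <= C.
Proof.
elim/poly_ind: p c => [|p a IHp] c c0.
  by exists 0 => s s0; rewrite horner0 normr0 mul0r.
have c20 : 0 < c / 2 by rewrite divr_gt0.
have [C hC] := IHp _ c20; exists (C * (c / 2)^-1 + `|a|) => s s0.
have E2 : expR (- (c * s)) = expR (- (c / 2 * s)) * expR (- (c / 2 * s)).
  by rewrite -expRD; congr expR; field.
have es : s * expR (- (c / 2 * s)) <= (c / 2)^-1.
  rewrite expRN ler_pdivrMr ?expR_gt0// ler_pdivlMl//.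
  by apply: le_trans (expR_ge1Dx _); rewrite lerDr.
have e1 : expR (- (c * s)) <= 1.
  by rewrite -expR0 ler_expR oppr_le0 mulr_ge0// ltW.
rewrite hornerMXaddC.
apply: (@le_trans _ _ ((`|p.[s] * s| + `|a|) * expR (- (c * s)))).
  by rewrite ler_wpM2r ?expR_ge0// ler_normD.
rewrite mulrDl; apply: lerD; last by rewrite ler_piMr.
rewrite E2 normrM (gtr0_norm s0).
rewrite (_ : _ * _ = (`|p.[s]| * expR (- (c / 2 * s))) * (s * expR (- (c / 2 * s)))); last by ring.
by apply: ler_pM; rewrite ?mulr_ge0 ?expR_ge0 ?(ltW s0)//; exact: hC.
Qed.

Lemma is_derive_bump0 c p t : 0 < c ->
  is_derive t (1:R) (bump0 c p) (bump0 c ((c%:P * p - p^`()) * 'X^2) t).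
Proof.
move=> c0; have [t0|t0|<-] := ltgtP 0 t.
- apply: (@near_eq_is_derive R R R (fun t => p.[t^-1] * expR (- (c * t^-1)))).
    near=> s; rewrite /bump0 ifT//; near: s; exact: lt_nbhsr.
  have tn : t != 0 by rewrite gt_eqF.
  have dv : is_derive t (1:R) (fun t : R => t^-1) (- t ^- 2).
    have := @is_deriveV R (@idfun R) t 1 1 tn (is_derive_id t 1).
    by rewrite /GRing.scale/= mulr1.
  have dp : is_derive t (1:R) (fun t : R => p.[t^-1]) (p^`().[t^-1] * - t ^- 2).
    exact: (@is_derive1_comp _ (horner p) (fun t : R => t^-1)).
  have de : is_derive t (1:R) (fun t : R => expR (- (c * t^-1)))
      (expR (- (c * t^-1)) * (c * t ^- 2)).
    apply: (@is_derive1_comp _ expR (fun t : R => - (c * t^-1))).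
    have := is_deriveN (is_deriveM (is_derive_cst c t (1:R)) dv).
    by rewrite /GRing.scale/= mulr0 addr0 mulrN opprK.
  apply: is_derive_eq (is_deriveM dp de) _.
  rewrite /bump0 t0 /GRing.scale/= !(hornerM, hornerD, hornerN, hornerC, hornerX).
  by field.
- apply: (@near_eq_is_derive R R R (cst 0)).
    near=> s; rewrite /bump0 ifF//; apply/negbTE; rewrite -leNgt ltW//; near: s; exact: lt_nbhsl.
  by rewrite /bump0 ifF ?(lt_gtF t0)//; exact: is_derive_cst.
(* At the origin, for [h > 0], the difference quotient is [h] times [p(1/h) h^-2 e^(-c/h)]; a bound
   for [p * 'X^2] makes it at most [C * |h|]. *)
have [C hC] := poly_expR_bounded (p * 'X^2) c0.
rewrite [X in is_derive _ _ _ X]/bump0 ltxx.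
suff h : h^-1 *: ((bump0 c p \o shift 0) (h *: (1 : R)) - bump0 c p 0) @[h --> 0^'] --> (0 : R).
  by split; [apply/cvg_ex; exists 0|exact/cvg_lim].
apply/norm_cvg0P.
apply: (@squeeze_cvgr _ _ _ _ (cst 0) (fun h => C * `|h|)); last 2 first.
- exact: cvg_cst.
- have H : `|h| @[h --> (0:R)^'] --> (0:R).
    have /continuous_withinNx : {for 0, continuous (fun h : R => `|h|)} by exact: norm_continuous.
    by rewrite normr0.
  have := @cvgM R R _ _ (cst C) (fun h => `|h|) C 0 (cvg_cst C) H; rewrite mulr0; exact.
have C0 : 0 <= C.
  apply: le_trans (hC 1 ltr01); by rewrite mulr_ge0// expR_ge0.
near=> h; rewrite normr_ge0/= /bump0 ltxx subr0 addr0 /GRing.scale/= mulr1.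
case: ifPn => h0; last by rewrite mulr0 normr0 mulr_ge0.
have hn : h != 0 by rewrite gt_eqF.
have := hC h^-1; rewrite invr_gt0 h0 => /(_ isT).
rewrite hornerM hornerXn => H.
rewrite (_ : h^-1 * _ = (p.[h^-1] * h^-1 ^+ 2 * expR (- (c * h^-1))) * h); last by field.
by rewrite normrM ler_wpM2r// normrM (ger0_norm (expR_ge0 _)).
Unshelve. all: by end_near. Qed.

Lemma Ck_bump0 k c p : 0 < c -> Ck k (bump0 c p).
Proof.
move=> c0; elim: k p => [|k IHk] p.
  by apply: is_derive_continuous => x; exact: is_derive_bump0.
by eexists; [move=> x; exact: is_derive_bump0|exact: IHk].
Qed.

Definition bump c (a b t : R) : R := bump0 c 1 (t - a) * bump0 c 1 (b - t).

Lemma Ck_bump k c a b : 0 < c -> Ck k (bump c a b).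
Proof.
move=> c0; apply: (@CkM k (fun t => bump0 c 1 (t - a)) (fun t => bump0 c 1 (b - t))).
  have := @Ck_affine k _ 1 (- a) (@Ck_bump0 k c 1 c0).
  by congr (Ck _ _); apply/funext => t; rewrite mul1r.
have := @Ck_affine k _ (-1) b (@Ck_bump0 k c 1 c0).
by congr (Ck _ _); apply/funext => t; rewrite mulN1r addrC.
Qed.

Lemma bump_out c a b t : ~~ (a < t < b) -> bump c a b t = 0.
Proof.
rewrite negb_and /bump /bump0 !subr_gt0 => /orP[/negbTE ->|/negbTE ->].
  by rewrite mul0r.
by rewrite mulr0.
Qed.

Lemma bump_itv c a b t : 0 <= c -> 0 <= bump c a b t <= 1.
Proof.
move=> c0.
have h u : 0 <= bump0 c 1 u <= 1.
  rewrite /bump0 hornerC mul1r; case: ifPn => u0; last by rewrite lexx ler01.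
  rewrite expR_ge0/= -expR0 ler_expR oppr_le0 mulr_ge0// invr_ge0 ltW//.
have /andP[h1 h2] := h (t - a); have /andP[h3 h4] := h (b - t).
by rewrite /bump mulr_ge0//= mulr_ile1.
Qed.

Lemma bump_cvg a b t :
  bump m.+1%:R^-1 a b t @[m --> \oo] --> ((a < t < b)%R%:R : R).
Proof.
have h u : bump0 m.+1%:R^-1 1 u @[m --> \oo] --> ((0 < u)%R%:R : R).
  rewrite /bump0; have [u0|u0] := boolP (0 < u); last exact: cvg_cst.
  have -> : (fun m : nat => (1 : {poly R}).[u^-1] * expR (- (m.+1%:R^-1 / u))) =
      (fun m => expR (- (m.+1%:R^-1 * u^-1))).
    by apply/funext => m; rewrite hornerC mul1r.
  suff : expR (- (m.+1%:R^-1 * u^-1)) @[m --> \oo] --> expR (0 : R) by rewrite expR0.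
  apply: continuous_cvg; first exact: continuous_expR.
  rewrite -oppr0; apply: cvgN; rewrite -(mul0r u^-1); apply: cvgM; last exact: cvg_cst.
  exact: cvg_harmonic.
by rewrite -(subr_gt0 a t) -(subr_gt0 t b) -mulnb natrM; apply: cvgM; exact: h.
Qed.

End smooth_line.

Section smooth_space.
Context (R : realType) (n : nat).
Local Notation E := 'rV[R]_n.
Implicit Types (u v : E -> R).

Fixpoint CkN k u : Prop :=
  continuous u /\
  if k is k'.+1 then forall i : 'I_n, exists2 v,
    (forall x, is_derive x (delta_mx ord0 i : E) u (v x)) & CkN k' v
  else True.


Lemma CkNW k u : CkN k.+1 u -> CkN k u.
Proof.
elim: k u => [|k IHk] u [cu du]; split => // i.
by have [v uv cv] := du i; exists v => //; exact: IHk.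
Qed.

Lemma CkN_cst k (c : R) : CkN k (cst c).
Proof.
elim: k c => [|k IHk] c; split => //; try exact: cst_continuous.
by move=> i; exists (cst 0) => // x; exact: is_derive_cst.
Qed.

Lemma CkND k u v : CkN k u -> CkN k v -> CkN k (u + v).
Proof.
elim: k u v => [|k IHk] u v [cu du] [cv dv].
  by split=> // x; exact: (cvgD (cu x) (cv x)).
split=> [x|i]; first by exact: (cvgD (cu x) (cv x)).
have [u' hu' cu'] := du i; have [v' hv' cv'] := dv i.
by exists (u' + v'); [move=> x; exact: is_deriveD|exact: IHk].
Qed.

Lemma CkNM k u v : CkN k u -> CkN k v -> CkN k (u * v).
Proof.
elim: k u v => [|k IHk] u v [cu du] [cv dv].
  by split=> // x; exact: (cvgM (cu x) (cv x)).
split=> [x|i]; first by exact: (cvgM (cu x) (cv x)).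
have [u' hu' cu'] := du i; have [v' hv' cv'] := dv i.
exists (u * v' + v * u'); first by move=> x; exact: is_deriveM.
by apply: CkND; apply: IHk => //; exact: CkNW.
Qed.

Lemma CkN_coord k (f : R -> R) (i : 'I_n) : Ck k f -> CkN k (fun x : E => f (x ord0 i)).
Proof.
have cont g : continuous g -> continuous (fun x : E => (g : R -> R) (x ord0 i)).
  move=> cg x; apply: (@continuous_comp _ _ _ (fun x : E => x ord0 i) g); last exact: cg.
  exact: coord_continuous.
elim: k f => [|k IHk] f; first by move=> cf; split => //; exact: cont.
move=> cf; split; first exact/cont/Ck_continuous/cf.
have [f' ff' cf'] := cf => j.
exists ((fun x : E => f' (x ord0 i)) * cst (j == i)%:R); last first.
  by apply: CkNM; [exact: IHk|exact: CkN_cst].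
move=> x; suff : is_derive x (delta_mx ord0 j : E) (fun x0 : E => f (x0 ord0 i))
  (f' (x ord0 i) * (j == i)%:R) by [].
have [->|ij] := eqVneq j i.
  rewrite mulr1; have [df vf] := ff' (x ord0 i).
  have e : (fun h : R => h^-1 *: (((fun x0 : E => f (x0 ord0 i)) \o shift x) (h *: delta_mx ord0 i) - f (x ord0 i)))
     = (fun h : R => h^-1 *: ((f \o shift (x ord0 i)) (h *: (1:R)) - f (x ord0 i))).
    by apply/funext => h /=; rewrite !mxE !eqxx.
  split; first by move: df; rewrite /derivable -e.
  by rewrite -vf /derive -e.
rewrite mulr0.
have e : (fun h : R => h^-1 *: (((fun x0 : E => f (x0 ord0 i)) \o shift x) (h *: delta_mx ord0 j) - f (x ord0 i)))
     = cst 0.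
  apply/funext => h /=; rewrite !mxE eqxx/= eq_sym (negbTE ij).
  by rewrite mulr0 add0r subrr scaler0.
split; first by rewrite /derivable e; exact: is_cvg_cst.
by rewrite /derive e lim_cst.
Qed.

Lemma partial_is_derive i u u' :
  (forall x, is_derive x (delta_mx ord0 i : E) u (u' x)) -> partial i u = u'.
Proof. by move=> h; apply/funext => x; rewrite /partial derive_val. Qed.

Lemma partials_rcons s i u : partials (rcons s i) u = partials s (partial i u).
Proof. by elim: s => //= j s ->. Qed.

(** Induction on the last index of [s], which [partials] differentiates first, so that the induction
    hypothesis applies to the exhibited derivative. *)
Lemma CkN_smooth u : (forall k, CkN k u) -> smooth u.
Proof.
move=> cu s; move: (cu (size s).+1).
elim/last_ind: s u {cu} => [|s i IHs] u.
  move=> [cu du]; split => // i x; have [v hv _] := du i.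
  by have [] := hv x.
rewrite size_rcons partials_rcons => -[_ /(_ i)[v uv cv]].
by rewrite (partial_is_derive uv); exact: IHs.
Qed.

(* The exponent [- c / t] of the one-dimensional bumps makes [box_bump c a b] tend to the
   indicator of the open box as [c] tends to 0. *)
Definition box_bump (c : R) (a b : 'I_n -> R) : E -> R :=
  \prod_(i < n) (fun x => bump c (a i) (b i) (x ord0 i)).

Lemma box_bumpE c a b x : box_bump c a b x = \prod_(i < n) bump c (a i) (b i) (x ord0 i).
Proof.
rewrite /box_bump; elim/big_ind2 : _ => //; last by move=> u s v t <- <-.
Qed.

Lemma smooth_box_bump c a b : 0 < c -> smooth (box_bump c a b).
Proof.
move=> c0; apply: CkN_smooth => k; rewrite /box_bump.
elim/big_ind : _ => [|u v|i _]; [exact: CkN_cst|exact: CkNM|].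
exact/CkN_coord/Ck_bump.
Qed.

Lemma box_bump_out c a b x : ~ obox a b x -> box_bump c a b x = 0.
Proof.
move=> /existsNP[i /negP abx]; rewrite box_bumpE (bigD1 i)//=.
by rewrite bump_out ?mul0r.
Qed.

Definition cbox (a b : 'I_n -> R) : set E := [set x | forall i, a i <= x ord0 i <= b i].

Lemma closed_cbox a b : closed (cbox a b).
Proof.
rewrite (_ : cbox a b = \bigcap_(i in [set: 'I_n]) ((fun x : E => x ord0 i) @^-1` `[a i, b i]%classic)).
  apply: closed_bigI => i _; apply: preimage_closed => [x _|]; first exact: coord_continuous.
  exact: interval_closed.
by apply/seteqP; split => x abx i; [move=> _|]; have := abx i; rewrite /= in_itv/=; apply.
Qed.

Lemma compact_cbox a b : compact (cbox a b).
Proof.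
apply: bounded_closed_compact; last exact: closed_cbox.
exists (\sum_(i < n) (`|a i| + `|b i|)); split; first exact: num_real.
move=> M hM x abx /=; apply: le_trans (ltW hM).
apply: norm_le_coord => [|i]; first by rewrite sumr_ge0// => i _; rewrite addr_ge0.
rewrite (bigD1 i)//=; apply: (@le_trans _ _ (`|a i| + `|b i|)); last first.
  by rewrite lerDl sumr_ge0// => j _; rewrite addr_ge0.
have /andP[h1 h2] := abx i; rewrite ler_norml; apply/andP; split.
  by apply: le_trans h1; rewrite lerNl; apply: (le_trans (ler_norm _)); rewrite normrN lerDl.
by apply: le_trans h2 _; apply: (le_trans (ler_norm _)); rewrite lerDr.
Qed.

Lemma supp_box_bump c a b : supp (box_bump c a b) `<=` cbox a b.
Proof.
rewrite /supp; apply: (subset_trans (B := closure (cbox a b))); last first.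
  by rewrite -(closure_id _).1; [exact: subset_refl|exact: closed_cbox].
apply: closureS => x /= hx i.
have : obox a b x by apply: contrapT => /(box_bump_out c) h; move: hx; rewrite h eqxx.
by move=> /(_ i) /andP[/ltW -> /ltW ->].
Qed.

Lemma Cc_infty_box_bump c a b : 0 < c -> Cc_infty (box_bump c a b).
Proof.
move=> c0; split; first exact: smooth_box_bump.
apply: (subclosed_compact _ (@compact_cbox a b)); first exact: closed_closure.
exact: supp_box_bump.
Qed.

Lemma box_bump_itv c a b x : 0 <= c -> 0 <= box_bump c a b x <= 1.
Proof.
move=> c0; rewrite box_bumpE; apply/andP; split.
  by apply: prodr_ge0 => i _; have /andP[] := bump_itv (a i) (b i) (x ord0 i) c0.
apply: le_trans (_ : \prod_(i < n) (1 : R) <= 1); last by rewrite big1.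
by apply: ler_prod => i _; exact: bump_itv.
Qed.

Lemma box_bump_cvg a b x :
  box_bump m.+1%:R^-1 a b x @[m --> \oo] --> (\1_(obox a b) x : R).
Proof.
have -> : \1_(obox a b) x = \prod_(i < n) ((a i < x ord0 i < b i)%R%:R : R).
  rewrite indicE; case: (boolP (x \in obox a b)) => [/set_mem xab|xab].
    by rewrite big1// => i _; rewrite (xab i).
  have /existsNP[i /negP xi] : ~ obox a b x by move=> h; move: xab; rewrite mem_set.
  by rewrite (bigD1 i)//= (negbTE xi) mul0r.
have -> : (fun m : nat => box_bump m.+1%:R^-1 a b x) =
    (fun m : nat => \prod_(i < n) bump m.+1%:R^-1 (a i) (b i) (x ord0 i)).
  by apply/funext => m; rewrite box_bumpE.
apply: cvg_big => [|i _]; first exact: mul_continuous.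
exact: bump_cvg.
Qed.

End smooth_space.

(** * Uniqueness of the weak gradient *)

Section fundamental_lemma.
Context (R : realType) (n : nat).
Local Notation E := 'rV[R]_n.+1.
Local Notation mu := (lebesgueN R n.+1).
Implicit Types (f u phi : E -> R).

Lemma measurable_compact (C : set E) : compact C -> measurable C.
Proof.
move=> cC; rewrite -[C]setCK; apply: measurableC; apply: open_measurable_rV.
by apply: closed_openC; apply: compact_closed => //; exact: norm_hausdorff.
Qed.

Lemma Cc_bounded phi : continuous phi -> compact (supp phi) ->
  exists2 M : R, 0 <= M & forall x, `|phi x| <= M.
Proof.
move=> cp cs; have [s0|s0] := pselect (supp phi !=set0).
  have [|c _ hc] := compact_EVT_max s0 cs (f := fun x => `|phi x|).
    apply: continuous_subspaceT => x.
    by apply: (@continuous_comp _ _ _ phi Num.norm); [exact: cp|exact: norm_continuous].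
  exists `|phi c| => // x; have [->|px] := eqVneq (phi x) 0; first by rewrite normr0.
  by apply: hc; rewrite inE; apply: subset_closure.
exists 0 => // x; rewrite normr_le0; apply: contrapT => /negP px.
by apply: s0; exists x; exact: subset_closure.
Qed.

Lemma supp_out phi x : ~ supp phi x -> phi x = 0.
Proof. by move=> h; apply: contrapT => /eqP px; apply: h; exact: subset_closure. Qed.

Lemma smooth_continuous phi : smooth phi -> continuous phi.
Proof. by move=> sp; have [] := sp [::]. Qed.

(** Borel counterpart of [L1loc_off0]: the library theorems on integrals apply to such functions. *)
Definition L1loc f := measurable_fun setT (f : E -> measurableTypeR R) /\
  forall C : set E, compact C -> C `<=` [set~ 0] ->
    (\int[mu]_(x in C) `|f x|%:E < +oo)%E.

Lemma L1loc_off0_borel f : L1loc_off0 f ->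
  exists2 g, L1loc g & {ae mu, forall x, f x = g x}.
Proof.
move=> [mf hf].
have m0 : measurable [set~ (0 : E)].
  by apply: measurableC; apply: measurable_compact; exact: compact_set1.
have [g mg fg] := lebesgue_measurable_borel m0 mf.
have fg' : {ae mu, forall x, f x = g x}.
  apply: filterS2 fg (ae_enorm_gt0 R n) => x fgx x0; apply: fgx => /= x00.
  by move: x0; rewrite enorm_gt0 x00 eqxx.
exists g => //; split => // C cC C0.
rewrite -(@ae_eq_integral_any _ _ _ mu C (fun x => `|f x|%:E)); first exact: hf.
by apply: filterS fg' => x ->.
Qed.

Lemma L1loc_Cc_integrable f phi : L1loc f -> continuous phi -> compact (supp phi) ->
  ~ supp phi 0 -> mu.-integrable setT (EFin \o (fun x => f x * phi x)).
Proof.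
move=> [mf hf] cp cs s0; have [M M0 hM] := Cc_bounded cp cs.
have mphi := continuous_measurable_rV cp.
have mS := measurable_compact cs.
apply/integrableP; split.
  by apply/measurable_EFinP; exact: measurable_funM.
have S0 : supp phi `<=` [set~ 0] by move=> x sx x0; apply: s0; rewrite -x0.
apply: (@le_lt_trans _ _ (\int[mu]_x ((fun x => M%:E * `|f x|%:E) \_ (supp phi)) x)%E).
  apply: ge0_le_integral => //.
  - apply/measurable_EFinP; apply: measurableT_comp => //; exact: measurable_funM.
  - apply/(measurable_restrictT _ mS); apply: measurable_funS (measurableT) _ _ => //.
    by apply/measurable_EFinP; apply: measurable_funM => //; exact: measurableT_comp.
  - move=> x _; rewrite /patch; case: ifPn => [_|/negP sx].
      by rewrite -EFinM lee_fin normrM mulrC ler_wpM2r.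
    by rewrite /= (supp_out (phi := phi)) ?mulr0 ?normr0// => h; apply: sx; rewrite inE.
rewrite -integral_mkcond ge0_integralZl//; last first.
  by apply/measurable_EFinP; apply: measurable_funS (measurableT) _ _ => //; exact: measurableT_comp.
by apply: lte_mul_pinfty => //; exact: hf.
Qed.

(** One coordinate keeps a strict sign on the closed box, which separates it from the origin and
    makes the bumps of the box admissible test functions. *)
Definition off0 (a b : 'I_n.+1 -> R) := exists i, (0 < a i) \/ (b i < 0).

Lemma off0_cbox a b : off0 a b -> cbox a b `<=` [set~ 0].
Proof.
move=> [i h] x xab x0; have /andP[] := xab i; rewrite x0 mxE => h1 h2.
by case: h => h; [have := lt_le_trans h h1|have := le_lt_trans h2 h]; rewrite ltxx.
Qed.

Lemma obox_cbox a b : @obox R n.+1 a b `<=` cbox a b.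
Proof. by move=> x h i; have /andP[/ltW -> /ltW ->] := h i. Qed.

Lemma L1loc_box_integrable f a b : L1loc f -> off0 a b ->
  mu.-integrable (obox a b) (EFin \o f).
Proof.
move=> [mf hf] ab0; apply/integrableP; split.
  by apply/measurable_EFinP; exact: measurable_funS mf.
apply: (@le_lt_trans _ _ (\int[mu]_(x in cbox a b) `|f x|%:E)%E).
  apply: ge0_subset_integral => //; [exact: measurable_obox| | |exact: obox_cbox].
    by apply: measurable_compact; exact: compact_cbox.
  by apply/measurable_EFinP; apply: measurable_funS (measurableT) _ _ => //; exact: measurableT_comp.
by apply: hf; [exact: compact_cbox|exact: off0_cbox].
Qed.

Section null.
Variable f : E -> R.
Hypothesis Lf : L1loc f.
Hypothesis f_null : forall phi, Cc_infty phi -> ~ supp phi 0 ->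
  (\int[mu]_x (f x * phi x)%:E = 0)%E.

(** The smooth bumps tend to the indicator of the box and are dominated by it, so dominated
    convergence passes from test functions to the box. *)
Let int_box a b : off0 a b -> (\int[mu]_(x in obox a b) (f x)%:E = 0)%E.
Proof.
move=> ab0; have mQ := @measurable_obox R n.+1 a b.
have [mf _] := Lf.
have c0 m : 0 < m.+1%:R^-1 :> R by rewrite invr_gt0.
have Cb m := @Cc_infty_box_bump R n.+1 _ a b (c0 m).
pose g := (fun x => `|f x|%:E) \_ (obox a b).
have -> : (\int[mu]_(x in obox a b) (f x)%:E = \int[mu]_x (f x * \1_(obox a b) x)%:E)%E.
  rewrite integral_mkcond; apply: eq_integral => x _; rewrite /patch indicE.
  by case: ifP => _; rewrite ?mulr1 ?mulr0.
have [] := @dominated_convergence _ _ _ mu setT measurableT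
  (fun m x => (f x * box_bump m.+1%:R^-1 a b x)%:E) (fun x => (f x * \1_(obox a b) x)%:E) g.
- move=> m; apply/measurable_EFinP; apply: measurable_funM => //.
  apply: continuous_measurable_rV; apply: smooth_continuous; exact: (Cb m).1.
- by apply/measurable_EFinP; apply: measurable_funM.
- apply: aeW => x _; apply: cvg_EFin; first exact: nearW.
  by apply: cvgM; [exact: cvg_cst|exact: box_bump_cvg].
- apply: (proj1 (integrable_mkcond _ mQ)).
  by have /integrable_abse := L1loc_box_integrable Lf ab0.
- apply: aeW => x m _; rewrite /g /patch; case: ifPn => [_|/negP xQ].
    rewrite lee_fin normrM ler_piMr//.
    by have /andP[h1 h2] := box_bump_itv a b x (ltW (c0 m)); rewrite ger0_norm.
  rewrite box_bump_out ?mulr0 ?abse0; first exact: lexx.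
  by move=> h; apply: xQ; rewrite inE.
move=> _ _; rewrite (_ : [sequence _]_m = cst 0%E); last first.
  apply/funext => m /=; apply: f_null => //.
  by move=> /supp_box_bump /(off0_cbox ab0); apply.
by move=> /cvg_lim <-//; rewrite lim_cst.
Qed.

(** The Borel sets [S] for which [f] has integral 0 over [S] intersected with the box form a Dynkin
    system that contains all boxes. *)
Let ae_box a b : off0 a b -> {ae mu, forall x, obox a b x -> f x = 0}.
Proof.
move=> ab0; set Q := obox a b; have mQ : measurable Q := @measurable_obox R n.+1 a b.
have intQ := L1loc_box_integrable Lf ab0.
have P (S : set E) : measurable S -> (\int[mu]_(x in S `&` Q) (f x)%:E = 0)%E.
  rewrite measurable_oboxes; move: S.
  apply: (@dynkin_induction _ E (@oboxes R n.+1)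
    (fun S => (\int[mu]_(x in S `&` Q) (f x)%:E = 0)%E)).
  - exact: measurable_oboxes.
  - by move=> _ _ [a1 [b1 ->]] [a2 [b2 ->]]; rewrite oboxI; do 2 eexists.
  - by rewrite setTI int_box.
  - move=> _ [a1 [b1 ->]]; rewrite oboxI int_box//.
    have [i hi] := ab0; exists i; rewrite lt_max gt_min.
    by case: hi => ->; rewrite orbT; [left|right].
  - move=> S mS S0.
    have : (\int[mu]_(x in (S `&` Q) `|` (~` S `&` Q)) (f x)%:E = 0)%E.
      by rewrite -setIUl setUCr setTI int_box.
    rewrite integral_setU; first by rewrite S0 add0e.
    - exact: measurableI.
    - by apply: measurableI => //; exact: measurableC.
    - by apply/measurable_EFinP; apply: measurable_funS Lf.1.
    - by apply/disj_setPS => x /= [[Sx _] [/(_ Sx)]].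
  - move=> F mF tF F0; rewrite setI_bigcupl integral_bigcup.
    + by rewrite eseries0// => i _ _; exact: F0.
    + exact: trivIset_setIr.
    + by move=> k; exact: measurableI.
    + rewrite -setI_bigcupl; apply: integrableS intQ => //.
      by apply: measurableI => //; exact: bigcup_measurable.
have := @integral_ae_eq _ _ _ mu Q mQ (cst 0%E) (EFin \o f) intQ.
move=> /(_ (measurable_cst _)) H.
have : ae_eq mu Q (EFin \o f) (cst 0%E).
  apply: H => S SQ mS; rewrite integral0 -[RHS](P S mS).
  by rewrite setIidl.
by apply: filterS => x h /h /= [].
Qed.

Lemma fundamental_lemma : {ae mu, forall x, f x = 0}.
Proof.
(* Countably many boxes cover the complement of the origin: the [i]-th coordinate stays in
   []1/(k+1), k[] or in []-k, -1/(k+1)[], the others in []-k, k[]. *)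
pose ap i k (j : 'I_n.+1) : R := if j == i then k.+1%:R^-1 else - k%:R.
pose an k (j : 'I_n.+1) : R := - k%:R.
pose bp k (j : 'I_n.+1) : R := k%:R.
pose bn i k (j : 'I_n.+1) : R := if j == i then - k.+1%:R^-1 else k%:R.
have k0 k : 0 < k.+1%:R^-1 :> R by rewrite invr_gt0.
(* The direction is a natural number read through [inord], so that [ae_foralln] applies. *)
have H1 : {ae mu, forall x, forall k (i : nat), obox (ap (inord i) k) (bp k) x -> f x = 0}.
  apply/ae_foralln => k; apply/ae_foralln => i; apply: ae_box.
  by exists (inord i); left; rewrite /ap eqxx.
have H2 : {ae mu, forall x, forall k (i : nat), obox (an k) (bn (inord i) k) x -> f x = 0}.
  apply/ae_foralln => k; apply/ae_foralln => i; apply: ae_box.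
  by exists (inord i); right; rewrite /bn eqxx oppr_lt0.
apply: filterS3 H1 H2 (ae_enorm_gt0 R n) => x h1 h2 x0.
have /eqP/rowP x00 : x != 0 by rewrite -enorm_gt0.
have /existsNP[i xi0] : ~ (forall i, x ord0 i = 0) by move=> h; apply: x00 => i; rewrite h mxE.
have [M xM] := bound_coord x.
pose k := maxn M (Num.bound `|x ord0 i|^-1).
have xi1 : k.+1%:R^-1 < `|x ord0 i|.
  rewrite invf_plt ?posrE ?normr_gt0//; last exact/eqP.
  rewrite (lt_trans (archi_boundP _)) ?invr_ge0//.
  by rewrite ltr_nat ltnS leq_maxr.
have xk j : `|x ord0 j| < k%:R.
  by rewrite (lt_le_trans (xM j))// ler_nat leq_maxl.
have [xp|xn] := leP 0 (x ord0 i).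
  apply: (h1 k i); rewrite inord_val => j; rewrite /ap /bp.
  have := xk j; rewrite ltr_norml => /andP[l1 ->]; rewrite andbT.
  by case: eqP => [->|//]; move: xi1; rewrite ger0_norm.
apply: (h2 k i); rewrite inord_val => j; rewrite /an /bn.
have := xk j; rewrite ltr_norml => /andP[-> l1] /=.
by case: eqP => [->|//]; move: xi1; rewrite ltr0_norm// ltrNr.
Qed.

End null.

(** The fundamental lemma applies to each coordinate of the difference, after passing to Borel
    versions. It follows that [wgrad] may be replaced in integrals by any explicit weak gradient. *)
Lemma weak_gradient_unique u g g' : weak_gradient u g -> weak_gradient u g' ->
  {ae mu, forall x, g x = g' x}.
Proof.
move=> [_ Lg hg] [_ Lg' hg'].
suff H (i : nat) : {ae mu, forall x, g x ord0 (inord i : 'I_n.+1) = g' x ord0 (inord i)}.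
  have := ae_foralln H; apply: filterS => x h; apply/rowP => i.
  by have := h i; rewrite inord_val.
move: (inord i) => {}i.
have [f Lf gf] := L1loc_off0_borel (Lg i); have [f' Lf' gf'] := L1loc_off0_borel (Lg' i).
have [mf If] := Lf; have [mf' If'] := Lf'.
suff : {ae mu, forall x, f x - f' x = 0}.
  by apply: filterS3 gf gf' => x -> -> /eqP; rewrite subr_eq0 => /eqP.
apply: fundamental_lemma.
  split; first exact: measurable_funB.
  move=> C cC C0; have mC := measurable_compact cC.
  apply: (@le_lt_trans _ _ (\int[mu]_(x in C) (`|f x|%:E + `|f' x|%:E))%E).
    apply: ge0_le_integral => //.
    - apply/measurable_EFinP; apply: measurable_funS (measurableT) _ _ => //.
      by apply: measurableT_comp => //; exact: measurable_funB.
    - apply/measurable_EFinP; apply: measurable_funS (measurableT) _ _ => //.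
      by apply: measurable_funD => //; exact: measurableT_comp.
    - by move=> x _; rewrite lee_fin ler_normB.
  rewrite ge0_integralD//.
  - by rewrite lte_add_pinfty//; [exact: If|exact: If'].
  - apply/measurable_EFinP; apply: measurable_funS (measurableT) _ _ => //.
    exact: measurableT_comp.
  - apply/measurable_EFinP; apply: measurable_funS (measurableT) _ _ => //.
    exact: measurableT_comp.
move=> phi cphi sphi; have [sp cs] := cphi; have cp := smooth_continuous sp.
have I1 := L1loc_Cc_integrable Lf cp cs sphi.
have I2 := L1loc_Cc_integrable Lf' cp cs sphi.
have -> : (\int[mu]_x ((f x - f' x) * phi x)%:E =
    \int[mu]_x (f x * phi x)%:E - \int[mu]_x (f' x * phi x)%:E)%E.
  rewrite -(integralB_EFin measurableT I1 I2).
  by apply: eq_integral => x _; rewrite mulrBl EFinB.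
have -> : (\int[mu]_x (f x * phi x)%:E = \int[mu]_x (g x ord0 i * phi x)%:E)%E.
  by apply: ae_eq_integral_any; apply: filterS gf => x ->.
have E2 : (\int[mu]_x (f' x * phi x)%:E = \int[mu]_x (g' x ord0 i * phi x)%:E)%E.
  by apply: ae_eq_integral_any; apply: filterS gf' => x ->.
have fin := integrable_fin_num measurableT I2.
have := hg' _ cphi sphi i; rewrite hg// => /oppe_inj ->.
by rewrite -E2 subee.
Qed.

End fundamental_lemma.

(** * Integration by parts *)

Section integration_by_parts.
Context (R : realType) (n : nat).
Local Notation E := 'rV[R]_n.+1.
Local Notation mu := (lebesgueN R n.+1).
Implicit Types (u psi phi : E -> R).

Lemma ge0_integral_translate (f : E -> \bar R) (d : E) :
  measurable_fun setT f -> (forall x, 0 <= f x)%E ->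
  (\int[mu]_x f (x + d)%R = \int[mu]_x f x)%E.
Proof.
move=> mf f0; pose tr (x : E) := 1 *: x + d.
have mt : measurable_fun setT tr by exact: measurable_affineN.
have trE (A : set E) : measurable A -> mu A = pushforward mu tr A.
  by move=> mA; rewrite -(@lebesgueN_affine R n.+1 1 d A ltr01 mA) expr1n mul1e.
transitivity (\int[pushforward mu tr]_x f x)%E; last first.
  apply: eq_measure_integral => A mA _; exact: (esym (trE _ mA)).
rewrite (ge0_integral_pushforward mt)// preimage_setT.
by apply: eq_integral => x _; rewrite /= /tr scale1r.
Qed.

Lemma integral_translate (f : E -> \bar R) (d : E) :
  measurable_fun setT f -> (\int[mu]_x f (x + d)%R = \int[mu]_x f x)%E.
Proof.
move=> mf; rewrite integralE [RHS]integralE; congr (_ - _)%E.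
  rewrite -[RHS](@ge0_integral_translate f^\+%E d)//; last exact: measurable_funepos.
  by apply: eq_integral => x _; rewrite !funeposE.
rewrite -[RHS](@ge0_integral_translate f^\-%E d)//; last exact: measurable_funeneg.
by apply: eq_integral => x _; rewrite !funenegE.
Qed.

Lemma is_derive_line psi psi' (e x : E) (t : R) :
  (forall x, is_derive x e psi (psi' x)) ->
  is_derive t (1:R) (fun t : R => psi (t *: e + x)) (psi' (t *: e + x)).
Proof.
move=> /(_ (t *: e + x))[dp vp].
have H : (fun h : R => h^-1 *: (((fun t : R => psi (t *: e + x)) \o shift t) (h *: (1:R)) - psi (t *: e + x)))
    = (fun h : R => h^-1 *: ((psi \o shift (t *: e + x)) (h *: e) - psi (t *: e + x))).
  by apply/funext => h /=; rewrite [X in psi ((X + t) *: e + x)]mulr1 scalerDl addrA.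
by split; [move: dp; rewrite /derivable -H|rewrite -vp /derive -H].
Qed.

(** The derivative is the limit of difference quotients, whose integrals vanish by translation
    invariance; the mean value theorem dominates them by a constant on a bounded box. *)
Lemma integral_derivative_eq0 psi psi' (e : E) (M : R) :
  `|e| <= 1 ->
  (forall x, is_derive x e psi (psi' x)) -> continuous psi -> continuous psi' ->
  (forall x, psi x != 0 -> `|x| <= M) ->
  (\int[mu]_x (psi' x)%:E = 0)%E.
Proof.
move=> e1 dpsi cpsi cpsi' sM.
(* The steps have length at most 1, so every difference quotient vanishes outside this box. *)
pose B := @cbox R n.+1 (fun=> - (M + 1)) (fun=> M + 1).
have cB : compact B by exact: compact_cbox.
have mB := measurable_compact cB.
have outB x : ~ B x -> M + 1 < `|x|.
  move=> xB; rewrite ltNge; apply/negP => xM; apply: xB => i.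
  by rewrite -ler_norml (le_trans (coord_le_norm _ _)).
have Bfin : (mu B < +oo)%E.
  apply: (@lebesgueN_bounded _ _ _ (M + 1)) => // x i /(_ i).
  by rewrite ler_norml.
(* The larger box contains the intermediate points that the mean value theorem yields for [x] in
   [B]. *)
pose Q := @cbox R n.+1 (fun=> - (M + 2)) (fun=> M + 2).
have [C C0 hC] : exists2 C : R, 0 <= C & forall x, Q x -> `|psi' x| <= C.
  have cQ : compact Q by exact: compact_cbox.
  have [Q0|Q0] := pselect (Q !=set0); last by exists 0 => // x Qx; case: Q0; exists x.
  have [|c _ hc] := compact_EVT_max Q0 cQ (f := fun x => `|psi' x|).
    apply: continuous_subspaceT => x.
    by apply: (@continuous_comp _ _ _ psi' Num.norm); [exact: cpsi'|exact: norm_continuous].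
  by exists `|psi' c| => // x Qx; apply: hc; rewrite inE.
have mpsi := continuous_measurable_rV cpsi.
have mpsi' := continuous_measurable_rV cpsi'.
have Ipsi : mu.-integrable setT (EFin \o psi).
  have [D D0 hD] : exists2 D : R, 0 <= D & forall x, `|psi x| <= D.
    apply: Cc_bounded => //; apply: (subclosed_compact _ cB); first exact: closed_closure.
    rewrite /supp; apply: (subset_trans (B := closure B)); last first.
      by rewrite -(closure_id _).1; [exact: subset_refl|exact: closed_cbox].
    apply: closureS => x /= /sM xM; apply: contrapT => /outB.
    by apply/negP; rewrite -leNgt (le_trans xM)// lerDl.
  apply/integrableP; split; first exact/measurable_EFinP.
  apply: (@le_lt_trans _ _ (\int[mu]_x ((cst D%:E) \_ B) x)%E).
    apply: ge0_le_integral => //.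
    - by apply/measurable_EFinP; apply: measurableT_comp.
    - by apply/(measurable_restrictT _ mB).
    - move=> x _; rewrite /patch; case: ifPn => [_|/negP xB].
        by rewrite lee_fin.
      suff px : psi x = 0 by rewrite /= px normr0; exact: lexx.
      apply: contrapT => /eqP /sM xM.
      have /outB : ~ B x by move=> h; apply: xB; rewrite inE.
      by rewrite ltNge (le_trans xM)// lerDl.
  by rewrite -integral_mkcond integral_cst// lte_mul_pinfty.
pose h (m : nat) : R := m.+1%:R^-1.
have h0 m : 0 < h m by rewrite invr_gt0.
have h1 m : h m <= 1 by rewrite invf_le1 ?ler1n.
pose q m x := (h m)^-1 * (psi (h m *: e + x) - psi x).
have mq m : measurable_fun setT (q m).
  apply: measurable_funM => //; apply: measurable_funB => //.
  rewrite (_ : (fun x => _) = psi \o (fun x : E => 1 *: x + h m *: e)).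
    by apply: measurableT_comp => //; exact: measurable_affineN.
  by apply/funext => x; rewrite /= scale1r addrC.
have [] := @dominated_convergence _ _ _ mu setT measurableT
  (fun m x => (q m x)%:E) (fun x => (psi' x)%:E) ((cst C%:E) \_ B).
- by move=> m; apply/measurable_EFinP.
- exact/measurable_EFinP.
- apply: aeW => x _; apply: cvg_EFin; first exact: nearW.
  have [dp <-] := dpsi x.
  apply: (@cvg_comp _ _ _ h (fun k : R => k^-1 *: ((psi \o shift x) (k *: e) - psi x)) _ (0^')); last exact: dp.
  move=> P P0; have P0' : \forall y \near (0:R), y != 0 -> P y by exact: P0.
  have H : \forall m \near \oo, h m != 0 -> P (h m) := @cvg_harmonic R _ P0'.
  suff : \forall m \near \oo, P (h m) by [].
  by apply: filterS H => m; apply; rewrite gt_eqF.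
- apply: (proj1 (integrable_mkcond _ mB)).
  apply/integrableP; split => //.
  by under eq_integral do rewrite /=; rewrite integral_cst// lte_mul_pinfty.
- apply: aeW => x m _; rewrite /patch; case: ifPn => [xB|/negP xB].
    have cline : {within `[0, h m], continuous (fun t : R => psi (t *: e + x))}.
      apply: continuous_subspaceT; apply: is_derive_continuous => t.
      exact: (is_derive_line x t dpsi).
    have [c] := MVT (h0 m) (fun t _ => is_derive_line x t dpsi) cline.
    rewrite in_itv/= => /andP[c0 ch]; rewrite scale0r add0r subr0 => hE.
    rewrite lee_fin /q hE normrM normrM mulrCA -normrM mulVf ?gt_eqF// normr1 mulr1.
    apply: hC => i; rewrite -ler_norml mxE.
    have xi := set_mem xB i; rewrite /= -ler_norml in xi.
    apply: (le_trans (ler_normD _ _)); rewrite [M + 2](_ : _ = 1 + (M + 1)); last by ring.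
    apply: lerD => //; rewrite mxE normrM mulr_ile1 ?normr_ge0//.
      by rewrite gtr0_norm// (le_trans (ltW ch)).
    exact: le_trans (coord_le_norm _ _) e1.
  have Bx : M + 1 < `|x| by apply: outB => xB'; apply: xB; rewrite inE.
  rewrite /q (_ : psi x = 0); last first.
    by apply: contrapT => /eqP /sM; apply/negP; rewrite -ltNge (lt_trans _ Bx)// ltrDl.
  rewrite (_ : psi (h m *: e + x) = 0) ?subr0 ?mulr0 ?abse0; first exact: lexx.
  apply: contrapT => /eqP /sM; apply/negP; rewrite -ltNge.
  have : `|x| <= `|h m *: e + x| + `|h m *: e|.
    by rewrite -{1}(addKr (h m *: e) x) addrC (le_trans (ler_normB _ _)).
  have : `|h m *: e| <= 1.
    by rewrite normrZ mulr_ile1// gtr0_norm.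
  move: Bx; lra.
move=> _ _; rewrite (_ : [sequence _]_m = cst 0%E); last first.
  apply/funext => m /=; rewrite /q.
  pose psih x := psi (x + h m *: e).
  have Ih : (\int[mu]_x `|psih x|%:E = \int[mu]_x `|psi x|%:E)%E.
    apply: (@integral_translate (fun x => `|psi x|%:E) (h m *: e)).
    by apply/measurable_EFinP; exact: measurableT_comp.
  have Ipsih : mu.-integrable setT (EFin \o psih).
    apply/integrableP; split.
      apply/measurable_EFinP; rewrite (_ : psih = psi \o (fun x : E => 1 *: x + h m *: e)).
        by apply: measurableT_comp => //; exact: measurable_affineN.
      by apply/funext => x; rewrite /psih /= scale1r.
    by rewrite [X in (X < _)%E]Ih; have /integrableP[] := Ipsi.
  transitivity (((h m)^-1)%:E * \int[mu]_x ((EFin \o psih) \- (EFin \o psi)) x)%E.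
    rewrite -integralZl//; last exact: integrableB.
    by apply: eq_integral => x _; rewrite /= /psih [x + _]addrC EFinM EFinB.
  rewrite (integralB_EFin measurableT Ipsih Ipsi).
  rewrite (@integral_translate (EFin \o psi) (h m *: e)); last exact/measurable_EFinP.
  by rewrite subee ?mule0//; exact: integrable_fin_num.
by move=> /cvg_lim <-//; rewrite lim_cst.
Qed.

Lemma smooth_is_derive u i x : smooth u -> is_derive x (delta_mx ord0 i : E) u (partial i u x).
Proof. by move=> su; apply: derivableP; have [_] := su [::]; apply. Qed.

Lemma smooth_partial_continuous u i : smooth u -> continuous (partial i u).
Proof. by move=> su; have [] := su [:: i]. Qed.

Lemma norm_delta (i : 'I_n.+1) : `|delta_mx ord0 i : E| <= 1.
Proof.
apply: norm_le_coord => // j; rewrite mxE eqxx/=.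
by case: (_ == _); rewrite ?normr1 ?normr0.
Qed.

Lemma supp_bounded phi : compact (supp phi) -> exists2 M : R, 0 < M & forall x, supp phi x -> `|x| <= M.
Proof. by move=> /compact_bounded /pinfty_ex_gt0[M M0 hM]; exists M. Qed.

Lemma integral_by_parts u phi i : smooth u -> Cc_infty phi ->
  (\int[mu]_x (u x * partial i phi x + phi x * partial i u x)%:E = 0)%E.
Proof.
move=> su [sp /supp_bounded [M M0 hM]].
have cu := smooth_continuous su; have cp := smooth_continuous sp.
have cu' := @smooth_partial_continuous u i su; have cp' := @smooth_partial_continuous phi i sp.
apply: (@integral_derivative_eq0 (u * phi) (u * partial i phi + phi * partial i u) (delta_mx ord0 i) M).
- exact: norm_delta.
- by move=> x; apply: is_deriveM; exact: smooth_is_derive.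
- by move=> x; exact: (cvgM (cu x) (cp x)).
- by move=> x; exact: (cvgD (cvgM (cu x) (cp' x)) (cvgM (cp x) (cu' x))).
move=> x ux; apply: hM; apply: subset_closure => /=.
have {}ux : u x * phi x != 0 by [].
by apply: contraNN ux => /eqP ->; rewrite mulr0.
Qed.

End integration_by_parts.

(** * Radial profiles *)

Section radial_profile.
Context (R : realType) (n : nat).
Local Notation E := 'rV[R]_n.+1.
Local Notation mu := (lebesgueN R n.+1).
Local Notation e0 := (delta_mx ord0 ord0 : E).

(** Restricting to a whole axis, rather than to positive radii, keeps the profile of a smooth
    function differentiable everywhere. *)
Definition profile (u : E -> R) (t : R) : R := u (t *: e0).
Definition dprofile (u : E -> R) (t : R) : R := partial ord0 u (t *: e0).

Lemma enorm_delta (i : 'I_n.+1) : enorm (delta_mx ord0 i : E) = 1.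
Proof.
rewrite /enorm (bigD1 i)//= mxE !eqxx/= big1 ?addr0 ?expr1n ?sqrtr1// => j ji.
by rewrite mxE eqxx/= (negbTE ji) expr0n.
Qed.

Lemma radialE u x : radial u -> u x = profile u (enorm x).
Proof. by apply; rewrite enormZ enorm_delta mulr1 ger0_norm// enorm_ge0. Qed.

Lemma is_derive_profile u t : smooth u -> is_derive t (1:R) (profile u) (dprofile u t).
Proof.
move=> su; have := is_derive_line 0 t (fun x => smooth_is_derive ord0 x su).
by rewrite addr0 (_ : (fun t => _) = profile u)//; apply/funext => s; rewrite addr0.
Qed.

Lemma continuous_dprofile u : smooth u -> continuous (dprofile u).
Proof.
move=> su t; apply: (@continuous_comp _ _ _ (fun t : R => t *: e0) (partial ord0 u)).
  exact: scalel_continuous.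
exact: smooth_partial_continuous.
Qed.

(** The squared norm along a coordinate line is a quadratic polynomial in [h]; the norm itself is
    then differentiated through the square root, away from 0. *)
Lemma is_derive_enorm_sqr (x : E) (i : 'I_n.+1) :
  is_derive (0:R) (1:R) (fun h : R => enorm (h *: delta_mx ord0 i + x) ^+ 2) (2 * x ord0 i).
Proof.
have -> : (fun h : R => enorm (h *: delta_mx ord0 i + x) ^+ 2) =
   (fun h => h * h + (h * (2 * x ord0 i) + enorm x ^+ 2)).
  apply/funext => h; rewrite !sqr_enorm (bigD1 i)//= [in RHS](bigD1 i)//= !mxE !eqxx mulr1.
  rewrite (eq_bigr (fun j => x ord0 j ^+ 2)); first by ring.
  by move=> j ji; rewrite !mxE eqxx/= (negbTE ji) mulr0 add0r.
by apply: is_derive_eq; rewrite /GRing.scale/= !(mul0r,mulr0,add0r,addr0,mulr1).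
Qed.

(** Along the line through [x] in direction [i], [u] is its profile composed with the norm; the
    chain rule gives the formula. *)
Lemma partial_radial u i (x : E) : smooth u -> radial u -> x != 0 ->
  partial i u x = dprofile u (enorm x) / enorm x * x ord0 i.
Proof.
move=> su ru; rewrite -enorm_gt0 => x0.
have d1 := is_derive_line x 0 (fun x => smooth_is_derive i x su).
rewrite scale0r add0r in d1.
have d2 := is_derive_enorm_sqr x i.
have s0 : 0 < enorm (0 *: delta_mx ord0 i + x : E) ^+ 2 by rewrite scale0r add0r exprn_gt0.
have d3 := @is_derive1_comp R Num.sqrt
  (fun h : R => enorm (h *: delta_mx ord0 i + x : E) ^+ 2) 0 _ _ (is_derive1_sqrt s0) d2.
have e3 : (Num.sqrt \o (fun h : R => enorm (h *: delta_mx ord0 i + x : E) ^+ 2)) =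
   (fun h : R => enorm (h *: delta_mx ord0 i + x : E)).
  by apply/funext => h; rewrite /= sqrtr_sqr ger0_norm// enorm_ge0.
rewrite e3 scale0r add0r sqrtr_sqr (gtr0_norm x0) in d3.
have d4 := @is_derive1_comp R (profile u) (fun h : R => enorm (h *: delta_mx ord0 i + x : E)) 0
  (dprofile u (enorm x)) _ _ d3.
have {}d4 := d4 ltac:(rewrite scale0r add0r; exact: is_derive_profile).
have e4 : (profile u \o (fun h : R => enorm (h *: delta_mx ord0 i + x : E))) =
  (fun h : R => u (h *: delta_mx ord0 i + x)).
  by apply/funext => h; rewrite /= -radialE.
rewrite e4 in d4.
rewrite -(@derive_val _ _ _ _ _ _ _ d1) (@derive_val _ _ _ _ _ _ _ d4).
by field; rewrite gt_eqF.
Qed.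

Lemma enorm_grad_radial u (x : E) : smooth u -> radial u -> x != 0 ->
  enorm (grad u x) = `|dprofile u (enorm x)|.
Proof.
move=> su ru x0; have -> : grad u x = (dprofile u (enorm x) / enorm x) *: x.
  by apply/rowP => i; rewrite !mxE partial_radial.
have x1 : 0 < enorm x by rewrite enorm_gt0.
by rewrite enormZ normrM normfV (gtr0_norm x1) divfK// gt_eqF.
Qed.

End radial_profile.

(** * Oscillation of a profile in terms of the energy *)

Section osc.
Context (R : realType) (n : nat) (p : R) (p1 : 1 < p).
Local Notation E := 'rV[R]_n.+1.
Local Notation mu := (lebesgueN R n.+1).
Local Notation lam := (@lebesgue_measure R).
Local Notation om := (omega R n).

Let p0 : 0 < p. Proof. exact: lt_trans p1. Qed.

Definition renergy (w f : R -> R) : \bar R :=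
  (\int[mu]_x (w (enorm x) * `|f (enorm x)| `^ p)%:E)%E.

(* Replaces Hoelder's inequality: [y] is controlled by its [p]-th power, with a parameter [d]
   to be optimised after integration. *)
Lemma powR_trick (d y : R) : 0 < d -> 0 <= y -> y <= d + d `^ (1 - p) * y `^ p.
Proof.
move=> d0 y0; have [yd|dy] := leP y d.
  by apply: (le_trans yd); rewrite lerDl mulr_ge0// powR_ge0.
have yp : 0 < y by exact: lt_trans dy.
(* For [y > d] the second term alone dominates [y], since [(y/d)^(p-1) >= 1]. *)
rewrite (_ : d `^ (1 - p) * y `^ p = y * (y / d) `^ (p - 1)).
  apply: (@le_trans _ _ (y * (y / d) `^ (p - 1))); last by rewrite lerDr ltW.
  rewrite ler_peMr//; apply: (@le_trans _ _ (1 `^ (p - 1))); first by rewrite powR1.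
  apply: ge0_ler_powR; rewrite ?nnegrE ?divr_ge0 ?(ltW d0)//; first by rewrite subr_ge0 ltW.
  by rewrite ler_pdivlMr// mul1r ltW.
have -> : y `^ p = y * y `^ (p - 1).
  by rewrite -{2}(powRr1 y0) -powRD ?gt_eqF ?implybT// addrC subrK.
have -> : (y / d) `^ (p - 1) = y `^ (p - 1) * d `^ (1 - p).
  rewrite powRM ?invr_ge0 ?(ltW d0)//; congr (_ * _).
  by rewrite -powR_inv1 ?(ltW d0)// -powRrM mulN1r opprB.
by rewrite mulrC mulrA.
Qed.

Section estimate.
Variables (w : R -> R) (mw : measurable_fun setT (w : R -> measurableTypeR R))
  (w0 : forall r, 0 <= w r).
Variables (a b al : R).
Hypotheses (a0 : 0 < a) (ab : a < b) (al0 : 0 < al) (wal : forall r, a < r <= b -> al <= w r).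

Lemma measurable_powRabs (f : R -> R) : measurable_fun setT (f : R -> measurableTypeR R) ->
  measurable_fun setT ((fun r => `|f r| `^ p) : R -> measurableTypeR R).
Proof.
move=> mf; apply: (measurableT_comp (measurable_powR p)); exact: measurableT_comp.
Qed.

(** The factor [om * a^n] comes from the shell comparison, and [al] bounds the weight from below. *)
Lemma renergy_itv (f : R -> R) : measurable_fun setT (f : R -> measurableTypeR R) ->
  ((om * a ^+ n * al)%:E * \int[lam]_(r in `]a, b]) (`|f r| `^ p)%:E <= renergy w f)%E.
Proof.
move=> mf; have mfp := measurable_powRabs mf.
have al0' := ltW al0.
have me (D : set E) (g : R -> R) : measurable D -> measurable_fun setT (g : R -> measurableTypeR R) ->
    measurable_fun D (fun x : E => (g (enorm x))%:E).
  move=> mD mg; apply/measurable_EFinP; apply: measurable_funS (measurableT) _ _ => //.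
  exact: (measurableT_comp mg (@measurable_enorm R n.+1)).
rewrite mulrC EFinM -muleA.
apply: (@le_trans _ _ (al%:E * \int[mu]_(x in shell a b) (`|f (enorm x)| `^ p)%:E)%E).
  apply: lee_wpmul2l => //.
  apply: (@integral_shell_lower R n a b a0 ab (fun r => (`|f r| `^ p)%:E)).
    exact/measurable_EFinP.
  by move=> r; rewrite lee_fin powR_ge0.
have mS : measurable (shell a b : set E) by exact: measurable_shell.
rewrite -ge0_integralZl//; last exact: (me _ (fun r => `|f r| `^ p)).
apply: (@le_trans _ _ (\int[mu]_(x in shell a b) (w (enorm x) * `|f (enorm x)| `^ p)%:E)%E).
  apply: ge0_le_integral => //.
  - by move=> x _; rewrite mule_ge0 ?lee_fin ?powR_ge0.
  - under eq_fun do rewrite -EFinM.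
    apply: (me _ (fun r => al * `|f r| `^ p)) => //.
    exact: measurable_funM.
  - apply: (me _ (fun r => w r * `|f r| `^ p)) => //.
    exact: measurable_funM.
  - by move=> x xab; rewrite -EFinM lee_fin ler_wpM2r ?powR_ge0// wal.
apply: ge0_subset_integral => //.
- apply: (me _ (fun r => w r * `|f r| `^ p)) => //; exact: measurable_funM.
by move=> x _; rewrite lee_fin mulr_ge0// powR_ge0.
Qed.

Variables (U dU : R -> R).
Hypotheses (UdU : forall t, is_derive t (1:R) U (dU t)) (cdU : continuous dU).
Hypothesis Jfin : (renergy w dU < +oo)%E.

Let c := om * a ^+ n * al.
Let c0 : 0 < c. Proof. by rewrite !mulr_gt0 ?exprn_gt0// omega_gt0. Qed.
Let J := fine (renergy w dU).

Let J0 : (0 <= renergy w dU)%E.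
Proof. by apply: integral_ge0 => x _; rewrite lee_fin mulr_ge0// powR_ge0. Qed.

Let mdU : measurable_fun setT (dU : R -> measurableTypeR R).
Proof. exact: continuous_measurable_fun. Qed.

Let int_le : (\int[lam]_(r in `]a, b]) (`|dU r| `^ p)%:E <= (J / c)%:E)%E.
Proof.
have := renergy_itv mdU; rewrite -/c -lee_pdivlMl// => h.
by rewrite (le_trans h)// /J mulrC EFinM lee_pmul2l// ?lte_fin ?invr_gt0// fineK// ge0_fin_numE.
Qed.

(** The fundamental theorem of calculus bounds the increment by the integral of [|dU|], to which
    [powR_trick] applies pointwise. *)
Let osc_delta s t d : a <= s -> s < t -> t <= b -> 0 < d ->
  `|U t - U s| <= d * (t - s) + d `^ (1 - p) * (J / c).
Proof.
move=> as_ st tb d0.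
have cU : continuous U by exact: is_derive_continuous UdU.
have ftc : (\int[lam]_(r in `[s, t]) (dU r)%:E = (U t)%:E - (U s)%:E)%E.
  apply: (@continuous_FTC2 R dU U s t st).
  - exact: continuous_subspaceT.
  - split.
    + by move=> r _; have [] := UdU r.
    + by apply: cvg_at_right_filter; exact: cU.
    + by apply: cvg_at_left_filter; exact: cU.
  - by move=> r _; rewrite derive1E derive_val.
rewrite -lee_fin -abse_EFin EFinB -ftc.
have mD : measurable (`[s, t]%classic : set (measurableTypeR R)) by exact: measurable_itv.
have mD' : measurable (`]s, t]%classic : set (measurableTypeR R)) by exact: measurable_itv.
have mdU' D : measurable D -> measurable_fun D (fun r => (`|dU r|)%:E).
  move=> mD0; apply/measurable_EFinP; apply: measurable_funS (measurableT) _ _ => //.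
  exact: measurableT_comp.
have mdUp D : measurable D -> measurable_fun D (fun r => (`|dU r| `^ p)%:E).
  move=> mD0; apply/measurable_EFinP; apply: measurable_funS (measurableT) _ _ => //.
  exact: measurable_powRabs.
apply: (le_trans (le_abse_integral _ _ _)) => //.
  by apply/measurable_EFinP; exact: measurable_funS mdU.
rewrite -integral_itv_obnd_cbnd; last exact: mdU'.
apply: (@le_trans _ _ (\int[lam]_(r in `]s, t]) (d%:E + (d `^ (1 - p))%:E * (`|dU r| `^ p)%:E))%E).
  apply: ge0_le_integral => //.
  - exact: mdU'.
  - apply: emeasurable_funD => //; apply: emeasurable_funM => //; exact: mdUp.
  - by move=> r _; rewrite -EFinM -EFinD lee_fin powR_trick.
rewrite ge0_integralD//; last 3 first.
- by move=> r _; rewrite lee_fin ltW.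
- by move=> r _; rewrite mule_ge0 ?lee_fin ?powR_ge0.
- by apply: emeasurable_funM => //; exact: mdUp.
rewrite ge0_integralZl ?lee_fin ?powR_ge0//; last exact: mdUp.
rewrite EFinD; apply: leeD.
  have lst : lam `]s, t]%classic = (t - s)%:E.
    by rewrite [LHS](lebesgue_measure_itv `]s, t])/= lte_fin st EFinB.
  by rewrite integral_cst// EFinM -lst.
rewrite EFinM; apply: lee_wpmul2l; first by rewrite lee_fin powR_ge0.
apply: le_trans int_le; apply: ge0_subset_integral => //.
- exact: mdUp.
- by move=> r; rewrite /= !in_itv/= => /andP[sr rt]; rewrite (le_lt_trans as_)// (le_trans rt).
Qed.

Lemma osc_le s t : a <= s -> s <= t -> t <= b ->
  `|U t - U s| <= 2 * (t - s) `^ (1 - p^-1) * (J / c) `^ p^-1.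
Proof.
move=> as_; rewrite le_eqVlt => /predU1P[->|st] tb.
  by rewrite subrr normr0 !mulr_ge0// powR_ge0.
have d0 : 0 < t - s by rewrite subr_gt0.
have p'0 : 0 < p^-1 by rewrite invr_gt0.
have I0 : 0 <= J / c by rewrite divr_ge0 ?(ltW c0)// fine_ge0.
(* With zero energy no optimal [d] exists: letting [d] tend to 0 shows that the increment
   vanishes. *)
move: I0; rewrite le_eqVlt => /predU1P[/esym Ie|I0].
  rewrite Ie powR0 ?gt_eqF// mulr0; apply/ler_addgt0Pr => e e0.
  have := @osc_delta s t (e / (t - s)) as_ st tb (divr_gt0 e0 d0).
  by rewrite divfK ?gt_eqF// Ie mulr0 addr0 add0r.
(* This value makes the two terms of [osc_delta] equal, hence the factor 2. *)
pose d := ((J / c) / (t - s)) `^ p^-1.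
have dp : 0 < d by rewrite powR_gt0// divr_gt0.
apply: (le_trans (osc_delta as_ st tb dp)).
have e1 : d * (t - s) = (t - s) `^ (1 - p^-1) * (J / c) `^ p^-1.
  rewrite /d powRM ?invr_ge0 ?(ltW I0) ?(ltW d0)// -(powR_inv1 (ltW d0)) -powRrM mulN1r.
  rewrite (@powRB R (t - s) 1 p^-1) ?(gt_eqF d0) ?implybT// powRr1 ?(ltW d0)// powRN; ring.
have e2 : d `^ (1 - p) * (J / c) = d * (t - s).
  rewrite powRB ?(gt_eqF dp) ?implybT// powRr1 ?(ltW dp)// -[d `^ p]powRrM mulVf ?(gt_eqF p0)//.
  rewrite (powRr1 (divr_ge0 (ltW I0) (ltW d0))).
  rewrite -[LHS]mulrA; congr (d * _).
  by rewrite (invf_div (J / c)) divfK ?(gt_eqF I0).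
by rewrite e2 e1 -mulrA mulr_natl mulr2n.
Qed.

End estimate.
End osc.

(** * Decay at infinity and local bounds *)

Section decay.
Context (R : realType) (n : nat) (p : R) (p1 : 1 < p).
Local Notation E := 'rV[R]_n.+1.
Local Notation om := (omega R n).
Local Notation renergy := (renergy n p).

Let p0 : 0 < p. Proof. exact: lt_trans p1. Qed.

(** What the radial estimates ask of [A]: a positive lower bound on compact intervals for
    oscillations, and a power lower bound with [e > p - N], from a dyadic radius on, for the
    decay. *)
Definition weight (w : R -> R) : Prop :=
  [/\ measurable_fun setT (w : R -> measurableTypeR R), forall r, 0 <= w r,
      forall a b, 0 < a -> a < b ->
        exists2 al, 0 < al & forall r, a <= r <= b -> al <= w r &
      exists k0 c e, [/\ 0 < c, p - n.+1%:R < e &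
        forall r, 2 ^+ k0 <= r -> c * r `^ e <= w r]].

Definition C1_vanishing (U dU : R -> R) : Prop :=
  [/\ forall t, is_derive t (1:R) U (dU t), continuous dU &
      exists M, forall t, M <= t -> U t = 0].

Lemma renergy_ge0 w f : (forall r, 0 <= w r) -> (0 <= renergy w f)%E.
Proof. by move=> w0; apply: integral_ge0 => x _; rewrite lee_fin mulr_ge0// powR_ge0. Qed.

(* The increments over [2^k, 2^(k+1)] decay geometrically because [e > p - N]. *)
Lemma decay w : weight w -> exists k0 C, [/\ 0 <= C &
  forall U dU, C1_vanishing U dU -> (renergy w dU < +oo)%E ->
    `|U (2 ^+ k0)| <= C * (fine (renergy w dU)) `^ p^-1].
Proof.
move=> [mw w0 _ [k0 [c [e [c0 he hw]]]]].
(* On []2^k, 2^(k+1)]] the power [r^e] is at least [(2^k)^e] times 1 or [2^e], according to the sign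
   of [e]. *)
pose c' := c * Num.min 1 (2 `^ e).
have c'0 : 0 < c' by rewrite mulr_gt0// lt_min ltr01 powR_gt0.
have wk k r : (k0 <= k)%N -> 2 ^+ k < r <= 2 ^+ k.+1 -> c' * (2 ^+ k) `^ e <= w r.
  move=> kk /andP[kr rk].
  have k20 : 0 < (2:R) ^+ k by rewrite exprn_gt0.
  have r0 : 0 < r by exact: lt_trans kr.
  apply: le_trans (hw _ _); last first.
    by apply: le_trans (ltW kr); rewrite ler_eXn2l// ltr1n.
  rewrite /c' -mulrA ler_pM2l//.
  have [e0|e0] := leP 0 e.
    apply: (@le_trans _ _ ((2 ^+ k) `^ e)).
      by rewrite ler_piMl ?powR_ge0// ge_min lexx.
    by apply: ge0_ler_powR; rewrite ?nnegrE ?(ltW k20) ?(ltW r0) ?(ltW kr).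
  apply: (@le_trans _ _ (2 `^ e * (2 ^+ k) `^ e)).
    by rewrite ler_wpM2r ?powR_ge0// ge_min lexx orbT.
  rewrite -powRM// ?(ltW k20)// -exprS.
  rewrite -[e]opprK !(powRN _ (- e)) lef_pV2 ?posrE ?powR_gt0 ?exprn_gt0//.
  apply: ge0_ler_powR; rewrite ?nnegrE ?oppr_ge0 ?(ltW e0) ?(ltW r0)//.
(* On the [k]-th dyadic interval [osc_le] gives [2^k] the exponent
   [(1 - 1/p) - (n + e)/p = (p - N - e)/p], which is negative; hence the ratio [rho < 1]. *)
pose rho : R := 2 `^ ((p - n.+1%:R - e) / p).
have rho0 : 0 < rho by rewrite powR_gt0.
have rho1 : rho < 1.
  rewrite /rho /powR gt_eqF// -[ltRHS]expR0 ltr_expR.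
  rewrite pmulr_llt0 ?ln_gt0 ?ltr1n// pmulr_llt0 ?invr_gt0//.
  by move: he; lra.
pose D := 2 * ((om * c')^-1) `^ p^-1.
have D0 : 0 <= D by rewrite mulr_ge0// powR_ge0.
(* A bound for the sum of the geometric series of increments. *)
exists k0, (D / (1 - rho)); split; first by rewrite divr_ge0// subr_ge0 ltW.
move=> U dU [UdU cdU [M hM]] Jfin.
set J := fine (renergy w dU).
have J0 : 0 <= J by rewrite fine_ge0// renergy_ge0.
have step k : (k0 <= k)%N -> `|U (2 ^+ k) - U (2 ^+ k.+1)| <= D * J `^ p^-1 * rho ^+ k.
  move=> kk; have k20 : 0 < (2:R) ^+ k by rewrite exprn_gt0.
  have k2 : (2:R) ^+ k < 2 ^+ k.+1 by rewrite ltr_eXn2l// ltr1n.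
  have al0 : 0 < c' * (2 ^+ k) `^ e by rewrite mulr_gt0// powR_gt0.
  have := @osc_le R n p p1 w mw w0 _ _ _ k20 k2 al0 (wk k ^~ kk) U dU UdU cdU Jfin _ _ (lexx _) (ltW k2) (lexx _).
  rewrite distrC => /le_trans; apply.
  rewrite -/J (_ : 2 ^+ k.+1 - 2 ^+ k = 2 ^+ k :> R); last by rewrite exprS; ring.
  have E1 : J / (om * (2 ^+ k) ^+ n * (c' * (2 ^+ k) `^ e)) =
     (J * (om * c')^-1) * (2 ^+ k) `^ (- (n%:R + e)).
    rewrite powRN (@powRD R (2 ^+ k)) ?(gt_eqF k20) ?implybT// powR_mulrn ?(ltW k20)//.
    by field; rewrite !gt_eqF ?powR_gt0 ?omega_gt0.
  rewrite E1 powRM ?powR_ge0//; last first.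
    by rewrite mulr_ge0// invr_ge0 mulr_ge0 ?(ltW c'0)// ltW// omega_gt0.
  rewrite powRM//; last by rewrite invr_ge0 mulr_ge0 ?(ltW c'0)// ltW// omega_gt0.
  rewrite -powRrM.
  have E2 : rho ^+ k = (2 ^+ k) `^ (1 - p^-1) * (2 ^+ k) `^ (- (n%:R + e) / p).
    rewrite -powRD ?(gt_eqF k20) ?implybT//.
    rewrite -(powR_mulrn k (ltW rho0)) -(powR_mulrn k (ler0n R 2)) -!powRrM; congr (_ `^ _).
    rewrite -natr1; field; by rewrite gt_eqF.
  by rewrite E2 /D le_eqVlt; apply/orP; left; apply/eqP; ring.
have r10 : 0 < 1 - rho by rewrite subr_gt0.
have tel m : `|U (2 ^+ k0) - U (2 ^+ (k0 + m))| <=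
    D * J `^ p^-1 * ((rho ^+ k0 - rho ^+ (k0 + m)) / (1 - rho)).
  elim: m => [|m IHm]; first by rewrite addn0 !subrr normr0 mul0r mulr0.
  have := step (k0 + m)%N (leq_addr _ _) => hstep.
  apply: (le_trans (ler_distD (U (2 ^+ (k0 + m))) _ _)).
  rewrite addnS; apply: (le_trans (lerD IHm hstep)).
  rewrite (exprS rho (k0 + m)) le_eqVlt; apply/orP; left; apply/eqP; field.
  by rewrite gt_eqF.
(* Far enough [U] vanishes, so the telescoped increments bound [U (2^k0)] itself. *)
have [m hm] : exists m, M <= 2 ^+ (k0 + m).
  exists (Num.bound M); have [M0|M0] := leP M 0; first by rewrite (le_trans M0)// exprn_ge0.
  apply: (le_trans (ltW (archi_boundP (ltW M0)))).
  apply: (@le_trans _ _ (2 ^+ Num.bound M)).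
    by rewrite -natrX ler_nat ltnW// ltn_expl.
  by rewrite ler_eXn2l ?ltr1n// leq_addl.
have := tel m; rewrite (hM _ hm) subr0 => /le_trans; apply.
rewrite mulrAC [leRHS]mulrAC -[leRHS]mulrA -[leLHS]mulrA.
rewrite ler_wpM2l// [leLHS]mulrC ler_wpM2l ?powR_ge0//.
rewrite -[leRHS]mul1r ler_wpM2r// ?invr_ge0 ?(ltW r10)//.
have h1 : rho ^+ k0 <= 1 by apply: exprn_ile1; apply: ltW.
by rewrite lerBlDr (le_trans h1)// lerDl exprn_ge0// ltW.
Qed.

(** [decay] controls [U] at the single radius [2^k0], and [osc_le] carries this control to [[a, b]]
    on an interval enlarged so as to contain that radius. *)
Lemma profile_bounds w : weight w -> forall a b, 0 < a -> a < b ->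
  exists2 C, 0 <= C & forall U dU, C1_vanishing U dU -> (renergy w dU < +oo)%E ->
    (forall t, a <= t <= b -> `|U t| <= C * (fine (renergy w dU)) `^ p^-1) /\
    (forall s t, a <= s <= b -> a <= t <= b ->
      `|U t - U s| <= C * `|t - s| `^ (1 - p^-1) * (fine (renergy w dU)) `^ p^-1).
Proof.
move=> hw a b a0 ab; have [k0 [C [C0 hC]]] := decay hw.
have [mw w0 walpha _] := hw.
pose T : R := 2 ^+ k0; have T0 : 0 < T by rewrite exprn_gt0.
pose m := Num.min a T; pose M := Num.max b T.
have m0 : 0 < m by rewrite lt_min a0.
have mM : m < M by rewrite /m /M gt_min lt_max ab.
have [al al0 hal] := walpha _ _ m0 mM.
pose cc := om * m ^+ n * al.
have cc0 : 0 < cc by rewrite !mulr_gt0 ?omega_gt0// exprn_gt0.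
pose G := 2 * (cc^-1) `^ p^-1.
have G0 : 0 <= G by rewrite mulr_ge0// powR_ge0.
have q0 : 0 <= 1 - p^-1 by rewrite subr_ge0 invf_le1// ltW.
have osc U dU : C1_vanishing U dU -> (renergy w dU < +oo)%E -> forall s t,
    m <= s <= M -> m <= t <= M ->
    `|U t - U s| <= G * `|t - s| `^ (1 - p^-1) * (fine (renergy w dU)) `^ p^-1.
  move=> [UdU cdU _] Jfin s t; have J0 := fine_ge0 (renergy_ge0 dU w0).
  wlog st : s t / s <= t.
    move=> H hs ht; have [st|ts] := leP s t; first exact: H.
    by rewrite distrC (distrC t); apply: H => //; exact: ltW.
  move=> /andP[ms sM] /andP[mt tM].
  have hal' r : m < r <= M -> al <= w r by move=> /andP[mr rM]; apply: hal; rewrite ltW.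
  have := @osc_le R n p p1 w mw w0 _ _ _ m0 mM al0 hal' U dU UdU cdU Jfin _ _ ms st tM.
  have ts0 : 0 <= t - s by rewrite subr_ge0.
  rewrite -/cc powRM ?invr_ge0 ?(ltW cc0)// (ger0_norm ts0) => /le_trans; apply.
  by rewrite /G le_eqVlt; apply/orP; left; apply/eqP; ring.
pose C' := C + G * (M - m) `^ (1 - p^-1).
have CC' : 0 <= C' by rewrite addr_ge0// mulr_ge0// powR_ge0.
have inM t : a <= t <= b -> m <= t <= M.
  by move=> /andP[h1 h2]; rewrite /m /M ge_min le_max h1 h2.
exists (Num.max C' G); first by rewrite le_max CC'.
move=> U dU cU Jfin; split=> [t tab|s t sab tab].
  have TM : m <= T <= M by rewrite /m /M ge_min le_max lexx !orbT.
  apply: (@le_trans _ _ (C' * (fine (renergy w dU)) `^ p^-1)); last first.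
    by rewrite ler_wpM2r ?powR_ge0// le_max lexx.
  rewrite -[U t](subrK (U T)) (le_trans (ler_normD _ _))// /C' mulrDl addrC.
  apply: lerD; first exact: hC.
  apply: (le_trans (osc _ _ cU Jfin _ _ TM (inM _ tab))).
  rewrite ler_wpM2r ?powR_ge0// ler_wpM2l//; apply: ge0_ler_powR => //.
    by rewrite nnegrE subr_ge0 ltW.
  have /andP[h1 h2] := inM _ tab; have /andP[h3 h4] := TM.
  by rewrite ler_norml; apply/andP; split; lra.
apply: (le_trans (osc _ _ cU Jfin _ _ (inM _ sab) (inM _ tab))).
rewrite ler_wpM2r ?powR_ge0// ler_wpM2r ?powR_ge0//.
by rewrite le_max lexx orbT.
Qed.

End decay.

Section weight_hypA.
Context (R : realType) (n : nat) (p : R).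

(* The value of [A] at 0 is arbitrary, hence possibly negative. *)
Definition posw (A : R -> R) (r : R) : R := if 0 < r then A r else 0.

(** The bound on [[a, b]] is the minimum of the continuous positive [A]; the power bound with
    [coo / 2] follows from the positive lower limit at infinity. *)
Lemma hypA_weight A : hypA n.+1 p A -> weight n p (posw A).
Proof.
move=> [A0 cA [a0 [aoo [c0 [coo [_ hoo [_ coo0] _ [hinf _]]]]]]].
have mpos : measurable (`]0, +oo[%classic : set (measurableTypeR R)) by exact: measurable_itv.
split.
- have -> : posw A = A \_ `]0, +oo[%classic.
    by apply/funext => r; rewrite /posw /patch mem_setE in_itv/= andbT.
  apply/(measurable_restrictT _ mpos).
  exact: subspace_continuous_measurable_fun.
- by move=> r; rewrite /posw; case: ifP => // /A0/ltW.
- move=> a b a_gt0 ab.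
  have sub : `[a, b] `<=` `]0, +oo[%classic.
    by move=> r; rewrite /= !in_itv/= andbT => /andP[/(lt_le_trans a_gt0)].
  have [c + hc] := @EVT_min R A a b (ltW ab) (continuous_subspaceW sub cA).
  rewrite in_itv/= => /andP[ac cb]; exists (A c); first by rewrite A0// (lt_le_trans a_gt0).
  move=> r rab; rewrite /posw ifT; first by apply: hc; rewrite in_itv.
  by have /andP[ar _] := rab; exact: lt_le_trans ar.
- have : ((coo / 2)%:E < limf_einf (fun r => (A r / r `^ aoo)%:E) (+oo%R : set_system R))%E.
    by apply: lt_le_trans hinf; rewrite lte_fin ltr_pdivrMr// ltr_pMr// ltr1n.
  rewrite limf_einfE => /ereal_sup_gt[_ [W [M [_ MW]] <-]] hW.
  (* Since [k < 2^k], the radius [2^k] with this exponent lies beyond the threshold [M]. *)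
  exists (Num.bound `|M|), (coo / 2), aoo; split.
  + by rewrite divr_gt0.
  + by have /andP[] := hoo.
  move=> r hr.
  have r0 : 0 < r by apply: lt_le_trans hr; rewrite exprn_gt0.
  rewrite /posw r0 -ler_pdivlMr ?powR_gt0//.
  have : W r.
    apply: MW; apply: (le_lt_trans (ler_norm M)).
    apply: (lt_le_trans (archi_boundP (normr_ge0 M))); apply: le_trans hr.
    by rewrite -natrX ler_nat ltnW// ltn_expl.
  move=> Wr; rewrite -lee_fin; apply: (le_trans (ltW hW)).
  by apply: ereal_inf_lbound; exists r.
Qed.

End weight_hypA.

(** * Real powers *)

Section powR_facts.
Context (R : realType).

(** Near a positive limit the power is [expR (r * ln x)], which is continuous; a zero limit is
    treated by monotonicity. *)
Lemma cvg_powR (u : nat -> R) (y r : R) : 0 < r -> (forall k, 0 <= u k) ->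
  u k @[k --> \oo] --> y -> u k `^ r @[k --> \oo] --> y `^ r.
Proof.
move=> r0 u0 uy.
have y0 : 0 <= y.
  rewrite -(cvg_lim (@Rhausdorff R) uy); apply: limr_ge; first by apply/cvg_ex; exists y.
  exact: nearW.
move: y0; rewrite le_eqVlt => /predU1P[y0|y0].
  rewrite -y0 powR0 ?gt_eqF//; apply/cvgrPdist_lt => e e0.
  have e'0 : 0 < e `^ r^-1 by rewrite powR_gt0.
  move/cvgrPdist_lt : uy => /(_ _ e'0); apply: filterS => k.
  rewrite -y0 !sub0r !normrN ger0_norm// (ger0_norm (powR_ge0 _ _)) => h.
  have -> : e = (e `^ r^-1) `^ r by rewrite -powRrM mulVf ?gt_eqF// powRr1// ltW.
  by apply: gt0_ltr_powR; rewrite ?nnegrE ?(ltW e'0).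
apply: (@cvg_comp _ _ _ u (fun x => x `^ r) _ (nbhs y)) => //.
have : expR (r * ln x) @[x --> y] --> expR (r * ln y).
  apply: continuous_cvg; first exact: continuous_expR.
  by apply: cvgM; [exact: cvg_cst|exact: continuous_ln].
rewrite {2}/powR gt_eqF//; apply: cvg_trans; apply: near_eq_cvg.
near=> x; rewrite /powR gt_eqF//; near: x; exact: lt_nbhsr.
Unshelve. all: by end_near. Qed.

Lemma fine_powR_root (x : \bar R) (r : R) : 0 < r -> (0 <= x)%E -> (x < +oo)%E ->
  x = ((fine x `^ r^-1) `^ r)%:E.
Proof.
by case: x => [x| |]//= r0 x0 _; rewrite -powRrM mulVf ?gt_eqF// powRr1.
Qed.

Lemma fine_root_le (x : \bar R) (y r : R) : 0 < r -> (0 <= x)%E -> 0 <= y ->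
  (x <= (y `^ r)%:E)%E -> fine x `^ r^-1 <= y.
Proof.
case: x => [x| |]//= r0 x0 y0 xy.
have -> : y = (y `^ r) `^ r^-1 by rewrite -powRrM mulfV ?gt_eqF// powRr1.
by apply: ge0_ler_powR; rewrite ?nnegrE ?invr_ge0 ?(ltW r0) ?powR_ge0.
Qed.

Lemma fine_le_linear (x y z : \bar R) (c : R) : x \is a fin_num -> y \is a fin_num ->
  z \is a fin_num -> (x <= c%:E * (y + z))%E -> fine x <= c * (fine y + fine z).
Proof. by case: x => [x| |]//; case: y => [y| |]//; case: z => [z| |]//. Qed.

(** The sum is at most twice the larger term. This plays the part of Minkowski's inequality and is
    the source of the factors [2^p] and [2^q] below. *)
Lemma powRD_le (x y r : R) : 0 <= r -> 0 <= x -> 0 <= y ->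
  (x + y) `^ r <= 2 `^ r * (x `^ r + y `^ r).
Proof.
move=> r0; wlog xy : x y / x <= y.
  move=> H x0 y0; have [xy|yx] := leP x y; first exact: H.
  by rewrite addrC [X in _ * X]addrC; apply: H => //; exact: ltW.
move=> x0 y0; apply: (@le_trans _ _ ((2 * y) `^ r)).
  by apply: ge0_ler_powR; rewrite ?nnegrE ?addr_ge0 ?mulr_ge0//; lra.
by rewrite powRM// ler_wpM2l ?powR_ge0// lerDr powR_ge0.
Qed.

End powR_facts.

(** * Completeness of the weighted space *)

Section riesz_fischer.
Context d (T : measurableType d) (R : realType) (mu : {measure set T -> \bar R}).
Variables (p : R) (w : T -> R) (f : nat -> T -> R).
Hypotheses (p0 : 0 < p) (mw : measurable_fun setT (w : T -> measurableTypeR R))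
  (w0 : forall x, 0 <= w x)
  (mf : forall k, measurable_fun setT (f k : T -> measurableTypeR R)).
Local Notation dist g h := (\int[mu]_x (w x * `|g x - h x| `^ p)%:E)%E.
Hypothesis cauchy : forall e : R, 0 < e -> exists k0 : nat, forall m k : nat,
  (k0 <= m)%N -> (k0 <= k)%N -> (dist (f m) (f k) < e%:E)%E.

Let mdist (g h : T -> R) :
  measurable_fun setT (g : T -> measurableTypeR R) ->
  measurable_fun setT (h : T -> measurableTypeR R) ->
  measurable_fun setT (fun x => (w x * `|g x - h x| `^ p)%:E).
Proof.
move=> mg mh; apply/measurable_EFinP; apply: measurable_funM => //.
apply: (measurableT_comp (measurable_powR p)); apply: measurableT_comp => //.
exact: measurable_funB.
Qed.

Let dist_ge0 (g h : T -> R) x : (0 <= (w x * `|g x - h x| `^ p)%:E)%E.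
Proof. by rewrite lee_fin mulr_ge0// powR_ge0. Qed.

(* Along a subsequence the distance of consecutive terms, weighted by [2^(kp)],
   is summable, hence so are a.e. the increments themselves. *)
Lemma riesz_fischer : exists2 g : T -> R,
  measurable_fun setT (g : T -> measurableTypeR R) &
  dist (f k) g @[k --> \oo] --> 0%E.
Proof.
(* The second factor cancels the weight [2^(kp)] in [D]; the first leaves a convergent series. *)
pose eps (k : nat) : R := (1 / (2 ^ (k + 1))%:R) * ((2 ^+ k) `^ p)^-1.
have h20 k : 0 < 1 / (2 ^ (k + 1))%:R :> R by rewrite divr_gt0// ltr0n expn_gt0.
have eps0 k : 0 < eps k by rewrite mulr_gt0// invr_gt0 powR_gt0 ?exprn_gt0.
have /choice[s0 hs0] (k : nat) : exists k0 : nat, forall m l : nat,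
    (k0 <= m)%N -> (k0 <= l)%N -> (dist (f m) (f l) < (eps k)%:E)%E.
  exact: cauchy.
(* The indices are nondecreasing and dominate both [s0 k] and [k]. *)
pose s := fix s k := if k is k'.+1 then maxn (s k') (maxn k (s0 k)) else s0 0%N.
have s_nd k : (s k <= s k.+1)%N by rewrite leq_maxl.
have s_ge k : (s0 k <= s k)%N by case: k => //= k; rewrite !leq_max leqnn !orbT.
have s_k k : (k <= s k)%N by case: k => //= k; rewrite !leq_max leqnn !orbT.
pose D k x := (2 ^+ k) `^ p * (w x * `|f (s k.+1) x - f (s k) x| `^ p).
have D0 k x : 0 <= D k x by rewrite mulr_ge0 ?powR_ge0// mulr_ge0// powR_ge0.
have mD k : measurable_fun setT (fun x => (D k x)%:E).
  apply/measurable_EFinP; apply: measurable_funM => //.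
  by apply/measurable_EFinP; exact: mdist.
have intD : (\int[mu]_x (\sum_(0 <= k <oo) (D k x)%:E) < +oo)%E.
  rewrite integral_nneseries//; last by move=> k x _; rewrite lee_fin.
  apply: (@le_lt_trans _ _ (\sum_(0 <= k <oo) (1 / (2 ^ (k + 1))%:R)%:E)%E).
    apply: lee_nneseries => [k _ _|k _].
      by apply: integral_ge0 => x _; rewrite lee_fin.
    rewrite /D; under eq_integral do rewrite EFinM.
    rewrite ge0_integralZl ?lee_fin ?powR_ge0//; last exact: mdist.
    have k2 : 0 < (2 ^+ k) `^ p :> R by rewrite powR_gt0// exprn_gt0.
    rewrite -lee_pdivlMl// -EFinM mulrC; apply: ltW; apply: hs0 => //.
    exact: leq_trans (s_nd k).
  have := @cvg_geometric_eseries_half R 1 0.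
  by move=> /cvg_lim -> //; rewrite ltry.
have aeD : {ae mu, forall x, exists B : R, forall k, D k x <= B}.
  have : mu.-integrable setT (fun x => \sum_(0 <= k <oo) (D k x)%:E)%E.
    apply/integrableP; split; first by apply: ge0_emeasurable_sum => // k x _ _; rewrite lee_fin.
    under eq_integral.
      move=> x _; rewrite gee0_abs; last by apply: nneseries_ge0 => k _ _; rewrite lee_fin.
      over.
    exact: intD.
  move=> /(integrable_ae measurableT); apply: filterS => x /(_ I) xfin.
  exists (fine (\sum_(0 <= k <oo) (D k x)%:E)%E) => k.
  rewrite -lee_fin fineK//.
  apply: le_trans (@nneseries_lim_ge R (fun k => (D k x)%:E) xpredT 0 k.+1 _); last first.
    by move=> i _ _; rewrite lee_fin.
  by rewrite big_nat_recr//= leeDr// sume_ge0// => i _; rewrite lee_fin.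
(* The upper limit is measurable everywhere and is the limit wherever the subsequence converges,
   that is, almost everywhere on [w > 0]. *)
pose g x := fine (limn_esup (fun k => (f (s k) x)%:E)).
have mg : measurable_fun setT (g : T -> measurableTypeR R).
  apply: measurableT_comp; first exact: fine_measurable.
  apply: (@measurable_fun_limn_esup _ _ _ _ (fun k x => (f (s k) x)%:E)) => k.
  by apply/measurable_EFinP; exact: mf.
have cvgs : {ae mu, forall x, 0 < w x -> f (s k) x @[k --> \oo] --> g x}.
  apply: filterS aeD => x [B hB] wx.
  have B0 : 0 <= B by apply: le_trans (hB 0%N).
  (* The bound [D k x <= B], divided by [w x] and [2^(kp)], becomes a geometric bound on the
     increments. *)
  have inc k : `|f (s k.+1) x - f (s k) x| <= (B / w x) `^ p^-1 * (2^-1) ^+ k.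
    have k2 : 0 < (2 ^+ k : R) by rewrite exprn_gt0.
    rewrite exprVn ler_pdivlMr//.
    have -> : `|f (s k.+1) x - f (s k) x| * 2 ^+ k =
       ((`|f (s k.+1) x - f (s k) x| * 2 ^+ k) `^ p) `^ p^-1.
      by rewrite -powRrM mulfV ?gt_eqF// powRr1// mulr_ge0// ltW.
    apply: ge0_ler_powR; rewrite ?nnegrE ?invr_ge0 ?(ltW p0) ?powR_ge0 ?divr_ge0//.
    rewrite ler_pdivlMr// powRM ?(ltW k2)//.
    apply: le_trans (hB k); rewrite /D le_eqVlt; apply/orP; left; apply/eqP; ring.
  have /cvg_ex[l hl] : cvgn (fun k => f (s k) x).
    have cs : cvgn (series (fun k => f (s k.+1) x - f (s k) x)).
      apply: normed_cvg; apply: (@series_le_cvg _ _ (geometric ((B / w x) `^ p^-1) 2^-1)) => //=.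
      - by move=> k; rewrite mulr_ge0 ?powR_ge0// exprn_ge0.
      - by apply: is_cvg_geometric_series; rewrite ger0_norm// invf_lt1 ?ltr1n.
    have -> : (fun k => f (s k) x) = (fun k => f (s 0%N) x + series (fun k => f (s k.+1) x - f (s k) x) k).
      by apply/funext => k; rewrite /series/= telescope_sumr// addrC subrK.
    by apply: is_cvgD => //; exact: is_cvg_cst.
  have hlE : (f (s k) x)%:E @[k --> \oo] --> l%:E by apply: cvg_EFin => //; exact: nearW.
  by rewrite /g (cvg_limn_einf_sup hlE).2.
exists g => //.
have distg e : 0 < e -> exists k0 : nat, forall k, (k0 <= k)%N -> (dist (f k) g <= e%:E)%E.
  move=> e0; have [k0 hk0] := cauchy e0; exists k0 => k kk.
  pose F l x := (w x * `|f k x - f (s l) x| `^ p)%:E.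
  have -> : (dist (f k) g = \int[mu]_x limn_einf (F^~ x))%E.
    apply: ae_eq_integral_any; apply: filterS cvgs => x hx _.
    suff : F l x @[l --> \oo] --> (w x * `|f k x - g x| `^ p)%:E by move=> /cvg_limn_einf_sup ->.
    have := w0 x; rewrite le_eqVlt => /predU1P[w0x|wx].
      rewrite -w0x mul0r; apply: (@cvg_trans _ ((fun l : nat => (0%:E : \bar R)) @ \oo)); last exact: cvg_cst.
      by apply: near_eq_cvg; apply: nearW => l; rewrite /F -w0x mul0r.
    apply: cvg_EFin; first exact: nearW.
    apply: cvgM; first exact: cvg_cst.
    apply: cvg_powR => //.
    by apply: cvg_norm; apply: cvgB; [exact: cvg_cst|exact: hx].
  apply: (le_trans (fatou mu measurableT _ _)).
  - by move=> l; exact: mdist.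
  - by move=> l x _; exact: dist_ge0.
  rewrite limn_einf_lim; apply: lime_le; first exact: is_cvg_einfs.
  apply: nearW => l.
  (* The tail infimum from [l] is at most the term of index [maxn l k0], which also lies in the
     Cauchy range. *)
  apply: (@le_trans _ _ (\int[mu]_x F (maxn l k0) x)%E).
    by apply: ereal_inf_lbound; exists (maxn l k0) => //=; exact: leq_maxl.
  apply: ltW; apply: hk0 => //; exact: leq_trans (leq_maxr _ _) (s_k _).
apply/fine_cvgP; split.
  have [k0 hk0] := distg 1 ltr01.
  exists k0 => // k /= kk; rewrite ge0_fin_numE; last by apply: integral_ge0.
  by apply: le_lt_trans (hk0 _ kk) _; rewrite ltry.
apply/cvgrPdist_le => e e0; have [k0 hk0] := distg _ e0.
exists k0 => // k /= kk; rewrite sub0r normrN ger0_norm; last first.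
  by rewrite fine_ge0//; apply: integral_ge0.
rewrite -lee_fin fineK; first exact: hk0.
rewrite ge0_fin_numE; last by apply: integral_ge0.
by apply: le_lt_trans (hk0 _ kk) _; rewrite ltry.
Qed.

End riesz_fischer.

(** * The completion of the smooth radial functions *)

Section smooth_algebra.
Context (R : realType) (n : nat).
Local Notation E := 'rV[R]_n.+1.
Implicit Types (u v : E -> R).

Lemma partials_smooth s u : smooth u -> smooth (partials s u).
Proof. by move=> su t; rewrite /partials -foldr_cat; exact: (su (t ++ s)). Qed.

Lemma partialB i u v : smooth u -> smooth v -> partial i (u - v) = partial i u - partial i v.
Proof.
move=> su sv; apply/funext => x; rewrite /partial deriveB//.
- exact: (su [::]).2.
- exact: (sv [::]).2.
Qed.

Lemma partialZ i (c : R) u : smooth u -> partial i (c *: u) = c *: partial i u.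
Proof. by move=> su; apply/funext => x; rewrite /partial deriveZ//; exact: (su [::]).2. Qed.

Lemma partialsB s u v : smooth u -> smooth v -> partials s (u - v) = partials s u - partials s v.
Proof.
move=> su sv; elim: s => [|i s IHs]; first by [].
by rewrite /= IHs; apply: partialB; exact: partials_smooth.
Qed.

Lemma partialsZ s (c : R) u : smooth u -> partials s (c *: u) = c *: partials s u.
Proof.
move=> su; elim: s => [|i s IHs]; first by [].
by rewrite /= IHs; apply: partialZ; exact: partials_smooth.
Qed.

Lemma smoothB u v : smooth u -> smooth v -> smooth (u - v).
Proof.
move=> su sv s; rewrite partialsB//; split=> [x|i x].
  exact: (cvgB ((su s).1 x) ((sv s).1 x)).
by apply: derivableB; [exact: (su s).2|exact: (sv s).2].
Qed.

Lemma smoothZ (c : R) u : smooth u -> smooth (c *: u).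
Proof.
move=> su s; rewrite partialsZ//; split=> [x|i x].
  exact: (cvgM (cvg_cst c) ((su s).1 x)).
by apply: derivableZ; exact: (su s).2.
Qed.

Lemma dprofileB u v t : smooth u -> smooth v ->
  dprofile (u - v) t = dprofile u t - dprofile v t.
Proof. by move=> su sv; rewrite /dprofile partialB. Qed.

Lemma radialB u v : radial u -> radial v -> radial (u - v).
Proof. by move=> ru rv x y xy; rewrite -[LHS]/(u x - v x) (ru x y xy) (rv x y xy). Qed.

Lemma radialZ (c : R) u : radial u -> radial (c *: u).
Proof. by move=> ru x y xy; rewrite -[LHS]/(c * u x) (ru x y xy). Qed.

Lemma Cc_inftyZ (c : R) u : Cc_infty u -> Cc_infty (c *: u).
Proof.
move=> [su cu]; split; first exact: smoothZ.
apply: (subclosed_compact _ cu); first exact: closed_closure.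
apply: closureS => x /=; apply: contraNN => /eqP ux.
by rewrite -[X in X == 0]/(c * u x) ux mulr0.
Qed.

Lemma Cc_infty_profile u : Cc_infty u -> C1_vanishing (profile u) (dprofile u).
Proof.
move=> [su cs]; split; [by move=> t; exact: is_derive_profile|exact: continuous_dprofile|].
have [M M0 hM] := supp_bounded cs; exists (M + 1) => t Mt.
apply: (supp_out (phi := u)) => /hM; apply/negP; rewrite -ltNge.
apply: (@lt_le_trans _ _ `|(t *: delta_mx ord0 ord0 : E) ord0 ord0|); last exact: coord_le_norm.
rewrite !mxE mulr1 (lt_le_trans _ (ler_norm t))// (lt_le_trans _ Mt)//.
by rewrite ltrDl.
Qed.

End smooth_algebra.

(** * Weighted integrals of radial functions *)

Section radial_integral.
Context (R : realType) (n : nat).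
Local Notation E := 'rV[R]_n.+1.
Local Notation mu := (lebesgueN R n.+1).

Lemma measurable_enormF (f : R -> R) (D : set E) : measurable D ->
  measurable_fun setT (f : R -> measurableTypeR R) ->
  measurable_fun D (fun x : E => (f (enorm x))%:E).
Proof.
move=> mD mf; apply/measurable_EFinP; apply: measurable_funS (measurableT) _ _ => //.
exact: (measurableT_comp mf (@measurable_enorm R n.+1)).
Qed.

(** The [q]-th power of a weighted norm of the radial function of profile [f]. On the whole space
    with [q = p] it is [renergy], so its lemmas serve the energy, the potential and the
    [K]-integrals alike. *)
Definition rint (k : R -> R) (q : R) (D : set E) (f : R -> R) : \bar R :=
  (\int[mu]_(x in D) (k (enorm x) * `|f (enorm x)| `^ q)%:E)%E.

Section coefficient.
Variable k : R -> R.
Hypothesis mk : measurable_fun setT (k : R -> measurableTypeR R).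
Hypothesis k0 : forall r, 0 <= k r.

Lemma rint_ge0 q D f : (0 <= rint k q D f)%E.
Proof. by apply: integral_ge0 => x _; rewrite lee_fin mulr_ge0// powR_ge0. Qed.

Lemma measurable_rint q (D : set E) (f : R -> R) : measurable D ->
  measurable_fun setT (f : R -> measurableTypeR R) ->
  measurable_fun D (fun x : E => (k (enorm x) * `|f (enorm x)| `^ q)%:E).
Proof.
move=> mD mf; apply: (@measurable_enormF (fun r => k r * `|f r| `^ q)) => //.
by apply: measurable_funM => //; exact: measurable_powRabs.
Qed.

Lemma rintZ q (D : set E) (f : R -> R) (c : R) : measurable D ->
  measurable_fun setT (f : R -> measurableTypeR R) ->
  rint k q D (fun t => c * f t) = ((`|c| `^ q)%:E * rint k q D f)%E.
Proof.
move=> mD mf; rewrite /rint -ge0_integralZl//; last 2 first.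
- exact: (measurable_rint q mD mf).
- by move=> x _; rewrite lee_fin mulr_ge0// powR_ge0.
by apply: eq_integral => x _; rewrite -EFinM normrM powRM// mulrCA.
Qed.

Lemma rint_subset q (D D' : set E) (f : R -> R) : measurable D -> measurable D' ->
  measurable_fun setT (f : R -> measurableTypeR R) -> D `<=` D' ->
  (rint k q D f <= rint k q D' f)%E.
Proof.
move=> mD mD' mf sD; apply: ge0_subset_integral => //.
- exact: (measurable_rint q mD' mf).
- by move=> x _; rewrite lee_fin mulr_ge0// powR_ge0.
Qed.

Lemma rint_setU q (D D' : set E) (f : R -> R) : measurable D -> measurable D' ->
  measurable_fun setT (f : R -> measurableTypeR R) ->
  (rint k q (D `|` D') f <= rint k q D f + rint k q D' f)%E.
Proof.
move=> mD mD' mf; have -> : D `|` D' = D `|` (D' `\` D).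
  apply/seteqP; split=> [x|x [Dx|[Dx _]]]; [|by left|by right].
  by have [Dx _|Dx [//|D'x]] := pselect (D x); [left|right].
have mDD : measurable (D' `\` D) by exact: measurableD.
have mU : measurable (D `|` (D' `\` D)) by exact: measurableU.
rewrite /rint ge0_integral_setU//; last 3 first.
- exact: (measurable_rint q mU mf).
- by move=> x _; rewrite lee_fin mulr_ge0// powR_ge0.
- by apply/disj_setPS => x [Dx [_]].
by apply: leeD => //; apply: rint_subset => // x [].
Qed.

Lemma rint_le (q : R) (D : set E) (f : R -> R) (c : R) : 0 < q -> measurable D ->
  measurable_fun setT (f : R -> measurableTypeR R) -> (forall x, D x -> `|f (enorm x)| <= c) ->
  (rint k q D f <= (c `^ q)%:E * \int[mu]_(x in D) (k (enorm x))%:E)%E.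
Proof.
move=> q0 mD mf fc; have mkD := measurable_enormF mD mk.
rewrite -ge0_integralZl ?lee_fin ?powR_ge0//; last by move=> x _; rewrite lee_fin.
apply: ge0_le_integral => //.
- by move=> x _; rewrite lee_fin mulr_ge0// powR_ge0.
- exact: (measurable_rint q mD mf).
- by apply: emeasurable_funM.
move=> x Dx; rewrite -EFinM lee_fin mulrC ler_wpM2r//; have fcx := fc x Dx.
by apply: ge0_ler_powR; rewrite ?nnegrE ?(ltW q0)// (le_trans _ fcx).
Qed.

Lemma rintD (q : R) (D : set E) (f g : R -> R) : 0 <= q -> measurable D ->
  measurable_fun setT (f : R -> measurableTypeR R) ->
  measurable_fun setT (g : R -> measurableTypeR R) ->
  (rint k q D (fun t => f t + g t)%R <= (2 `^ q)%:E * (rint k q D f + rint k q D g))%E.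
Proof.
move=> q0 mD mf mg.
have pos (h : R -> R) (x : E) : (0 <= (k (enorm x) * `|h (enorm x)| `^ q)%:E)%E.
  by rewrite lee_fin mulr_ge0// powR_ge0.
have If := measurable_rint q mD mf; have Ig := measurable_rint q mD mg.
rewrite /rint -ge0_integralD//.
rewrite -ge0_integralZl ?lee_fin ?powR_ge0//; last 2 first.
- exact: emeasurable_funD.
- by move=> x _; apply: adde_ge0; exact: pos.
apply: ge0_le_integral => //.
- by move=> x _; exact: (pos (fun t => f t + g t)).
- exact: (measurable_rint q mD (measurable_funD mf mg)).
- by apply: emeasurable_funM => //; exact: emeasurable_funD.
move=> x _; rewrite -EFinD -EFinM lee_fin -mulrDr mulrCA ler_wpM2l//.
apply: le_trans (powRD_le _ _ _) => //.
by apply: ge0_ler_powR; rewrite ?nnegrE ?addr_ge0// ler_normD.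
Qed.

Lemma rintB (q : R) (D : set E) (f g : R -> R) : 0 <= q -> measurable D ->
  measurable_fun setT (f : R -> measurableTypeR R) ->
  measurable_fun setT (g : R -> measurableTypeR R) ->
  (rint k q D (fun t => f t - g t)%R <= (2 `^ q)%:E * (rint k q D f + rint k q D g))%E.
Proof.
move=> q0 mD mf mg.
have -> : rint k q D g = rint k q D (fun t => - g t).
  by apply: eq_integral => x _; rewrite normrN.
exact: (rintD q0 mD mf (measurable_funN mg)).
Qed.

(** Fatou's lemma; convergence at positive radii is enough because the origin is a null set. *)
Lemma rint_fatou (q c : R) (D : set E) (f_ : nat -> R -> R) (g : R -> R) : 0 < q -> measurable D ->
  (forall j, measurable_fun setT (f_ j : R -> measurableTypeR R)) ->
  (forall t, 0 < t -> f_ j t @[j --> \oo] --> g t) ->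
  (forall j, (rint k q D (f_ j) <= c%:E)%E) -> (rint k q D g <= c%:E)%E.
Proof.
move=> q0 mD mf fg hc; pose F j (x : E) := (k (enorm x) * `|f_ j (enorm x)| `^ q)%:E.
have -> : (rint k q D g = \int[mu]_(x in D) limn_einf (F^~ x))%E.
  apply: ae_eq_integral_any; apply: filterS (ae_enorm_gt0 R n) => x x0 _.
  suff : F j x @[j --> \oo] --> (k (enorm x) * `|g (enorm x)| `^ q)%:E.
    by move=> /cvg_limn_einf_sup ->.
  apply: cvg_EFin; first exact: nearW.
  apply: cvgM; first exact: cvg_cst.
  by apply: cvg_powR => //; apply: cvg_norm; exact: fg.
apply: (le_trans (fatou mu mD _ _)).
- by move=> j; exact: measurable_rint.
- by move=> j x _; rewrite lee_fin mulr_ge0// powR_ge0.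
rewrite limn_einf_lim; apply: lime_le; first exact: is_cvg_einfs.
apply: nearW => j; apply: le_trans (hc j).
by apply: ereal_inf_lbound; exists j => /=.
Qed.

End coefficient.

End radial_integral.

(** * Profiles of the elements of the completion *)

Section representation.
Context (R : realType) (n : nat) (p : R) (p1 : 1 < p).
Local Notation E := 'rV[R]_n.+1.
Local Notation mu := (lebesgueN R n.+1).
Local Notation renergy := (renergy n p).

Let p0 : 0 < p. Proof. exact: lt_trans p1. Qed.

Lemma C1_vanishingB (U dU V dV : R -> R) : C1_vanishing U dU -> C1_vanishing V dV -> C1_vanishing (U - V) (dU - dV).
Proof.
move=> [dU1 cU [M hM]] [dV1 cV [M' hM']]; split.
- by move=> t; exact: is_deriveB.
- by move=> t; exact: (cvgB (cU t) (cV t)).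
exists (Num.max M M') => t; rewrite ge_max => /andP[h1 h2].
by rewrite -[LHS]/(U t - V t) hM// hM'// subrr.
Qed.

Lemma energy_radial (A : R -> R) (u : E -> R) : smooth u -> radial u ->
  energyA p A (grad u) = renergy (posw A) (dprofile u).
Proof.
move=> su ru; apply: ae_eq_integral_any; apply: filterS (ae_enorm_gt0 R n) => x x0 _.
by rewrite /posw x0 enorm_grad_radial// -enorm_gt0.
Qed.

Section weighted.
Variable w : R -> R.
Hypothesis hw : weight n p w.

Let mw : measurable_fun setT (w : R -> measurableTypeR R). Proof. by have [] := hw. Qed.
Let w0 r : 0 <= w r. Proof. by have [_ + _ _] := hw; apply. Qed.

Lemma measurable_renergy f : measurable_fun setT (f : R -> measurableTypeR R) ->
  measurable_fun setT ((fun t => w t * `|f t| `^ p) : R -> measurableTypeR R).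
Proof. by move=> mf; apply: measurable_funM => //; exact: measurable_powRabs. Qed.

Lemma renergy_radm f : measurable_fun setT (f : R -> measurableTypeR R) ->
  renergy w f = (\int[@radm R n]_t (w t * `|f t| `^ p)%:E)%E.
Proof.
move=> mf; rewrite (ge0_integral_pushforward (@measurable_enorm R n.+1))//.
- by apply/measurable_EFinP; exact: measurable_renergy.
- by move=> t _; rewrite lee_fin mulr_ge0// powR_ge0.
Qed.

Lemma renergyD f g : measurable_fun setT (f : R -> measurableTypeR R) ->
  measurable_fun setT (g : R -> measurableTypeR R) ->
  (renergy w (fun t => f t + g t)%R <= (2 `^ p)%:E * (renergy w f + renergy w g))%E.
Proof. exact: (rintD mw w0 (ltW p0)). Qed.

Lemma renergyB f g : measurable_fun setT (f : R -> measurableTypeR R) ->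
  measurable_fun setT (g : R -> measurableTypeR R) ->
  (renergy w (fun t => f t - g t)%R <= (2 `^ p)%:E * (renergy w f + renergy w g))%E.
Proof. exact: (rintB mw w0 (ltW p0)). Qed.

(** Here [W] is just the limit of the derivatives; that it yields the weak gradient is the content
    of [approx_weak_gradient]. *)
Definition approx (u_ : nat -> E -> R) (U W : R -> R) : Prop :=
  [/\ forall k, [/\ Cc_infty (u_ k), radial (u_ k) & (renergy w (dprofile (u_ k)) < +oo)%E],
      measurable_fun setT (U : R -> measurableTypeR R),
      measurable_fun setT (W : R -> measurableTypeR R),
      renergy w (fun t => dprofile (u_ k) t - W t) @[k --> \oo] --> 0%E &
      forall t, 0 < t -> profile (u_ k) t @[k --> \oo] --> U t].

(* [u] is the function of radial profile [U], and [W] is the weak derivative of [U]. *)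
Definition repr (u : E -> R) (U W : R -> R) : Prop :=
  (exists u_, approx u_ U W) /\ {ae mu, forall x, u x = U (enorm x)}.

Lemma measurable_dprofile (u : E -> R) : smooth u ->
  measurable_fun setT (dprofile u : R -> measurableTypeR R).
Proof. by move=> su; apply: continuous_measurable_fun; exact: continuous_dprofile. Qed.

Lemma measurable_profile (u : E -> R) : smooth u ->
  measurable_fun setT (profile u : R -> measurableTypeR R).
Proof.
move=> su; apply: continuous_measurable_fun.
by apply: is_derive_continuous => t; exact: is_derive_profile.
Qed.

(** [W] comes from completeness for the measure [radm]. [U] comes from completeness of the reals,
    since [profile_bounds] applied to differences controls them at each positive radius by their
    energy. *)
Lemma cauchy_approx (u_ : nat -> E -> R) :
  (forall k, [/\ Cc_infty (u_ k), radial (u_ k) & (renergy w (dprofile (u_ k)) < +oo)%E]) ->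
  (forall e : R, 0 < e -> exists k0 : nat, forall m k : nat, (k0 <= m)%N -> (k0 <= k)%N ->
    (renergy w (fun t => dprofile (u_ m) t - dprofile (u_ k) t)%R < e%:E)%E) ->
  exists U W, approx u_ U W.
Proof.
move=> hu cau.
have su k : smooth (u_ k) by have [[]] := hu k.
have [|W mW hW] := @riesz_fischer _ _ _ (@radm R n) p w (fun k => dprofile (u_ k)) p0 mw w0 (fun k => measurable_dprofile (su k)).
  move=> e /cau[k0 hk0]; exists k0 => m k mm kk.
  rewrite -(@renergy_radm (fun t => dprofile (u_ m) t - dprofile (u_ k) t)); first exact: hk0.
  by apply: measurable_funB; exact: measurable_dprofile.
have ccvg t : 0 < t -> cvgn (fun k => profile (u_ k) t).
  move=> t0; have tt : t < t + 1 by rewrite ltrDl.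
  have [C C0 hC] := profile_bounds p1 hw t0 tt.
  apply: cauchy_cvg; apply/cauchy_ballP => e e0.
  (* Differences of energy below this value have size at most [C * e / (C + 1) < e]; [C + 1] also
     covers [C = 0]. *)
  have d0 : 0 < (e / (C + 1)) `^ p by rewrite powR_gt0// divr_gt0// ltr_wpDl.
  have [k0 hk0] := cau _ d0.
  exists ((fun k => profile (u_ k) t) @` [set k | (k0 <= k)%N], (fun k => profile (u_ k) t) @` [set k | (k0 <= k)%N]).
    by split; exists k0 => // k /= kk; exists k.
  move=> [_ _] /= [[m /= mm <-] [k /= kk <-]]; rewrite /ball/=.
  have [[cm _ _] [ck _ _]] := (hu m, hu k).
  have cU := C1_vanishingB (Cc_infty_profile cm) (Cc_infty_profile ck).
  have J1 : (renergy w (dprofile (u_ m) - dprofile (u_ k))%R < ((e / (C + 1)) `^ p)%:E)%E := hk0 m k mm kk.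
  have J0 := renergy_ge0 n p (dprofile (u_ m) - dprofile (u_ k)) w0.
  have Jfin : (renergy w (dprofile (u_ m) - dprofile (u_ k))%R < +oo)%E by rewrite (lt_trans J1)// ltry.
  have tin : t <= t <= t + 1 by rewrite lexx ltW.
  have := (hC _ _ cU Jfin).1 t tin; rewrite -[X in `|X|]/(profile (u_ m) t - profile (u_ k) t).
  move=> /le_lt_trans; apply.
  have C1 : 0 < C + 1 by rewrite ltr_wpDl.
  apply: (@le_lt_trans _ _ (C * (e / (C + 1)))).
    apply: ler_wpM2l => //.
    have -> : e / (C + 1) = ((e / (C + 1)) `^ p) `^ p^-1.
      by rewrite -powRrM mulfV ?gt_eqF// powRr1// divr_ge0 ?(ltW C1)// ltW.
    apply: ge0_ler_powR; rewrite ?nnegrE ?invr_ge0 ?(ltW p0) ?powR_ge0 ?fine_ge0//.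
    by rewrite -lee_fin fineK ?ge0_fin_numE// ltW.
  by rewrite mulrA ltr_pdivrMr// mulrC ltr_pM2l// ltrDl.
(* With value 0 outside the half-line, [U] is everywhere a limit of measurable functions. *)
pose U t := if 0 < t then lim (profile (u_ k) t @[k --> \oo]) else 0.
exists U, W; split => //.
- apply: (@measurable_fun_cvg _ (measurableTypeR R) R setT (fun k (t : R) => if 0 < t then profile (u_ k) t else 0 : R)) => [k|t _].
    have mpos : measurable (`]0, +oo[%classic : set (measurableTypeR R)) by exact: measurable_itv.
    rewrite (_ : (fun t => _) = profile (u_ k) \_ `]0, +oo[%classic); last first.
      by apply/funext => r; rewrite /patch mem_setE in_itv/= andbT.
    apply/(measurable_restrictT _ mpos); apply: measurable_funS (measurableT) _ _ => //.
    exact: measurable_profile.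
  rewrite /U; case: (boolP (0 < t)) => t0; last exact: cvg_cst.
  exact: ccvg.
- rewrite (_ : (fun k => _) = (fun k => \int[@radm R n]_t (w t * `|dprofile (u_ k) t - W t| `^ p)%:E)%E)//.
  apply/funext => k; rewrite (@renergy_radm (fun t => dprofile (u_ k) t - W t))//.
  by apply: measurable_funB => //; exact: measurable_dprofile.
- by move=> t t0; rewrite /U t0; exact: ccvg.
Qed.

(** The sequence defining membership in [DA] is Cauchy for the energy; its almost everywhere limit
    must agree with the limit of its profiles. *)
Lemma DA_repr (A : R -> R) u : w = posw A -> DA p A u -> exists U W, repr u U W.
Proof.
move=> wA [u_ [hSA cau aeu]].
have su k : smooth (u_ k) by have [[]] := hSA k.
have ru k : radial (u_ k) by have [] := hSA k.
have [|e e0|U [W hUW]] := @cauchy_approx u_.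
- by move=> k; have [cc rr] := hSA k; rewrite energy_radial// -wA.
- have e'0 : 0 < e `^ p^-1 by rewrite powR_gt0.
  have [k0 hk0] := cau _ e'0; exists k0 => m k mm kk.
  have := hk0 m k mm kk; rewrite /normSA energy_radial -?wA; last 2 first.
  + exact: smoothB.
  + exact: radialB.
  have -> : dprofile (u_ m - u_ k) = fun t => dprofile (u_ m) t - dprofile (u_ k) t.
    by apply/funext => t; rewrite dprofileB.
  have := renergy_ge0 n p (fun t => dprofile (u_ m) t - dprofile (u_ k) t) w0.
  case: (renergy _ _) => [r||]//= r0.
    rewrite !lte_fin => h; rewrite ltNge; apply/negP => er.
    move: h; rewrite ltNge => /negP; apply.
    by apply: ge0_ler_powR; rewrite ?nnegrE ?invr_ge0 ?(ltW p0) ?(ltW e0).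
  by rewrite gt_eqF// invr_gt0.
exists U, W; split; first by exists u_.
have [_ _ _ _ cvU] := hUW.
apply: filterS2 aeu (ae_enorm_gt0 R n) => x ux x0.
apply: (cvg_unique (@Rhausdorff R) ux).
rewrite (_ : (fun k => u_ k x) = (fun k => profile (u_ k) (enorm x))); first exact: cvU.
by apply/funext => k; rewrite radialE.
Qed.

End weighted.
End representation.

(** * Bounds for limit profiles *)

Section approx_bounds.
Context (R : realType) (n : nat) (p : R) (p1 : 1 < p).
Local Notation E := 'rV[R]_n.+1.
Local Notation mu := (lebesgueN R n.+1).
Local Notation renergy := (renergy n p).
Variable w : R -> R.
Hypothesis hw : weight n p w.

Let p0 : 0 < p. Proof. exact: lt_trans p1. Qed.
Let w0 r : 0 <= w r. Proof. by have [_ + _ _] := hw; apply. Qed.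

Section one_limit.
Variables (u_ : nat -> E -> R) (U W : R -> R).
Hypothesis H : approx p w u_ U W.

Let su k : smooth (u_ k). Proof. by have [h _ _ _ _] := H; have [[]] := h k. Qed.
Let cU k : C1_vanishing (profile (u_ k)) (dprofile (u_ k)).
Proof. by have [h _ _ _ _] := H; have [c _ _] := h k; exact: Cc_infty_profile. Qed.
Let mU' k : measurable_fun setT (dprofile (u_ k) : R -> measurableTypeR R).
Proof. exact: measurable_dprofile. Qed.
Let mW : measurable_fun setT (W : R -> measurableTypeR R). Proof. by have [] := H. Qed.
Let cvU t : 0 < t -> profile (u_ k) t @[k --> \oo] --> U t.
Proof. by have [_ _ _ _ h] := H; exact: h. Qed.

Lemma approx_err (e : R) : 0 < e -> exists k0 : nat, forall k, (k0 <= k)%N ->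
  (renergy w (fun t => dprofile (u_ k) t - W t)%R <= e%:E)%E.
Proof.
move=> e0; have [_ _ _ /fine_cvgP[[k1 _ hk1] /cvgrPdist_le /(_ _ e0)[k2 _ hk2]] _] := H.
exists (maxn k1 k2) => k; rewrite geq_max => /andP[h1 h2].
have := hk2 k h2; rewrite sub0r normrN ger0_norm /=; last first.
  by rewrite fine_ge0// renergy_ge0.
by rewrite -lee_fin fineK//; exact: hk1.
Qed.

Lemma approx_energy : (renergy w W < +oo)%E.
Proof.
have [k0 hk0] := approx_err ltr01.
have [h _ _ _ _] := H; have [_ _ fin] := h k0.
have -> : renergy w W = renergy w (fun t => dprofile (u_ k0) t - (dprofile (u_ k0) t - W t)).
  by apply: eq_integral => x _; rewrite opprB addrC subrK.
apply: (le_lt_trans (renergyB p1 hw (mU' k0) (measurable_funB (mU' k0) mW))).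
apply: lte_mul_pinfty; [by rewrite lee_fin powR_ge0|by []|].
apply: lte_add_pinfty; first exact: fin.
exact: le_lt_trans (hk0 _ (leqnn _)) (ltry _).
Qed.

(** [profile_bounds] makes the profiles uniformly Cauchy on [[a, b]]; let the second index tend to
    infinity. *)
Lemma approx_unif a b (e : R) : 0 < a -> a < b -> 0 < e -> exists k0 : nat, forall k t,
  (k0 <= k)%N -> a <= t <= b -> `|profile (u_ k) t - U t| <= e.
Proof.
move=> a0 ab e0; have [C C0 hC] := profile_bounds p1 hw a0 ab.
have C1 : 0 < C + 1 by rewrite ltr_wpDl.
pose d := (e / (C + 1)) `^ p; have d0 : 0 < d by rewrite powR_gt0// divr_gt0.
(* [renergyB] costs [2^p] and is applied to two errors, so each is kept below [d / (2^p * 2)]. *)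
have p2 : 0 < 2 `^ p * 2 :> R by rewrite mulr_gt0// powR_gt0.
have [k0 hk0] := approx_err (divr_gt0 d0 p2).
exists k0 => k t kk tab; have t0 : 0 < t by case/andP: tab => h _; exact: lt_le_trans h.
have : `|profile (u_ k) t - profile (u_ m) t| @[m --> \oo] --> `|profile (u_ k) t - U t|.
  by apply: cvg_norm; apply: cvgB; [exact: cvg_cst|exact: cvU].
move=> /(@cvg_lim _ _) <- //; apply: limr_le.
  apply/cvg_ex; exists `|profile (u_ k) t - U t|.
  by apply: cvg_norm; apply: cvgB; [exact: cvg_cst|exact: cvU].
exists k0 => // m /= mm.
have J1 : (renergy w (dprofile (u_ k) - dprofile (u_ m))%R <= d%:E)%E.
  have -> : renergy w (dprofile (u_ k) - dprofile (u_ m)) =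
    renergy w (fun t => (dprofile (u_ k) t - W t) - (dprofile (u_ m) t - W t)).
    apply: eq_integral => x _.
    by rewrite opprB addrA subrK.
  apply: (le_trans (renergyB p1 hw (measurable_funB (mU' k) mW) (measurable_funB (mU' m) mW))).
  rewrite -lee_pdivlMl ?powR_gt0//.
  apply: (le_trans (leeD (hk0 _ kk) (hk0 _ mm))).
  rewrite -EFinD -EFinM lee_fin le_eqVlt; apply/orP; left; apply/eqP; field.
  by rewrite gt_eqF// powR_gt0.
have Jfin : (renergy w (dprofile (u_ k) - dprofile (u_ m))%R < +oo)%E by rewrite (le_lt_trans J1)// ltry.
have := (hC _ _ (C1_vanishingB (cU k) (cU m)) Jfin).1 t tab.
rewrite -[X in `|X|]/(profile (u_ k) t - profile (u_ m) t) => /le_trans; apply.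
apply: (@le_trans _ _ (C * (e / (C + 1)))).
  apply: ler_wpM2l => //.
  have -> : e / (C + 1) = d `^ p^-1.
    by rewrite -powRrM mulfV ?gt_eqF// powRr1// divr_ge0 ?(ltW C1)// ltW.
  apply: ge0_ler_powR; rewrite ?nnegrE ?invr_ge0 ?(ltW p0) ?(ltW d0) ?fine_ge0 ?renergy_ge0//.
  by rewrite -lee_fin fineK ?ge0_fin_numE// renergy_ge0.
by rewrite mulrA ler_pdivrMr// mulrC ler_pM2l// lerDl.
Qed.

Let err k := fine (renergy w (fun t => dprofile (u_ k) t - W t)).

Let err0 k : 0 <= err k. Proof. by rewrite fine_ge0// renergy_ge0. Qed.

Let err_cvg : err k @[k --> \oo] --> (0:R).
Proof. by have [_ _ _ /fine_cvgP[_ h] _] := H. Qed.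

Let bound_energy : \forall k \near \oo, fine (renergy w (dprofile (u_ k))) <=
  2 `^ p * (fine (renergy w W) + err k).
Proof.
have [k0 hk0] := approx_err ltr01; exists k0 => // k /= kk.
have fink : renergy w (fun t => dprofile (u_ k) t - W t) \is a fin_num.
  by rewrite ge0_fin_numE ?renergy_ge0// (le_lt_trans (hk0 _ kk))// ltry.
have finW : renergy w W \is a fin_num by rewrite ge0_fin_numE ?renergy_ge0// approx_energy.
have [h _ _ _ _] := H; have [_ _ fin] := h k.
have fink' : renergy w (dprofile (u_ k)) \is a fin_num.
  by rewrite ge0_fin_numE; [exact: fin|exact: renergy_ge0].
apply: (fine_le_linear fink' finW fink); apply: le_trans (renergyD p1 hw mW (measurable_funB (mU' k) mW)).
rewrite le_eqVlt; apply/orP; left; apply/eqP; apply: eq_integral => x _.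
by rewrite addrC subrK.
Qed.

(** The extra factor 2 is the [p]-th root of the constant [2^p] of [bound_energy]. *)
Let lim_bound (c : R) (v : nat -> R) (l : R) : 0 <= c -> v k @[k --> \oo] --> l ->
  (forall k, `|v k| <= c * (fine (renergy w (dprofile (u_ k)))) `^ p^-1) ->
  `|l| <= 2 * c * (fine (renergy w W)) `^ p^-1.
Proof.
move=> c0 vl hv.
have W0 : 0 <= fine (renergy w W) by rewrite fine_ge0// renergy_ge0.
have cv : 2 * c * (fine (renergy w W) + err k) `^ p^-1 @[k --> \oo] -->
    2 * c * (fine (renergy w W)) `^ p^-1.
  apply: cvgM; first exact: cvg_cst.
  apply: cvg_powR; [by rewrite invr_gt0|by move=> k; exact: addr_ge0 W0 (err0 k)|].
  rewrite -[X in _ --> X]addr0; apply: cvgD => //; exact: cvg_cst.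
apply: (ler_cvg_to (cvg_norm vl) cv).
move: bound_energy; apply: filterS => k hk; apply: (le_trans (hv k)).
rewrite [2 * c]mulrC -mulrA; apply: ler_wpM2l => //.
have -> : 2 * (fine (renergy w W) + err k) `^ p^-1 = (2 `^ p * (fine (renergy w W) + err k)) `^ p^-1.
  by rewrite (powRM _ (powR_ge0 _ _) (addr_ge0 W0 (err0 k))) -powRrM mulfV ?gt_eqF// powRr1.
have J0 : 0 <= fine (renergy w (dprofile (u_ k))) by rewrite fine_ge0// renergy_ge0.
apply: ge0_ler_powR; rewrite ?nnegrE ?invr_ge0 ?(ltW p0)//.
exact: le_trans J0 hk.
Qed.

(** The constant [C] is given from outside so that [repr_bounds] obtains one constant for all
    functions. *)
Lemma approx_bounds_of a b C : 0 < a -> a < b -> 0 <= C ->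
  (forall V dV, C1_vanishing V dV -> (renergy w dV < +oo)%E ->
    (forall t, a <= t <= b -> `|V t| <= C * (fine (renergy w dV)) `^ p^-1) /\
    (forall s t, a <= s <= b -> a <= t <= b ->
      `|V t - V s| <= C * `|t - s| `^ (1 - p^-1) * (fine (renergy w dV)) `^ p^-1)) ->
  (forall t, a <= t <= b -> `|U t| <= 2 * C * (fine (renergy w W)) `^ p^-1) /\
  (forall s t, a <= s <= b -> a <= t <= b ->
      `|U t - U s| <= 2 * C * `|t - s| `^ (1 - p^-1) * (fine (renergy w W)) `^ p^-1).
Proof.
move=> a0 ab C0 hC.
have t0 t : a <= t <= b -> 0 < t by case/andP => h _; exact: lt_le_trans h.
have fin k : (renergy w (dprofile (u_ k)) < +oo)%E.
  by have [h _ _ _ _] := H; have [] := h k.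
split=> [t tab|s t sab tab].
  apply: (lim_bound C0 (cvU (t0 _ tab))) => k; exact: (hC _ _ (cU k) (fin k)).1.
rewrite -(mulrA 2 C); apply: (@lim_bound (C * `|t - s| `^ (1 - p^-1)) (fun k => profile (u_ k) t - profile (u_ k) s)).
- by rewrite mulr_ge0// powR_ge0.
- by apply: cvgB; apply: cvU; exact: t0.
- by move=> k; exact: (hC _ _ (cU k) (fin k)).2.
Qed.

End one_limit.

Lemma repr_bounds a b : 0 < a -> a < b -> exists2 C, 0 <= C &
  forall (u : E -> R) U W, repr p w u U W ->
  (forall t, a <= t <= b -> `|U t| <= C * (fine (renergy w W)) `^ p^-1) /\
  (forall s t, a <= s <= b -> a <= t <= b ->
      `|U t - U s| <= C * `|t - s| `^ (1 - p^-1) * (fine (renergy w W)) `^ p^-1).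
Proof.
move=> a0 ab; have [C C0 hC] := profile_bounds p1 hw a0 ab.
exists (2 * C); first by rewrite mulr_ge0.
by move=> u U W [[u_ H] _]; exact: (approx_bounds_of H a0 ab C0 hC).
Qed.

End approx_bounds.

(** * The weak gradient of the limit *)

Section off_origin.
Context (R : realType) (n : nat).
Local Notation E := 'rV[R]_n.+1.
Local Notation mu := (lebesgueN R n.+1).
Implicit Types (f g u phi : E -> R).

Lemma compact_shell (C : set E) : compact C -> C `<=` [set~ 0] ->
  exists a b : R, [/\ 0 < a, a < b & C `<=` shell a b].
Proof.
move=> cC C0; have [nC|nC] := pselect (C !=set0); last first.
  exists 1, 2; split; rewrite ?ltr1n// => x Cx.
  by case: nC; exists x.
have ce : {within C, continuous (@enorm R n.+1)}.
  by apply: continuous_subspaceT => x; exact: continuous_enorm.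
have [c /set_mem Cc hc] := compact_EVT_min nC cC ce.
have [d _ hd] := compact_EVT_max nC cC ce.
have c0 : 0 < enorm c by rewrite enorm_gt0; apply/eqP; exact: C0.
(* Half the minimum, because a shell is open at its inner radius; adding 1 ensures [a < b]. *)
exists (enorm c / 2), (enorm d + 1); split.
- by rewrite divr_gt0.
- have := hd c (mem_set Cc); lra.
- move=> x Cx; apply/andP; have := hc x (mem_set Cx); have := hd x (mem_set Cx).
  by move=> h1 h2; split; lra.
Qed.

Lemma shell_lty (a b : R) : (mu (shell a b) < +oo)%E.
Proof.
apply: le_lt_trans (@cball_lty R n b); apply: le_measure; rewrite ?inE.
- exact: measurable_shell.
- exact: measurable_cball.
- by move=> x /andP[].
Qed.

Lemma ae_L1loc_off0 f g : L1loc g -> {ae mu, forall x, f x = g x} -> L1loc_off0 f.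
Proof.
move=> [mg hg] fg; split.
  apply: (ae_eq_lebesgue_measurable _ mg); last by apply: filterS fg.
  by apply: measurableC; apply: measurable_compact; exact: compact_set1.
move=> C cC C0; rewrite (@ae_eq_integral_any _ _ _ mu C _ (fun x => `|g x|%:E)); first exact: hg.
by apply: filterS fg => x ->.
Qed.

Lemma continuous_L1loc f : continuous f -> L1loc f.
Proof.
move=> cf; split; first exact: continuous_measurable_rV.
move=> C cC C0; have [a [b [a0 ab Cab]]] := compact_shell cC C0.
have [nC|nC] := pselect (C !=set0); last first.
  rewrite (_ : C = set0) ?integral_set0//; apply/seteqP; split=> // x Cx.
  by case: nC; exists x.
have cfC : {within C, continuous (fun x => `|f x|)}.
  apply: continuous_subspaceT => x.
  by apply: (@continuous_comp _ _ _ f Num.norm); [exact: cf|exact: norm_continuous].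
have [c _ hc] := compact_EVT_max nC cC cfC.
have mC := measurable_compact cC.
have mf := continuous_measurable_rV cf.
apply: (@le_lt_trans _ _ (\int[mu]_(x in C) (cst (`|f c|%:E) x))%E).
  apply: ge0_le_integral => //.
  - apply/measurable_EFinP; apply: measurable_funS (measurableT) _ _ => //.
    exact: measurableT_comp.
  - by move=> x Cx; rewrite lee_fin; apply: hc; rewrite inE.
rewrite integral_cst//; apply: lte_mul_pinfty => //.
apply: le_lt_trans (shell_lty a b); apply: le_measure; rewrite ?inE//.
exact: measurable_shell.
Qed.

Lemma supp_partial phi i : supp (partial i phi) `<=` supp phi.
Proof.
suff sub : [set x | partial i phi x != 0] `<=` supp phi.
  by move=> x /(closureS sub); rewrite /supp -(closure_id _).1//; exact: closed_closure.
move=> x /= px; apply: contrapT => sx.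
move/eqP: px; apply; have : nbhs x (~` supp phi).
  by apply: open_nbhs_nbhs; split => //; apply: closed_openC; exact: closed_closure.
move=> nx; rewrite /partial (_ : 0 = 'D_(delta_mx ord0 i) (cst 0) x); last first.
  by rewrite derive_cst.
by apply: near_eq_derive; apply: filterS nx => y; exact: supp_out.
Qed.

End off_origin.

Section approx_gradient.
Context (R : realType) (n : nat) (p : R) (p1 : 1 < p).
Local Notation E := 'rV[R]_n.+1.
Local Notation mu := (lebesgueN R n.+1).
Local Notation renergy := (renergy n p).
Variable w : R -> R.
Hypothesis hw : weight n p w.

Let p0 : 0 < p. Proof. exact: lt_trans p1. Qed.
Let mw : measurable_fun setT (w : R -> measurableTypeR R). Proof. by have [] := hw. Qed.
Let w0 r : 0 <= w r. Proof. by have [_ + _ _] := hw; apply. Qed.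

(** [powR_trick] integrated over the shell. A small [d] handles the first term, after which a small
    energy handles the second. *)
Lemma integral_shell_abs (a b al d : R) (f : R -> R) : 0 < a -> a < b -> 0 < al ->
  (forall r, a <= r <= b -> al <= w r) -> 0 < d ->
  measurable_fun setT (f : R -> measurableTypeR R) ->
  (\int[mu]_(x in shell a b) `|f (enorm x)|%:E <=
    d%:E * mu (shell a b) + (d `^ (1 - p) / al)%:E * renergy w f)%E.
Proof.
move=> a0 ab al0 wal d0 mf.
have mS : measurable (shell a b : set E) by exact: measurable_shell.
have mwf := measurable_renergy hw mf.
have c0 : 0 <= d `^ (1 - p) / al by rewrite divr_ge0 ?powR_ge0// ltW.
have wf0 (x : E) : (0 <= (w (enorm x) * `|f (enorm x)| `^ p)%:E)%E.
  by rewrite lee_fin mulr_ge0 ?powR_ge0.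
have mE (D : set E) : measurable D ->
  measurable_fun D (fun x : E => (w (enorm x) * `|f (enorm x)| `^ p)%:E).
  by move=> mD; exact: (measurable_enormF mD mwf).
have maf : measurable_fun setT ((fun r => `|f r|) : R -> measurableTypeR R).
  exact: measurableT_comp.
apply: (@le_trans _ _ (\int[mu]_(x in shell a b)
   (cst d%:E x + (d `^ (1 - p) / al)%:E * (w (enorm x) * `|f (enorm x)| `^ p)%:E))%E).
  apply: ge0_le_integral => //.
  - exact: (measurable_enormF mS maf).
  - apply: emeasurable_funD => //; apply: emeasurable_funM => //; exact: mE.
  move=> x /andP[xa xb]; rewrite -EFinM -EFinD lee_fin.
  apply: le_trans (powR_trick p1 d0 (normr_ge0 (f (enorm x)))) _.
  rewrite lerD2l -mulrA; apply: ler_wpM2l; first exact: powR_ge0.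
  rewrite mulrA ler_peMl ?powR_ge0//; rewrite mulrC ler_pdivlMr// mul1r.
  by apply: wal; rewrite xb ltW.
rewrite ge0_integralD//; last 3 first.
- by move=> x _; rewrite lee_fin ltW.
- by move=> x _; rewrite mule_ge0.
- by apply: emeasurable_funM => //; exact: mE.
apply: leeD; first by rewrite integral_cst.
rewrite ge0_integralZl//; last exact: mE.
apply: lee_wpmul2l; first by rewrite lee_fin.
by apply: ge0_subset_integral => //; exact: mE.
Qed.

Section one_limit.
Variables (u_ : nat -> E -> R) (U W : R -> R).
Hypothesis H : approx p w u_ U W.

Let g (x : E) : E := (W (enorm x) / enorm x) *: x.

Let su k : smooth (u_ k). Proof. by have [h _ _ _ _] := H; have [[]] := h k. Qed.
Let ru k : radial (u_ k). Proof. by have [h _ _ _ _] := H; have [] := h k. Qed.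
Let mU : measurable_fun setT (U : R -> measurableTypeR R). Proof. by have [] := H. Qed.
Let mW : measurable_fun setT (W : R -> measurableTypeR R). Proof. by have [] := H. Qed.

Lemma coord_gradient_le (c : R) (x : E) i : `|c / enorm x * x ord0 i| <= `|c|.
Proof.
have [->|x0] := eqVneq x 0; first by rewrite mxE mulr0 normr0.
have {}x0 : 0 < enorm x by rewrite enorm_gt0.
rewrite -mulrA normrM ler_piMr// normrM normfV (gtr0_norm x0) mulrC.
by rewrite ler_pdivrMr// mul1r coord_le_enorm.
Qed.

Lemma approx_L1loc : L1loc (fun x : E => U (enorm x)).
Proof.
have mUE : measurable_fun setT ((fun x : E => U (enorm x)) : E -> measurableTypeR R).
  exact: (measurableT_comp mU (@measurable_enorm R n.+1)).
split => // C cC C0; have [a [b [a0 ab Cab]]] := compact_shell cC C0.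
have [Cb Cb0 hCb] := repr_bounds p1 hw a0 ab.
have HR : repr p w (fun x : E => U (enorm x)) U W by split; [exists u_|exact: aeW].
have [hU _] := hCb _ _ _ HR; have mC := measurable_compact cC.
set M := Cb * _ in hU.
apply: (@le_lt_trans _ _ (\int[mu]_(x in C) (cst (M%:E) x))%E).
  apply: ge0_le_integral => //.
  - apply/measurable_EFinP; apply: measurable_funS (measurableT) _ _ => //.
    exact: measurableT_comp.
  - by move=> x Cx; rewrite lee_fin; apply: hU; have /andP[/ltW -> ->] := Cab x Cx.
rewrite integral_cst//; apply: lte_mul_pinfty => //.
  by rewrite lee_fin mulr_ge0// powR_ge0.
apply: le_lt_trans (shell_lty n a b); apply: le_measure; rewrite ?inE//.
exact: measurable_shell.
Qed.

Lemma measurable_gradient i :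
  measurable_fun setT ((fun x => g x ord0 i) : E -> measurableTypeR R).
Proof.
rewrite (_ : (fun x => _) = fun x : E => W (enorm x) / enorm x * x ord0 i); last first.
  by apply/funext => x; rewrite mxE.
apply: measurable_funM; last exact: measurable_rV_coord.
rewrite (_ : (fun x => _) = fun x : E => W (enorm x) * enorm x `^ (-1)); last first.
  by apply/funext => x; rewrite powR_inv1// enorm_ge0.
apply: (measurableT_comp (f := fun r => W r * r `^ (-1)) _ (@measurable_enorm R n.+1)).
by apply: measurable_funM => //; exact: measurable_powR.
Qed.

Lemma approx_grad_L1loc i : L1loc (fun x => g x ord0 i).
Proof.
split; first exact: measurable_gradient.
move=> C cC C0; have [a [b [a0 ab Cab]]] := compact_shell cC C0.
have [_ _ /(_ _ _ a0 ab)[al al0 wal] _] := hw.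
have mC := measurable_compact cC.
have mS : measurable (shell a b : set E) by exact: measurable_shell.
have maW : measurable_fun setT ((fun r => `|W r|) : R -> measurableTypeR R).
  exact: measurableT_comp.
apply: (@le_lt_trans _ _ (\int[mu]_(x in C) `|W (enorm x)|%:E)%E).
  apply: ge0_le_integral => //.
  - apply/measurable_EFinP; apply: measurable_funS (measurableT) _ _ => //.
    apply: measurableT_comp => //; exact: measurable_gradient.
  - exact: (measurable_enormF mC maW).
  - by move=> x Cx; rewrite lee_fin mxE coord_gradient_le.
apply: (@le_lt_trans _ _ (\int[mu]_(x in shell a b) `|W (enorm x)|%:E)%E).
  by apply: ge0_subset_integral => //; exact: (measurable_enormF mS maW).
apply: (le_lt_trans (integral_shell_abs a0 ab al0 wal ltr01 mW)).
apply: lte_add_pinfty; apply: lte_mul_pinfty => //.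
- exact: shell_lty.
- by rewrite lee_fin divr_ge0 ?powR_ge0// ltW.
- exact: (approx_energy p1 hw H).
Qed.

(** The left side compares the integrand for the limit with the one for [u_ k], whose integral
    vanishes by parts. Both live on the support of [phi], inside a shell where the convergence is
    controlled. *)
Let test_diff phi i (M : R) (a b : R) k x : smooth phi -> ~ supp phi 0 ->
  supp phi `<=` shell a b ->
  (forall x, `|phi x| <= M) -> (forall x, `|partial i phi x| <= M) ->
  `|(U (enorm x) * partial i phi x + g x ord0 i * phi x) -
    (u_ k x * partial i phi x + phi x * partial i (u_ k) x)| <=
  M * ((fun t => `|profile (u_ k) t - U t| + `|dprofile (u_ k) t - W t|) (enorm x))
    * \1_(shell a b) x.
Proof.
move=> sp s0 sab hM hM'.
have [sx|sx] := pselect (supp phi x); last first.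
  rewrite (supp_out sx) (supp_out (phi := partial i phi)); last by move/supp_partial.
  by rewrite !(mulr0, mul0r) addr0 subr0 normr0 !mulr_ge0 ?addr_ge0// (le_trans _ (hM x)).
rewrite indicE mem_set ?mulr1; last exact: sab.
have x0 : x != 0 by apply: contra_notN s0 => /eqP <-.
have -> : (U (enorm x) * partial i phi x + g x ord0 i * phi x) -
    (u_ k x * partial i phi x + phi x * partial i (u_ k) x) =
    - (profile (u_ k) (enorm x) - U (enorm x)) * partial i phi x +
    - ((dprofile (u_ k) (enorm x) - W (enorm x)) / enorm x * x ord0 i) * phi x.
  by rewrite (radialE _ (ru k)) (partial_radial _ (su k) (ru k) x0) mxE; ring.
rewrite mulrDr; apply: (le_trans (ler_normD _ _)); apply: lerD.
  by rewrite normrM normrN mulrC ler_wpM2r.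
by rewrite normrM normrN mulrC ler_pM// coord_gradient_le.
Qed.

Let test_le phi i (e : R) : Cc_infty phi -> ~ supp phi 0 -> 0 < e ->
  (`|\int[mu]_x (U (enorm x) * partial i phi x + g x ord0 i * phi x)%:E| <= e%:E)%E.
Proof.
move=> [sp cs] s0 e0; have cp := smooth_continuous sp.
have cp' := @smooth_partial_continuous _ _ phi i sp.
have cs' : compact (supp (partial i phi)).
  by apply: (subclosed_compact _ cs); [exact: closed_closure|exact: supp_partial].
have s0' : ~ supp (partial i phi) 0 by move/supp_partial.
have [M1 M10 hM1] := Cc_bounded cp cs; have [M2 M20 hM2] := Cc_bounded cp' cs'.
pose M := Num.max M1 M2 + 1.
have M0 : 0 < M by rewrite ltr_wpDl// le_max M10.
have hM x : `|phi x| <= M.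
  by rewrite (le_trans (hM1 x))// (@le_trans _ _ (Num.max M1 M2)) ?lerDl// le_max lexx.
have hM' x : `|partial i phi x| <= M.
  by rewrite (le_trans (hM2 x))// (@le_trans _ _ (Num.max M1 M2)) ?lerDl// le_max lexx orbT.
have [a [b [a0 ab sab]]] : exists a b : R, [/\ 0 < a, a < b & supp phi `<=` shell a b].
  by apply: compact_shell => // x sx x0; apply: s0; rewrite -x0.
have [_ _ /(_ _ _ a0 ab)[al al0 wal] _] := hw.
have mS : measurable (shell a b : set E) by exact: measurable_shell.
pose m := fine (mu (shell a b)).
have mE : mu (shell a b) = m%:E by rewrite /m fineK// ge0_fin_numE// shell_lty.
have m0 : 0 <= m by rewrite /m fine_ge0.
(* Chosen so that [M * (d m + (d m + d)) = e]: one [d m] for the profiles, and [d m + d] for the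
   derivatives through [integral_shell_abs]. *)
pose d := e / (M * (2 * m + 1)).
have d0 : 0 < d by rewrite divr_gt0// mulr_gt0// ltr_wpDl// mulr_ge0.
have c0 : 0 < d `^ (1 - p) / al by rewrite divr_gt0// powR_gt0.
have [k1 hk1] := approx_unif p1 hw H a0 ab d0.
have [k2 hk2] := approx_err hw H (divr_gt0 d0 c0).
pose k := maxn k1 k2.
have {}hk1 := hk1 k _ (leq_maxl _ _); have {}hk2 := hk2 k (leq_maxr _ _).
have mp := measurable_profile (su k); have mdp := measurable_dprofile (su k).
have mWd : measurable_fun setT ((fun t => dprofile (u_ k) t - W t) : R -> measurableTypeR R).
  exact: measurable_funB.
have I1 := L1loc_Cc_integrable approx_L1loc cp' cs' s0'.
have I2 := L1loc_Cc_integrable (approx_grad_L1loc i) cp cs s0.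
have I3 := L1loc_Cc_integrable (continuous_L1loc (smooth_continuous (su k))) cp' cs' s0'.
have I4 := L1loc_Cc_integrable (continuous_L1loc (@smooth_partial_continuous _ _ _ i (su k))) cp cs s0.
have IF := integrableD measurableT I1 I2.
have IG := integrableD measurableT I3 I4.
have IFG := integrableB measurableT IF IG.
(* The zero integral given by integration by parts for [u_ k] is subtracted. *)
have {IF IG} -> : (\int[mu]_x (U (enorm x) * partial i phi x + g x ord0 i * phi x)%:E =
    \int[mu]_x ((U (enorm x) * partial i phi x + g x ord0 i * phi x) -
    (u_ k x * partial i phi x + phi x * partial i (u_ k) x))%:E)%E.
  have := integralB measurableT IF IG.
  have -> : (\int[mu]_x ((EFin \o (fun x => u_ k x * partial i phi x)%R) \+
      (EFin \o (fun x => partial i (u_ k) x * phi x)%R)) x = 0)%E.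
    rewrite -[RHS](integral_by_parts i (su k) (conj sp cs)).
    by apply: eq_integral => x _; rewrite /= -EFinD [in RHS](mulrC (phi x)).
  rewrite sube0 => h; transitivity (\int[mu]_x ((EFin \o (fun x => U (enorm x) * partial i phi x)%R) \+
      (EFin \o (fun x => g x ord0 i * phi x)%R)) x)%E => //.
  by rewrite -h; apply: eq_integral => x _; rewrite [in RHS](mulrC (phi x)).
have mF : measurable_fun setT (fun x => ((U (enorm x) * partial i phi x + g x ord0 i * phi x) -
    (u_ k x * partial i phi x + phi x * partial i (u_ k) x))%:E).
  have := measurable_int _ IFG; apply: eq_measurable_fun => x _.
  by rewrite [in RHS](mulrC (phi x)).
apply: (le_trans (le_abse_integral _ _ mF)) => //.
pose h t := `|profile (u_ k) t - U t| + `|dprofile (u_ k) t - W t|.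
have mh1 : measurable_fun setT ((fun t => `|profile (u_ k) t - U t|) : R -> measurableTypeR R).
  by apply: measurableT_comp => //; exact: measurable_funB.
have mh2 : measurable_fun setT ((fun t => `|dprofile (u_ k) t - W t|) : R -> measurableTypeR R).
  by apply: measurableT_comp => //; exact: measurable_funB.
have mh : measurable_fun setT (h : R -> measurableTypeR R) by exact: measurable_funD.
apply: (@le_trans _ _ (\int[mu]_(x in shell a b) (M%:E * (h (enorm x))%:E))%E).
  rewrite [leRHS]integral_mkcond; apply: ge0_le_integral => //.
  - exact: measurableT_comp.
  - apply/(measurable_restrictT _ mS); apply: emeasurable_funM => //.
    exact: (measurable_enormF mS mh).
  move=> x _; have := test_diff k x sp s0 sab hM hM'; rewrite -/(h _) -lee_fin => /le_trans; apply.
  rewrite /patch indicE; case: ifPn => _; last by rewrite mulr0.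
  by rewrite mulr1 EFinM.
rewrite ge0_integralZl//; last 3 first.
- exact: (measurable_enormF mS mh).
- by move=> x _; rewrite lee_fin addr_ge0.
- by rewrite lee_fin ltW.
have -> : e = M * (d * m + (d * m + d)).
  by rewrite /d; field; rewrite !gt_eqF//= ltr_wpDl// mulr_ge0.
rewrite EFinM; apply: lee_wpmul2l; first by rewrite lee_fin ltW.
have -> : (\int[mu]_(x in shell a b) (h (enorm x))%:E =
    \int[mu]_(x in shell a b) `|profile (u_ k) (enorm x) - U (enorm x)|%:E +
    \int[mu]_(x in shell a b) `|dprofile (u_ k) (enorm x) - W (enorm x)|%:E)%E.
  rewrite -ge0_integralD//.
  - exact: (measurable_enormF mS mh1).
  - exact: (measurable_enormF mS mh2).
rewrite EFinD; apply: leeD.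
  rewrite EFinM -mE -integral_cst//; apply: ge0_le_integral => //.
  - exact: (measurable_enormF mS mh1).
  - by move=> x /andP[xa xb]; rewrite lee_fin hk1// xb ltW.
apply: le_trans (integral_shell_abs a0 ab al0 wal d0 mWd) _.
rewrite EFinD (EFinM d m) mE; apply: leeD => //.
apply: (@le_trans _ _ ((d `^ (1 - p) / al)%:E * (d / (d `^ (1 - p) / al))%:E)%E).
  by apply: lee_wpmul2l hk2; rewrite lee_fin ltW.
by rewrite -EFinM [X in X%:E](mulrC _ (d / _)) divfK// gt_eqF.
Qed.

(** By [test_le] with arbitrary [e] the integral of the sum vanishes; both terms are integrable, so
    it splits. *)
Lemma approx_weak_gradient u : {ae mu, forall x, u x = U (enorm x)} ->
  weak_gradient u g.
Proof.
move=> uU; split.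
- exact: ae_L1loc_off0 approx_L1loc uU.
- by move=> i; apply: ae_L1loc_off0 (approx_grad_L1loc i) _; exact: aeW.
move=> phi cphi s0 i; have [sp cs] := cphi.
have cp' := @smooth_partial_continuous _ _ phi i sp.
have cs' : compact (supp (partial i phi)).
  by apply: (subclosed_compact _ cs); [exact: closed_closure|exact: supp_partial].
have s0' : ~ supp (partial i phi) 0 by move/supp_partial.
have I1 := L1loc_Cc_integrable approx_L1loc cp' cs' s0'.
have I2 := L1loc_Cc_integrable (approx_grad_L1loc i) (smooth_continuous sp) cs s0.
have -> : (\int[mu]_x (u x * partial i phi x)%:E =
   \int[mu]_x (U (enorm x) * partial i phi x)%:E)%E.
  by apply: ae_eq_integral_any; apply: filterS uU => x ->.
have f1 : (\int[mu]_x (U (enorm x) * partial i phi x)%:E)%E \is a fin_num.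
  exact: (integrable_fin_num measurableT I1).
have f2 : (\int[mu]_x (g x ord0 i * phi x)%:E)%E \is a fin_num.
  exact: (integrable_fin_num measurableT I2).
have : (\int[mu]_x (U (enorm x) * partial i phi x)%:E +
    \int[mu]_x (g x ord0 i * phi x)%:E = 0)%E.
  have := integralD measurableT I1 I2; rewrite /comp/= => <-.
  apply/eqP; rewrite -abse_eq0 eq_le abse_ge0 andbT.
  apply/lee_addgt0Pr => e e0; rewrite add0e.
  by have := test_le i cphi s0 e0; under eq_integral do rewrite EFinD.
move: f1 f2; case: (integral _ _ _) => [r| |]//; case: (integral _ _ _) => [s| |]//= _ _.
by rewrite -EFinD => -[] /eqP; rewrite addr_eq0 => /eqP ->.
Qed.

End one_limit.
End approx_gradient.

(** * Borel versions of the coefficients *)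

Section local_coefficient.
Context (R : realType) (n : nat).
Local Notation E := 'rV[R]_n.+1.
Local Notation mu := (lebesgueN R n.+1).
Local Notation lam := (@lebesgue_measure R).

(** On a bounded interval [g <= 1 + g^s] reduces integrability to that of the power, and
    [integral_shell_upper] carries it to shells. *)
Lemma Lloc_pos_borel s (f : R -> R) : 1 <= s -> Lloc_pos s f -> (forall r, 0 < r -> 0 <= f r) ->
  exists g : R -> R, [/\ measurable_fun setT (g : R -> measurableTypeR R), forall r, 0 <= g r,
    {ae mu, forall x, f (enorm x) = g (enorm x)} &
    forall a b, 0 < a -> a < b -> (\int[mu]_(x in shell a b) (g (enorm x))%:E < +oo)%E].
Proof.
move=> s1 [mf hf] f0.
have mpos : measurable (`]0, +oo[%classic : set (measurableTypeR R)) by exact: measurable_itv.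
have f0' r : `]0, +oo[%classic r -> 0 <= f r by rewrite /= in_itv/= andbT; exact: f0.
have [g [mg g0 fg]] := lebesgue_measurable_ge0_borel mpos f0' mf.
have fg' : {ae lam, forall r, 0 < r -> f r = g r}.
  by apply: filterS fg => r h r0; apply: h; rewrite /= in_itv/= andbT.
exists g; split => //.
  by apply: filterS2 (ae_radial n fg') (ae_enorm_gt0 R n) => x h /h.
move=> a b a0 ab; have mgE : measurable_fun [set: measurableTypeR R] (EFin \o g) by exact/measurable_EFinP.
apply: (le_lt_trans (integral_shell_upper n a0 ab mgE _)); first by move=> r; rewrite lee_fin.
have mD : measurable (`]a, b]%classic : set (measurableTypeR R)) by exact: measurable_itv.
apply: lte_mul_pinfty => //.
  rewrite lee_fin mulr_ge0 ?(ltW (omega_gt0 R n))// mulr_ge0// exprn_ge0//.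
  by rewrite ltW// (lt_trans a0).
have mgs : measurable_fun setT ((fun r => `|g r| `^ s) : R -> measurableTypeR R).
  exact: measurable_powRabs.
have mgD : measurable_fun `]a, b]%classic (fun r => (`|g r| `^ s)%:E).
  by apply/measurable_EFinP; apply: measurable_funS mgs.
apply: (@le_lt_trans _ _ (\int[lam]_(r in `]a, b]) (cst 1%E r + (`|g r| `^ s)%:E))%E).
  apply: ge0_le_integral => //.
  - by move=> r _; rewrite lee_fin.
  - by apply/measurable_EFinP; apply: measurable_funS mg.
  - exact: emeasurable_funD.
  move=> r _; rewrite -EFinD lee_fin (ger0_norm (g0 r)).
  have [g1|g1] := leP (g r) 1; first by rewrite (le_trans g1)// lerDl powR_ge0.
  rewrite -[leLHS](powRr1 (g0 r)) (@le_trans _ _ (g r `^ s)) ?lerDr//.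
  by apply: ler_powR => //; exact: ltW.
rewrite ge0_integralD//; apply: lte_add_pinfty.
  rewrite integral_cst// mul1e [X in (X < _)%E](lebesgue_measure_itv `]a, b])/= lte_fin ab.
  by rewrite -EFinB ltry.
apply: (@le_lt_trans _ _ (\int[lam]_(r in `[a, b]) (`|g r| `^ s)%:E)%E).
  apply: ge0_subset_integral => //.
  - by apply/measurable_EFinP; apply: measurable_funS mgs.
  - by apply: subset_itvr; rewrite bnd_simp.
rewrite (@ae_eq_integral_any _ _ _ lam _ _ (fun r => (`|f r| `^ s)%:E)).
  apply: hf; first exact: segment_compact.
  by move=> r; rewrite /= !in_itv/= andbT => /andP[/(lt_le_trans a0)].
apply: filterS fg => r h; rewrite /= in_itv/= => /andP[/(lt_le_trans a0) r0 _].
by rewrite h//= in_itv/= r0.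
Qed.

End local_coefficient.

(** * Norm and scaling of represented functions *)

Section repr_space.
Context (R : realType) (n : nat) (p : R) (p1 : 1 < p).
Local Notation E := 'rV[R]_n.+1.
Local Notation mu := (lebesgueN R n.+1).
Local Notation renergy := (renergy n p).

Let p0 : 0 < p. Proof. exact: lt_trans p1. Qed.

(** A weak gradient exists, so [wgrad u] is one, and by uniqueness it equals [W(|x|) x/|x|] almost
    everywhere. *)
Lemma energy_wgrad (A : R -> R) (u : E -> R) U W : weight n p (posw A) ->
  repr p (posw A) u U W -> energyA p A (wgrad u) = renergy (posw A) W.
Proof.
move=> hw [[u_ H] uU]; pose g (x : E) : E := (W (enorm x) / enorm x) *: x.
have ug : weak_gradient u g := approx_weak_gradient p1 hw H uU.
have uw : weak_gradient u (wgrad u).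
  rewrite /wgrad; case: xgetP => [h _ //|/(_ g)]; exact.
apply: ae_eq_integral_any.
apply: filterS2 (weak_gradient_unique uw ug) (ae_enorm_gt0 R n) => x -> x0 _.
rewrite /posw x0 /g enormZ normrM normfV (gtr0_norm x0) divfK//.
by rewrite gt_eqF.
Qed.

Lemma renergyZ w (f : R -> R) (c : R) : weight n p w ->
  measurable_fun setT (f : R -> measurableTypeR R) ->
  renergy w (fun t => c * f t) = ((`|c| `^ p)%:E * renergy w f)%E.
Proof. by move=> [mw w0 _ _] mf; exact: (rintZ mw w0). Qed.

Lemma reprZ w (u : E -> R) U W (c : R) : weight n p w -> repr p w u U W ->
  repr p w (c *: u) (fun t => c * U t) (fun t => c * W t).
Proof.
move=> hw [[u_ [h mU mW cW cU]] uU]; split; last first.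
  by apply: filterS uU => x ux; rewrite -[LHS]/(c * u x) ux.
have su k : smooth (u_ k) by have [[]] := h k.
have dZ k : dprofile (c *: u_ k) = fun t => c * dprofile (u_ k) t.
  by apply/funext => t; rewrite /dprofile partialZ.
exists (fun k => c *: u_ k); split.
- move=> k; have [ck rk fk] := h k; split.
  + exact: Cc_inftyZ.
  + exact: radialZ.
  + rewrite dZ renergyZ//; last exact: measurable_dprofile.
    by apply: lte_mul_pinfty => //; rewrite lee_fin powR_ge0.
- exact: measurable_funM.
- exact: measurable_funM.
- rewrite (_ : (fun k => _) = fun k => ((`|c| `^ p)%:E * renergy w (fun t => dprofile (u_ k) t - W t)%R)%E).
    by rewrite -(mule0 (`|c| `^ p)%:E); apply: cvgeZl.
  have mB k : measurable_fun setT ((fun t => dprofile (u_ k) t - W t) : R -> measurableTypeR R).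
    by apply: measurable_funB => //; exact: measurable_dprofile.
  apply/funext => k; rewrite -(renergyZ c hw (mB k)).
  by apply: eq_integral => x _; rewrite dZ mulrBr.
- move=> t t0; exact: (cvgM (cvg_cst c) (cU t t0)).
Qed.

(** Converse of [DA_repr]; it puts the rescaled functions back into the space over which the suprema
    are taken. *)
Lemma repr_DA (A : R -> R) (u : E -> R) U W : weight n p (posw A) ->
  repr p (posw A) u U W -> DA p A u.
Proof.
move=> hw [[u_ H] uU]; have [h mU mW _ cU] := H; exists u_.
have su k : smooth (u_ k) by have [[]] := h k.
have ru k : radial (u_ k) by have [] := h k.
have w0 r : 0 <= posw A r by have [_ + _ _] := hw; apply.
split.
- move=> k; have [ck rk fk] := h k; split; [exact: ck|exact: rk|].
  by rewrite (energy_radial p A (su k) (ru k)).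
- move=> e e0; have q0 : 0 < 2 `^ p * 2 :> R by rewrite mulr_gt0// powR_gt0.
  (* Two such errors, with the factor [2^p] of [renergyB], give [(e/2)^p]; half of [e] makes the
     final inequality strict. *)
  have d0 : 0 < (e / 2) `^ p / (2 `^ p * 2) by rewrite divr_gt0// powR_gt0// divr_gt0.
  have [k0 hk0] := approx_err hw H d0; exists k0 => m k mm kk.
  rewrite /normSA energy_radial; [|exact: smoothB|exact: radialB].
  have mB j : measurable_fun setT ((fun t => dprofile (u_ j) t - W t) : R -> measurableTypeR R).
    by apply: measurable_funB => //; exact: measurable_dprofile.
  have le1 : (renergy (posw A) (dprofile (u_ m - u_ k)%R) <= ((e / 2) `^ p)%:E)%E.
    have -> : renergy (posw A) (dprofile (u_ m - u_ k)) =
      renergy (posw A) (fun t => (dprofile (u_ m) t - W t) - (dprofile (u_ k) t - W t)).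
      apply: eq_integral => x _; rewrite dprofileB//; congr (_ * `|_| `^ _)%:E; ring.
    apply: (le_trans (renergyB p1 hw (mB m) (mB k))).
    apply: (@le_trans _ _ ((2 `^ p)%:E * (((e / 2) `^ p / (2 `^ p * 2))%:E + ((e / 2) `^ p / (2 `^ p * 2))%:E))%E).
      by apply: lee_wpmul2l; [rewrite lee_fin powR_ge0|apply: leeD; exact: hk0].
    rewrite -EFinD -EFinM lee_fin le_eqVlt; apply/orP; left; apply/eqP.
    by field; rewrite gt_eqF// powR_gt0.
  have := renergy_ge0 n p (dprofile (u_ m - u_ k)) w0.
  move: le1; case: (renergy _ _) => [r| |]//; rewrite !lee_fin => le1 r0.
  rewrite lte_fin (@le_lt_trans _ _ (e / 2))//; last by rewrite ltr_pdivrMr// ltr_pMr// ltr1n.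
  have -> : e / 2 = ((e / 2) `^ p) `^ p^-1.
    by rewrite -powRrM mulfV ?gt_eqF// powRr1// divr_ge0// ltW.
  by apply: ge0_ler_powR; rewrite ?nnegrE ?invr_ge0 ?(ltW p0) ?powR_ge0.
- apply: filterS2 uU (ae_enorm_gt0 R n) => x -> x0.
  rewrite (_ : (fun k => u_ k x) = (fun k => profile (u_ k) (enorm x))); first exact: cU.
  by apply/funext => k; rewrite radialE.
Qed.

End repr_space.

(** * Locally uniform limits of profiles *)

Section arzela_ascoli.
Context (R : realType).

Lemma fmap_ultra (S T : Type) (f : S -> T) (G : set_system S) :
  UltraFilter G -> UltraFilter (f @ G).
Proof.
move=> UG; split; first exact: fmap_proper_filter.
move=> H PH GH; apply/seteqP; split => // B HB.
have [//|GB] := in_ultra_setVsetC (f @^-1` B) UG.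
by have [x []] := filter_ex (filterI HB (GH (~` B) GB)).
Qed.

Variables (f : nat -> R -> R) (th : R).
Hypothesis th0 : 0 < th.
Hypothesis fb : forall a b : R, 0 < a -> a < b -> exists2 C : R, 0 <= C &
  forall k, (forall t, a <= t <= b -> `|f k t| <= C) /\
  (forall s t, a <= s <= b -> a <= t <= b -> `|f k t - f k s| <= C * `|t - s| `^ th).

(* The limit is taken along an ultrafilter first; the subsequence is then extracted by
   a diagonal choice. *)
Lemma arzela_ascoli : exists (sigma : nat -> nat) (L : R -> R),
  {homo sigma : m k / (m < k)%N} /\
  forall a b e : R, 0 < a -> a < b -> 0 < e -> exists k0 : nat, forall k (t : R),
    (k0 <= k)%N -> a <= t <= b -> `|f (sigma k) t - L t| <= e.
Proof.
have [G [UG ooG]] := ultraFilterLemma eventually_filter.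
have PG : ProperFilter G by exact: ultra_proper.
(* At a fixed radius the values stay in a compact interval, where an ultrafilter converges. *)
have lim_ex (t : R) : exists l : R, 0 < t -> f k t @[k --> G] --> l.
  have [t0|t0] := ltP 0 t; last by exists 0.
  have tt : t < t + 1 by rewrite ltrDl.
  have [C C0 hC] := fb t0 tt.
  have cI : compact `[- C, C]%classic by exact: segment_compact.
  rewrite compact_ultra in cI.
  have [|l [_ hl]] := cI (f k t @[k --> G]) (fmap_ultra (f ^~ t) UG).
    rewrite /fmap/=; apply: filterE => k /=; rewrite in_itv/= -ler_norml.
    by apply: (hC k).1; rewrite lexx ltW.
  by exists l.
have [L hL] := choice lim_ex.
have near_t (t e : R) : 0 < t -> 0 < e -> G [set k | `|f k t - L t| <= e].
  move=> t0 e0; have := hL t t0 => /cvgrPdist_le /(_ e e0).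
  by apply: filterS => k /=; rewrite distrC.
(* Three terms of size [e/3]: move [t] to the grid point just below it for [f k] and for [L], and
   compare the two at that point. [HL] gives [L] the modulus of continuity of the sequence. *)
have near_I (a b e : R) : 0 < a -> a < b -> 0 < e ->
    G [set k | forall t, a <= t <= b -> `|f k t - L t| <= e].
  move=> a0 ab e0; have [C C0 hC] := fb a0 ab.
  have HL s t : a <= s <= b -> a <= t <= b -> `|L t - L s| <= C * `|t - s| `^ th.
    move=> sab tab; have [s0 t0] : 0 < s /\ 0 < t.
      by move: sab tab => /andP[/(lt_le_trans a0) -> _] /andP[/(lt_le_trans a0) -> _].
    apply/ler_addgt0Pr => d d0; have d2 : 0 < d / 2 by rewrite divr_gt0.
    have [k [/= h1 h2]] := filter_ex (filterI (near_t s _ s0 d2) (near_t t _ t0 d2)).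
    have := (hC k).2 s t sab tab; move: h1 h2; rewrite !ler_norml.
    by move=> /andP[? ?] /andP[? ?] /andP[? ?]; apply/andP; split; lra.
  (* The mesh for which the modulus [C * d^th] is at most [e/3]. *)
  pose d := (e / 3 / (C + 1)) `^ th^-1.
  have C1 : 0 < C + 1 by rewrite ltr_wpDl.
  have d0 : 0 < d by rewrite powR_gt0// !divr_gt0.
  have dC (s t : R) : `|t - s| <= d -> C * `|t - s| `^ th <= e / 3.
    move=> st; apply: (@le_trans _ _ (C * (e / 3 / (C + 1)))).
      apply: ler_wpM2l => //.
      have -> : e / 3 / (C + 1) = d `^ th.
        by rewrite -powRrM mulVf ?gt_eqF// powRr1// ltW// !divr_gt0.
      by apply: ge0_ler_powR; rewrite ?nnegrE ?(ltW th0) ?(ltW d0).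
    rewrite mulrA ler_pdivrMr// mulrC ler_wpM2l ?lerDl//.
    by rewrite ltW// divr_gt0.
  (* A filter is stable under finite intersections, so finitely many grid points can be treated
     together. *)
  have grid m : G [set k | forall i : nat, (i < m)%N -> a <= a + i%:R * d <= b ->
      `|f k (a + i%:R * d) - L (a + i%:R * d)| <= e / 3].
    elim: m => [|m IH]; first by apply: filterE.
    have [mab|mab] := boolP (a <= a + m%:R * d <= b).
      have tm0 : 0 < a + m%:R * d by rewrite (lt_le_trans a0)//; have /andP[] := mab.
      apply: filterS2 IH (near_t _ (e / 3) tm0 (divr_gt0 e0 (ltr0Sn _ _))) => k h1 h2 i.
      by rewrite ltnS leq_eqVlt => /predU1P[->//|]; exact: h1.
    apply: filterS IH => k h1 i.
    by rewrite ltnS leq_eqVlt => /predU1P[->|]; [rewrite (negbTE mab)|exact: h1].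
  pose m := (Num.truncn ((b - a) / d)).+1.
  apply: filterS (grid m) => k hk t tab.
  have /andP[ta tb] := tab.
  pose i := Num.truncn ((t - a) / d).
  have q0 : 0 <= (t - a) / d by rewrite divr_ge0 ?subr_ge0// ltW.
  have /andP[i1 i2] := truncn_itv q0.
  rewrite -/i in i1 i2; rewrite ler_pdivlMr// in i1; rewrite ltr_pdivrMr// in i2.
  have im : (i < m)%N.
    rewrite /m ltnS; apply: le_truncn.
    by rewrite ler_pM2r ?invr_gt0// lerD2r.
  have iab : a <= a + i%:R * d <= b.
    rewrite lerDl mulr_ge0 ?(ltW d0)//=; lra.
  have ti : `|t - (a + i%:R * d)| <= d.
    rewrite ler_norml; move: i2; rewrite -addn1 natrD mulrDl mul1r => i2.
    apply/andP; split; lra.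
  have := hk i im iab; have := dC _ _ ti; move: (a + i%:R * d) iab => s sab.
  move=> le1; have := (hC k).2 s t sab tab => /le_trans/(_ le1).
  have := HL s t sab tab => /le_trans/(_ le1).
  rewrite !ler_norml => /andP[? ?] /andP[? ?] /andP[? ?]; apply/andP; split; lra.
(* Tolerances shrink while the intervals exhaust the half-line; the end [k+2] keeps the interval
   nondegenerate at [k = 0]. *)
pose S (k : nat) : set nat := [set j | forall t : R, k.+1%:R^-1 <= t <= k.+2%:R -> `|f j t - L t| <= k.+1%:R^-1].
have next k m : exists j, (m < j)%N /\ S k j.
  have k1 : 0 < k.+1%:R^-1 :> R by rewrite invr_gt0.
  have k2 : k.+1%:R^-1 < k.+2%:R :> R.
    by rewrite (@le_lt_trans _ _ 1)// ?invf_le1 ?ler1n// ltr1n.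
  have Gm : G [set j | (m < j)%N] by apply: ooG; exists m.+1.
  by have [j []] := filter_ex (filterI Gm (near_I _ _ _ k1 k2 k1)); exists j.
have [g hg] := choice (fun km : nat * nat => next km.1 km.2).
pose fix sigma (k : nat) : nat := if k is j.+1 then g (j.+1, sigma j) else g (0%N, 0%N).
have sS k : S k (sigma k) by case: k => [|k]; [exact: (hg (0, 0)%N).2|exact: (hg (k.+1, sigma k)).2].
exists sigma, L; split.
  by apply: homo_ltn => [|k]; [exact: ltn_trans|exact: (hg (k.+1, sigma k)).1].
move=> a b e a0 ab e0.
pose k0 := maxn (Num.bound (e^-1)) (maxn (Num.bound (a^-1)) (Num.bound b)).
exists k0 => k t; rewrite !geq_max => /and3P[ke ka kb] /andP[ta tb].
have inv (x : R) : 0 < x -> (Num.bound (x^-1) <= k)%N -> k.+1%:R^-1 <= x.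
  move=> x0 kx; rewrite invf_ple ?posrE// ltW// (lt_le_trans (archi_boundP _)) ?invr_ge0 ?ltW//.
  by rewrite ltr_nat ltnS.
apply: (@le_trans _ _ k.+1%:R^-1); last exact: inv.
apply: sS; rewrite (le_trans (inv _ a0 ka) ta) (le_trans tb)//.
rewrite ltW// (lt_le_trans (archi_boundP _)) ?(ltW (lt_trans a0 ab))//.
by rewrite ler_nat (leq_trans kb)// (leq_trans (leqnSn _)).
Qed.

End arzela_ascoli.

(** * The embeddings *)

Section embedding.
Context (R : realType) (n : nat) (p : R) (p1 : 1 < p) (A V K : R -> R).
Local Notation E := 'rV[R]_n.+1.
Local Notation mu := (lebesgueN R n.+1).
Local Notation renergy := (renergy n p).
Local Notation X := (@spaceX R n.+1 p A V).
Local Notation nX := (@normX R n.+1 p A V).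
Hypothesis hw : weight n p (posw A).
Variables v k : R -> R.
Hypothesis mv : measurable_fun setT (v : R -> measurableTypeR R).
Hypothesis v0 : forall r, 0 <= v r.
Hypothesis vV : {ae mu, forall x, V (enorm x) = v (enorm x)}.
Hypothesis mk : measurable_fun setT (k : R -> measurableTypeR R).
Hypothesis k0 : forall r, 0 <= k r.
Hypothesis kK : {ae mu, forall x, K (enorm x) = k (enorm x)}.
Hypothesis kfin : forall a b, 0 < a -> a < b ->
  (\int[mu]_(x in shell a b) (k (enorm x))%:E < +oo)%E.

Let p0 : 0 < p. Proof. exact: lt_trans p1. Qed.
Let w0 r : 0 <= posw A r. Proof. by have [_ + _ _] := hw; apply. Qed.

(** [nu] is the norm as a real number; its [p]-th power is recorded so that roots of extended reals
    are taken once. *)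
Definition Xrepr (u : E -> R) (U W : R -> R) (nu : R) : Prop :=
  [/\ repr p (posw A) u U W, nX u = nu%:E, 0 <= nu &
      (renergy (posw A) W + renergy v U = (nu `^ p)%:E)%E].

Let potV_repr (u : E -> R) U W : repr p (posw A) u U W -> potV p V u = renergy v U.
Proof. by move=> [_ uU]; apply: ae_eq_integral_any; apply: filterS2 uU vV => x -> ->. Qed.

Let repr_measurable (u : E -> R) U W : repr p (posw A) u U W ->
  measurable_fun setT (U : R -> measurableTypeR R) /\
  measurable_fun setT (W : R -> measurableTypeR R).
Proof. by move=> [[u_ []]]. Qed.

Let normX_repr (u : E -> R) U W : repr p (posw A) u U W ->
  nX u = ((renergy (posw A) W + renergy v U) `^ p^-1)%E.
Proof. by move=> h; rewrite /normX (energy_wgrad p1 hw h) (potV_repr h). Qed.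

Lemma spaceX_repr u : X u -> exists U W nu, Xrepr u U W nu.
Proof.
move=> [/(DA_repr p1 hw erefl)[U [W h]] pfin].
have W0 := renergy_ge0 n p W w0; have V0 := renergy_ge0 n p U v0.
have Wfin : (renergy (posw A) W < +oo)%E by have [[u_ H] _] := h; exact: approx_energy H.
have Vfin : (renergy v U < +oo)%E by rewrite -(potV_repr h).
exists U, W, ((fine (renergy (posw A) W + renergy v U)) `^ p^-1).
have S0 := adde_ge0 W0 V0; have Sfin := lte_add_pinfty Wfin Vfin.
have S : (renergy (posw A) W + renergy v U)%E \is a fin_num by rewrite (ge0_fin_numE S0).
split; [by []| |exact: powR_ge0|exact: fine_powR_root p0 S0 Sfin].
by rewrite (normX_repr h) -{1}(fineK S) poweR_EFin.
Qed.

Lemma repr_Xrepr (u : E -> R) U W nu : repr p (posw A) u U W -> 0 <= nu ->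
  (renergy (posw A) W + renergy v U = (nu `^ p)%:E)%E -> Xrepr u U W nu.
Proof.
move=> h nu0 e; split=> //.
by rewrite (normX_repr h) e poweR_EFin -powRrM mulfV ?gt_eqF// powRr1.
Qed.

Lemma Xrepr_spaceX u U W nu : Xrepr u U W nu -> X u.
Proof.
move=> [h _ _ e]; split; first exact: repr_DA h.
rewrite (potV_repr h); apply: (@le_lt_trans _ _ (nu `^ p)%:E); last exact: ltry.
by rewrite -e leeDr// renergy_ge0.
Qed.

Lemma XreprZ u U W nu (c : R) : Xrepr u U W nu ->
  Xrepr (c *: u) (fun t => c * U t) (fun t => c * W t) (`|c| * nu).
Proof.
move=> [h _ nu0 e]; have [mU mW] := repr_measurable h.
apply: repr_Xrepr; [exact: reprZ|by rewrite mulr_ge0|].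
have eV : (renergy v (fun t => c * U t)%R = (`|c| `^ p)%:E * renergy v U)%E.
  exact: (rintZ mv v0).
rewrite (renergyZ c hw mW) eV -ge0_muleDr; [|exact: renergy_ge0|exact: renergy_ge0].
by rewrite e powRM// EFinM.
Qed.

Lemma Xrepr_energy u U W nu : Xrepr u U W nu -> fine (renergy (posw A) W) `^ p^-1 <= nu.
Proof.
move=> [h _ nu0 e].
have W0 := renergy_ge0 n p W w0; have V0 := renergy_ge0 n p U v0.
by apply: fine_root_le p0 W0 nu0 _; rewrite -e; exact: leeDl.
Qed.

Lemma Xrepr_bounds a b : 0 < a -> a < b -> exists2 C, 0 <= C &
  forall u U W nu, Xrepr u U W nu ->
  (forall t, a <= t <= b -> `|U t| <= C * nu) /\
  (forall s t, a <= s <= b -> a <= t <= b ->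
      `|U t - U s| <= C * `|t - s| `^ (1 - p^-1) * nu).
Proof.
move=> a0 ab; have [C C0 hC] := repr_bounds p1 hw a0 ab.
exists C => // u U W nu H; have le1 := Xrepr_energy H; have [h _ nu0 _] := H.
have [h1 h2] := hC _ _ _ h; split=> [t tab|s t sab tab].
- by apply: (le_trans (h1 t tab)); exact: ler_wpM2l.
- by apply: (le_trans (h2 s t sab tab)); apply: ler_wpM2l => //; rewrite mulr_ge0// powR_ge0.
Qed.

(** The pointwise bounds are proportional to the norm; this settles the case in which a function
    cannot be normalised. *)
Lemma Xrepr0 u U W : Xrepr u U W 0 -> forall t, 0 < t -> U t = 0.
Proof.
move=> H t t0; have tt : t < t + 1 by rewrite ltrDl.
have [C C0 hC] := Xrepr_bounds t0 tt.
have [/(_ t) + _] := hC _ _ _ _ H; rewrite mulr0 normr_le0 lexx ltW// => h.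
exact/eqP/h.
Qed.

Lemma Kint_repr u U W nu D q : Xrepr u U W nu ->
  (\int[mu]_(x in D) (K (enorm x) * `|u x| `^ q)%:E = rint k q D U)%E.
Proof.
by move=> [[_ uU] _ _ _]; apply: ae_eq_integral_any; apply: filterS2 uU kK => x -> ->.
Qed.

(** Common form of [S0] and [Soo], for [D] a ball or the complement of a ball. *)
Definition Ksup q (D : set E) := ereal_sup [set
   (\int[mu]_(x in D) (K (enorm x) * `|u x| `^ q)%:E)%E | u in [set u | X u /\ nX u = 1%E]].

(** By homogeneity: for [nu > 0] the function [u / nu] competes in the supremum. *)
Lemma Kint_le_sup u U W nu D (q : R) : 0 < q -> measurable D -> Xrepr u U W nu ->
  (rint k q D U <= (nu `^ q)%:E * Ksup q D)%E.
Proof.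
move=> q0 mD H; have [h nuE nu0 _] := H; have [mU mW] := repr_measurable h.
move: nu0; rewrite le_eqVlt => /predU1P[z|nu0].
  rewrite -z powR0 ?gt_eqF// mul0e; rewrite -z in H.
  rewrite /rint (@ae_eq_integral_any _ _ _ mu D _ (cst 0%E)) ?integral0//.
  apply: filterS (ae_enorm_gt0 R n) => x x0 _.
  by rewrite (Xrepr0 H x0) normr0 powR0 ?gt_eqF// mulr0.
have H' := XreprZ nu^-1 H.
have i0 : 0 <= nu^-1 by rewrite invr_ge0 ltW.
rewrite (ger0_norm i0) mulVf ?gt_eqF// in H'.
have nq0 : 0 < nu `^ q by rewrite powR_gt0.
rewrite -lee_pdivrMl//.
have -> : ((nu `^ q)^-1%:E * rint k q D U = rint k q D (fun t => nu^-1 * U t)%R)%E.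
  by rewrite (rintZ mk k0)// (ger0_norm i0) -(powR_inv1 (ltW nu0)) -powRrM mulN1r powRN.
rewrite -(Kint_repr D q H'); apply: ereal_sup_ubound; exists (nu^-1 *: u) => //.
by split; [exact: Xrepr_spaceX H'|have [] := H'].
Qed.

Lemma measurable_eball r : measurable (eball r : set E).
Proof.
rewrite -[eball r]setTI (_ : eball r = @enorm R n.+1 @^-1` `]-oo, r[%classic).
  exact: (@measurable_enorm R n.+1 _ _ (measurable_itv _)).
by apply/seteqP; split => x; rewrite /eball /= in_itv.
Qed.

Section split.
Variables (u : E -> R) (h : R -> R).
Hypothesis mh : measurable_fun setT (h : R -> measurableTypeR R).
Hypothesis uh : {ae mu, forall x, u x = h (enorm x)}.

Lemma LK_restrict (D : set E) (q a : R) : measurable D -> 0 < q -> 0 <= a ->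
  (rint k q D h <= a%:E)%E ->
  LK K q (fun x => \1_D x * u x) /\ (normLK K q (fun x => \1_D x * u x)%R <= (a `^ q^-1)%:E)%E.
Proof.
move=> mD q0 a0 ha.
have nE : (normLK K q (fun x => \1_D x * u x)%R <= (a `^ q^-1)%:E)%E.
  rewrite /normLK (_ : integral _ _ _ = rint k q D h).
    move: ha (rint_ge0 k0 q D h); case: (rint _ _ _ _) => [s| |]//; rewrite !lee_fin => sa s0.
    by apply: ge0_ler_powR; rewrite ?nnegrE ?invr_ge0 ?(ltW q0).
  rewrite [RHS]integral_mkcond; apply: ae_eq_integral_any.
  apply: filterS2 uh kK => x -> -> _; rewrite /patch indicE; case: ifPn => _; first by rewrite mul1r.
  by rewrite mul0r normr0 powR0 ?mulr0// gt_eqF.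
split=> //; split; last exact: le_lt_trans nE (ltry _).
have mg : measurable_fun setT ((fun x => \1_D x * h (enorm x)) : E -> measurableTypeR R).
  apply: measurable_funM => //.
  exact: (measurableT_comp mh (@measurable_enorm R n.+1)).
by apply: (ae_eq_lebesgue_measurable _ mg) => //; apply: filterS uh => x ->.
Qed.

(** The two restrictions of [u], to [D] and to its complement, form one of the decompositions in the
    infimum. *)
Lemma sumLK_split (D : set E) (q1 q2 a1 a2 : R) : measurable D -> 0 < q1 -> 0 < q2 ->
  0 <= a1 -> 0 <= a2 ->
  (rint k q1 D h <= a1%:E)%E -> (rint k q2 (~` D) h <= a2%:E)%E ->
  sumLK K q1 q2 u /\
  (normsumLK K q1 q2 u <= (Num.max (a1 `^ q1^-1) (a2 `^ q2^-1))%:E)%E.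
Proof.
move=> mD q10 q20 a10 a20 h1 h2.
have [L1 N1] := LK_restrict mD q10 a10 h1.
have [L2 N2] := LK_restrict (measurableC mD) q20 a20 h2.
have dec : decomposition K q1 q2 u ((fun x => \1_D x * u x), (fun x => \1_(~` D) x * u x)).
  split => //=; apply: aeW => x _.
  rewrite -[RHS]/(\1_D x * u x + \1_(~` D) x * u x) !indicE in_setC.
  by case: (x \in D); rewrite ?(mul1r, mul0r, addr0, add0r).
split; first by eexists; exact: dec.
apply: (@le_trans _ _ (maxe (normLK K q1 (fun x => \1_D x * u x)%R) (normLK K q2 (fun x => \1_(~` D) x * u x)%R))).
  by apply: ereal_inf_lbound; eexists; [exact: dec|].
by rewrite EFin_max ge_max !le_max N1 N2 orbT.
Qed.

End split.

Let lty_ub (x : \bar R) : (x < +oo)%E -> exists2 S : R, 0 <= S & (x <= S%:E)%E.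
Proof.
case: x => [r| |]// _; last by exists 0 => //; exact: leNye.
by exists (Num.max 0 r); rewrite ?lee_fin le_max lexx ?orbT.
Qed.

Lemma Kint_bound (q : R) (D D' : set E) (a b : R) : 0 < q -> measurable D -> measurable D' ->
  0 < a -> a < b -> D `<=` D' `|` shell a b -> (Ksup q D' < +oo)%E ->
  exists2 B : R, 0 <= B & forall u U W nu, Xrepr u U W nu ->
  (rint k q D U <= (B * nu `^ q)%:E)%E.
Proof.
move=> q0 mD mD' a0 ab sD /lty_ub[S S0 hS].
have [C C0 hC] := Xrepr_bounds a0 ab.
have kf := kfin a0 ab; set kap := integral _ _ _ in kf.
have kap0 : (0 <= kap)%E by apply: integral_ge0 => x _; rewrite lee_fin.
have mS : measurable (shell a b : set E) by exact: measurable_shell.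
(* [S] bounds the supremum over [D']; on the shell [|U| <= C * nu] and [kap] is the integral of the
   coefficient. *)
exists (S + C `^ q * fine kap).
  by rewrite addr_ge0// mulr_ge0 ?powR_ge0// fine_ge0.
move=> u U W nu H; have [hr _ nu0 _] := H; have [mU _] := repr_measurable hr.
apply: (@le_trans _ _ (rint k q (D' `|` shell a b) U)).
  by apply: (rint_subset mk k0 q mD _ mU) => //; exact: measurableU.
apply: (le_trans (rint_setU mk k0 q mD' mS mU)).
rewrite mulrDl EFinD; apply: leeD.
  apply: (le_trans (Kint_le_sup q0 mD' H)).
  by rewrite mulrC EFinM; apply: lee_wpmul2l => //; rewrite lee_fin powR_ge0.
apply: le_trans (rint_le mk k0 (c := C * nu) q0 mS mU _) _.
  by move=> x /andP[xa xb]; apply: (hC _ _ _ _ H).1; rewrite xb ltW.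
rewrite -/kap -(@fineK _ kap) ?ge0_fin_numE// -EFinM lee_fin powRM//= le_eqVlt.
by apply/orP; left; apply/eqP; ring.
Qed.

(** Changes the radius of a ball at the price of a shell, where the integrals are bounded anyway.
    The inner radius [r' / 2] makes the open end of the shell harmless. *)
Lemma eball_shell (r r' : R) : 0 < r' ->
  (eball r : set E) `<=` eball r' `|` shell (r' / 2) (r + r').
Proof.
move=> r'0 x xr; have [x'|x'] := ltP (enorm x) r'; [by left|right].
by have {}xr : enorm x < r := xr; apply/andP; split; lra.
Qed.

Lemma eballC_shell (r r' : R) : 0 < r -> 0 < r' ->
  (~` eball r : set E) `<=` ~` eball r' `|` shell (r / 2) (r + r').
Proof.
move=> r0 r'0 x /negP; rewrite -leNgt => rx; have [xr|xr] := ltP (enorm x) r'.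
  by right; apply/andP; split; lra.
by left; apply/negP; rewrite -leNgt.
Qed.

Lemma embedding_continuous (q1 q2 r1 r2 : R) : 0 < q1 -> 0 < q2 -> 0 < r1 -> 0 < r2 ->
  (Ksup q1 (eball r1) < +oo)%E -> (Ksup q2 (~` eball r2) < +oo)%E ->
  continuously_embedded X nX (sumLK K q1 q2) (normsumLK K q1 q2).
Proof.
move=> q10 q20 r10 r20 K1 K2.
have m1 := measurable_eball r1; have m2 := measurable_eball r2.
have a0 : 0 < r1 / 2 by rewrite divr_gt0.
have ab : r1 / 2 < r1 + r2 by lra.
have [B1 B10 hB1] := Kint_bound q10 m1 m1 a0 ab (@subsetUl _ _ _) K1.
(* Both pieces are cut at radius [r1]; the shell bridges the gap to [r2]. *)
have [B2 B20 hB2] := Kint_bound q20 (measurableC m1) (measurableC m2) a0 ab (eballC_shell r10 r20) K2.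
have H u : X u -> exists nu, [/\ nX u = nu%:E, 0 <= nu, sumLK K q1 q2 u &
  (normsumLK K q1 q2 u <= (Num.max (B1 `^ q1^-1) (B2 `^ q2^-1) * nu)%:E)%E].
  move=> /spaceX_repr[U [W [nu H]]]; exists nu; have [h nuE nu0 _] := H.
  have [mU _] := repr_measurable h; have [_ uU] := h.
  have b1 : 0 <= B1 * nu `^ q1 by rewrite mulr_ge0// powR_ge0.
  have b2 : 0 <= B2 * nu `^ q2 by rewrite mulr_ge0// powR_ge0.
  have [S N] := sumLK_split mU uU m1 q10 q20 b1 b2 (hB1 _ _ _ _ H) (hB2 _ _ _ _ H).
  split=> //; apply: (le_trans N); rewrite lee_fin maxr_pMl//.
  by rewrite !powRM ?powR_ge0// -!powRrM !mulfV ?gt_eqF// !powRr1.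
split=> [u /H[nu []]//|]; exists (Num.max (B1 `^ q1^-1) (B2 `^ q2^-1)) => u /H[nu [-> _ _]].
by rewrite EFinM.
Qed.

Section compactness.
Variables (u_ : nat -> E -> R) (M : R).
Hypothesis uX : forall j, X (u_ j).
Hypothesis uM : forall j, (nX (u_ j) <= M%:E)%E.

Lemma bounded_sequence_limit : exists (U_ : nat -> R -> R) (sigma : nat -> nat) (L : R -> R),
  [/\ {homo sigma : m j / (m < j)%N},
      forall j, exists W nu, Xrepr (u_ j) (U_ j) W nu /\ nu <= M,
      measurable_fun setT (L : R -> measurableTypeR R) &
      forall a b e : R, 0 < a -> a < b -> 0 < e -> exists j0 : nat, forall j (t : R),
        (j0 <= j)%N -> a <= t <= b -> `|U_ (sigma j) t - L t| <= e].
Proof.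
have [U_ hU] := choice (fun j => spaceX_repr (uX j)).
have {}hU j : exists W nu, Xrepr (u_ j) (U_ j) W nu /\ nu <= M.
  have [W [nu H]] := hU j; exists W, nu; split => //.
  by have [_ nuE _ _] := H; have := uM j; rewrite nuE lee_fin.
have mU j : measurable_fun setT (U_ j : R -> measurableTypeR R).
  by have [W [nu [[h _ _ _] _]]] := hU j; have [] := repr_measurable h.
have th0 : 0 < 1 - p^-1 by rewrite subr_gt0 invf_lt1.
have [|sigma [L [hs hL]]] := @arzela_ascoli R U_ _ th0.
  move=> a b a0 ab; have [C C0 hC] := Xrepr_bounds a0 ab.
  have [W0 [nu00 [[_ _ nu0 _] nuM]]] := hU 0%N; have M0 := le_trans nu0 nuM.
  exists (C * M); first by rewrite mulr_ge0.
  move=> j; have [W [nu [H nuM']]] := hU j; have [h1 h2] := hC _ _ _ _ H; split.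
    by move=> t tab; apply: (le_trans (h1 t tab)); exact: ler_wpM2l.
  move=> s t sab tab; apply: (le_trans (h2 s t sab tab)).
  by rewrite mulrAC ler_wpM2r ?powR_ge0// ler_wpM2l.
(* The limit is arbitrary outside the half-line; the value 0 there makes it measurable as a
   pointwise limit. *)
pose L' t := if 0 < t then L t else 0.
have hL' (a b e : R) : 0 < a -> a < b -> 0 < e -> exists j0 : nat, forall j (t : R),
    (j0 <= j)%N -> a <= t <= b -> `|U_ (sigma j) t - L' t| <= e.
  move=> a0 ab e0; have [j0 hj] := hL a b e a0 ab e0; exists j0 => j t jj tab.
  by rewrite /L' (lt_le_trans a0) ?hj//; have /andP[] := tab.
exists U_, sigma, L'; split => //.
apply: (@measurable_fun_cvg _ (measurableTypeR R) R setT (fun j (t : R) => if 0 < t then U_ (sigma j) t else 0 : R)) => [j|t _].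
  have mpos : measurable (`]0, +oo[%classic : set (measurableTypeR R)) by exact: measurable_itv.
  rewrite (_ : (fun t => _) = U_ (sigma j) \_ `]0, +oo[%classic); last first.
    by apply/funext => r; rewrite /patch mem_setE in_itv/= andbT.
  apply/(measurable_restrictT _ mpos); apply: measurable_funS (measurableT) _ _ => //.
  exact: mU.
have [t0|t0] := boolP (0 < t); last by rewrite /L' (negbTE t0); exact: cvg_cst.
apply/cvgrPdist_le => e e0; have tt : t < t + 1 by rewrite ltrDl.
have [j0 hj] := hL' t (t + 1) e t0 tt e0; exists j0 => // j jj.
by rewrite distrC hj// lexx ltW.
Qed.

Variables (U_ : nat -> R -> R) (sigma : nat -> nat) (L : R -> R).
Hypothesis hU : forall j, exists W nu, Xrepr (u_ j) (U_ j) W nu /\ nu <= M.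
Hypothesis mL : measurable_fun setT (L : R -> measurableTypeR R).
Hypothesis hL : forall a b e : R, 0 < a -> a < b -> 0 < e -> exists j0 : nat, forall j (t : R),
  (j0 <= j)%N -> a <= t <= b -> `|U_ (sigma j) t - L t| <= e.

Let mU j : measurable_fun setT (U_ j : R -> measurableTypeR R).
Proof. by have [W [nu [[h _ _ _] _]]] := hU j; have [] := repr_measurable h. Qed.

Let M0 : 0 <= M.
Proof. by have [W0 [nu00 [[_ _ nu0 _] nuM]]] := hU 0%N; exact: le_trans nu0 nuM. Qed.

Let UL t : 0 < t -> U_ (sigma j) t @[j --> \oo] --> L t.
Proof.
move=> t0; apply/cvgrPdist_le => e e0; have tt : t < t + 1 by rewrite ltrDl.
have [j0 hj] := hL t0 tt e0; exists j0 => // j jj.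
by rewrite distrC hj// lexx ltW.
Qed.

Lemma limit_rint_le (q c : R) (D : set E) : 0 < q -> measurable D ->
  (forall j, (rint k q D (U_ j) <= c%:E)%E) -> (rint k q D L <= c%:E)%E.
Proof.
by move=> q0 mD hc; apply: (rint_fatou mk k0 q0 mD (f_ := fun j => U_ (sigma j)) _ UL) => j.
Qed.

Lemma limit_rint_fin (q : R) (D D' : set E) (a b : R) : 0 < q -> measurable D -> measurable D' ->
  0 < a -> a < b -> D `<=` D' `|` shell a b -> (Ksup q D' < +oo)%E ->
  exists2 B : R, 0 <= B & (rint k q D L <= B%:E)%E.
Proof.
move=> q0 mD mD' a0 ab sD K1; have [B B0 hB] := Kint_bound q0 mD mD' a0 ab sD K1.
exists (B * M `^ q); first by rewrite mulr_ge0// powR_ge0.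
apply: limit_rint_le => // j; have [W [nu [H nuM]]] := hU j; have [_ _ nu0 _] := H.
apply: (le_trans (hB _ _ _ _ H)); rewrite lee_fin ler_wpM2l//.
by apply: ge0_ler_powR; rewrite ?nnegrE ?(ltW q0).
Qed.

(** On [D'] both the sequence and its limit are small; on the remaining shell the convergence is
    uniform and the coefficient integrable. *)
Lemma limit_rint_cvg (q : R) (D : set E) : 0 < q -> measurable D ->
  (forall e : R, 0 < e -> exists (D' : set E) (a b : R),
    [/\ measurable D', 0 < a < b, D `<=` D' `|` shell a b & (Ksup q D' <= e%:E)%E]) ->
  forall e : R, 0 < e -> exists j0 : nat, forall j, (j0 <= j)%N ->
    (rint k q D (fun t => U_ (sigma j) t - L t)%R <= e%:E)%E.
Proof.
move=> q0 mD small e e0.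
(* With the factor [2^q] of [rintB] and two terms of size [(M^q + 1) * e1], the part on [D'] is at
   most [e / 2]; adding 1 covers [M = 0]. *)
pose e1 := e / 2 / (2 `^ q * (2 * (M `^ q + 1))).
have Mq : 0 < M `^ q + 1 by rewrite ltr_wpDl// powR_ge0.
have q2 : 0 < 2 `^ q :> R by rewrite powR_gt0.
have e10 : 0 < e1 by rewrite !divr_gt0// mulr_gt0// mulr_gt0.
have [D' [a [b [mD' /andP[a0 ab] sD KD']]]] := small e1 e10.
have small_U j : (rint k q D' (U_ j) <= ((M `^ q + 1) * e1)%:E)%E.
  have [W [nu [H nuM]]] := hU j; have [_ _ nu0 _] := H.
  apply: (le_trans (Kint_le_sup q0 mD' H)).
  apply: (@le_trans _ _ ((nu `^ q)%:E * e1%:E)%E).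
    by apply: lee_wpmul2l => //; rewrite lee_fin powR_ge0.
  rewrite -EFinM lee_fin ler_wpM2r ?(ltW e10)// (@le_trans _ _ (M `^ q)) ?lerDl//.
  by apply: ge0_ler_powR; rewrite ?nnegrE ?(ltW q0).
have small_L := limit_rint_le q0 mD' small_U.
have kf := kfin a0 ab; set kap := integral _ _ _ in kf.
have kap0 : (0 <= kap)%E by apply: integral_ge0 => x _; rewrite lee_fin.
have kapE : kap = (fine kap)%:E by rewrite fineK// ge0_fin_numE.
have kap1 : 0 < fine kap + 1 by rewrite ltr_wpDl// fine_ge0.
have mS : measurable (shell a b : set E) by exact: measurable_shell.
(* Uniform distance for which the shell contributes [eta^q * kap], at most [e / 2]. *)
pose eta := (e / 2 / (fine kap + 1)) `^ q^-1.
have eta0 : 0 < eta by rewrite powR_gt0// !divr_gt0.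
have [j0 hj] := hL a0 ab eta0; exists j0 => j jj.
have mh : measurable_fun setT ((fun t => U_ (sigma j) t - L t) : R -> measurableTypeR R).
  exact: (measurable_funB (mU _) mL).
apply: (le_trans (rint_subset mk k0 q mD (measurableU _ _ mD' mS) mh sD)).
apply: (le_trans (rint_setU mk k0 q mD' mS mh)).
rewrite [in leRHS](_ : e = e / 2 + e / 2); last by lra.
rewrite EFinD; apply: leeD.
  apply: (le_trans (rintB mk k0 (ltW q0) mD' (mU _) mL)).
  have -> : e / 2 = 2 `^ q * ((M `^ q + 1) * e1 + (M `^ q + 1) * e1).
    by rewrite /e1; field; rewrite !gt_eqF.
  rewrite EFinM EFinD; apply: lee_wpmul2l; first by rewrite lee_fin ltW.
  by apply: leeD; [exact: small_U|exact: small_L].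
apply: le_trans (rint_le mk k0 (c := eta) q0 mS mh _) _.
  by move=> x /andP[xa xb]; apply: hj => //; rewrite xb ltW.
rewrite -/kap kapE -EFinM lee_fin -powRrM mulVf ?gt_eqF// powRr1 ?divr_ge0 ?(ltW kap1) ?(ltW e0)//.
by rewrite mulrAC ler_pdivrMr// ler_wpM2l ?lerDl// divr_ge0// ltW.
Qed.

End compactness.

Let small_value (F : set_system R) (f : R -> \bar R) (e : R) : ProperFilter F ->
  F [set r | 0 < r] -> f r @[r --> F] --> 0%E -> 0 < e ->
  exists2 r : R, 0 < r & (f r <= e%:E)%E.
Proof.
move=> PF F0 /fine_cvgP[fin /cvgrPdist_le h] e0.
have [r [rfin [/= r0]]] := filter_ex (filterI fin (filterI F0 (h e e0))).
rewrite sub0r normrN => re; exists r => //.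
by rewrite -(fineK rfin) lee_fin (le_trans (ler_norm _)).
Qed.

Lemma embedding_compact (q1 q2 : R) : 0 < q1 -> 0 < q2 ->
  Ksup q1 (eball r) @[r --> 0^'+] --> 0%E -> Ksup q2 (~` eball r) @[r --> +oo] --> 0%E ->
  compactly_embedded X nX (sumLK K q1 q2) (normsumLK K q1 q2).
Proof.
move=> q10 q20 K1 K2.
have small1 (e : R) : 0 < e -> exists2 r : R, 0 < r & (Ksup q1 (eball r) <= e%:E)%E.
  by move=> e0; apply: small_value K1 e0; exact: nbhs_right_gt.
have small2 (e : R) : 0 < e -> exists2 r : R, 0 < r & (Ksup q2 (~` eball r) <= e%:E)%E.
  by move=> e0; apply: small_value K2 e0; exact: nbhs_pinfty_gt.
have [r1 r10 hr1] := small1 1 ltr01; have [r2 r20 hr2] := small2 1 ltr01.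
have fin1 := le_lt_trans hr1 (ltry _); have fin2 := le_lt_trans hr2 (ltry _).
split; first exact: embedding_continuous q10 q20 r10 r20 fin1 fin2.
move=> u_ uX [M uM].
have [U_ [sigma [L [hs hU mL hL]]]] := bounded_sequence_limit uX uM.
have mB (r : R) := measurable_eball r.
have mC r := measurableC (mB r).
have lt2 (r s : R) : 0 < r -> 0 < s -> 0 < r / 2 < s + r.
  by move=> r0 s0; rewrite divr_gt0//=; lra.
have lt2' (r s : R) : 0 < r -> 0 < s -> 0 < r / 2 < r + s.
  by move=> r0 s0; rewrite divr_gt0//=; lra.
(* The sphere of radius 1 is the cut from here on, both for the limit and for the differences. *)
exists sigma; split=> //; exists (fun x => L (enorm x)).
  have /andP[a0 ab] := lt2 r1 1 r10 ltr01; have /andP[a0' ab'] := lt2' 1 r2 ltr01 r20.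
  have [B1 B10 h1] := limit_rint_fin hU hL q10 (mB 1) (mB r1) a0 ab (@eball_shell 1 r1 r10) fin1.
  have [B2 B20 h2] := limit_rint_fin hU hL q20 (mC 1) (mC r2) a0' ab' (@eballC_shell 1 r2 ltr01 r20) fin2.
  by have [] := @sumLK_split (fun x => L (enorm x)) L mL (aeW _ (fun=> erefl)) (eball 1) q1 q2 B1 B2 (mB 1) q10 q20 B10 B20 h1 h2.
have c1 := limit_rint_cvg hU mL hL q10 (mB 1).
have c2 := limit_rint_cvg hU mL hL q20 (mC 1).
have pos j : (0 <= normsumLK K q1 q2 (u_ (sigma j) - (fun x => L (enorm x)))%R)%E.
  apply: le_ereal_inf_tmp => _ [w _ <-]; rewrite le_max; apply/orP; left.
  exact: poweR_ge0.
have H (e : R) : 0 < e -> exists j0 : nat, forall j, (j0 <= j)%N ->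
    (normsumLK K q1 q2 (u_ (sigma j) - (fun x => L (enorm x)))%R <= e%:E)%E.
  (* The two integrals are required to be below [e^q1] and [e^q2], whose roots are both [e]. *)
  move=> e0; have p1e : 0 < e `^ q1 by rewrite powR_gt0.
  have p2e : 0 < e `^ q2 by rewrite powR_gt0.
  have [|j1 h1] := c1 _ _ p1e.
    move=> d d0; have [r r0 hr] := small1 d d0; exists (eball r), (r / 2), (1 + r).
    by split => //; [exact: lt2|exact: eball_shell].
  have [|j2 h2] := c2 _ _ p2e.
    move=> d d0; have [r r0 hr] := small2 d d0; exists (~` eball r), (1 / 2), (1 + r).
    by split => //; [exact: lt2'|exact: eballC_shell].
  exists (maxn j1 j2) => j; rewrite geq_max => /andP[jj1 jj2].
  have [W [nu [[h _ _ _] _]]] := hU (sigma j); have [mU _] := repr_measurable h.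
  have [_ uU] := h.
  have mh := measurable_funB mU mL.
  have uh : {ae mu, forall x, (u_ (sigma j) - (fun x => L (enorm x))) x =
      (U_ (sigma j) \- L) (enorm x)}.
    by apply: filterS uU => x ux; rewrite /= -ux.
  have [_] := sumLK_split mh uh (mB 1) q10 q20 (ltW p1e) (ltW p2e) (h1 j jj1) (h2 j jj2).
  by rewrite -!powRrM !mulfV ?gt_eqF// powRr1 ?(ltW e0)// maxxx.
apply/fine_cvgP; split.
  have [j0 hj] := H 1 ltr01; exists j0 => // j jj.
  by rewrite ge0_fin_numE// (le_lt_trans (hj j jj))// ltry.
apply/cvgrPdist_le => e e0; have [j0 hj] := H e e0; exists j0 => // j jj.
have nfin : normsumLK K q1 q2 (u_ (sigma j) - (fun x => L (enorm x)))%R \is a fin_num.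
  by rewrite ge0_fin_numE// (le_lt_trans (hj j jj))// ltry.
by rewrite sub0r normrN ger0_norm ?fine_ge0// -lee_fin fineK//; exact: hj.
Qed.

End embedding.

Theorem theorem3p1 (R : realType) (N : nat) (p : R) (A V K : R -> R)
    (q1 q2 : R) (hN : (3 <= N)%N) (hp : 1 < p < N%:R)
    (hA : hypA N p A) (hV : hypV V) (hK : hypK K)
    (hq1 : 1 < q1) (hq2 : 1 < q2) :
  ((exists R1 R2 : R, [/\ 0 < R1, 0 < R2,
      (S0 N p A V K q1 R1 < +oo)%E & (Soo N p A V K q2 R2 < +oo)%E]) ->
    continuously_embedded (spaceX (N := N) p A V) (normX p A V)
      (sumLK (N := N) K q1 q2) (normsumLK K q1 q2))
  /\
  (S0 N p A V K q1 r @[r --> 0^'+] --> 0%E ->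
   Soo N p A V K q2 r @[r --> +oo] --> 0%E ->
    compactly_embedded (spaceX (N := N) p A V) (normX p A V)
      (sumLK (N := N) K q1 q2) (normsumLK K q1 q2)).
Proof.
case: N hN hp hA => // n _ /andP[p1 _] hA.
have hw := hypA_weight hA.
have [V0 locV] := hV; have [K0 [s s1 locK]] := hK.
have [v [mv v0 vV _]] := Lloc_pos_borel n (lexx 1) locV V0.
have [k [mk k0 kK kfin]] := Lloc_pos_borel n (ltW s1) locK (fun r r0 => ltW (K0 r r0)).
have q10 := lt_trans ltr01 hq1; have q20 := lt_trans ltr01 hq2.
split=> [[R1 [R2 [R10 R20 S1 S2]]]|S1 S2].
  exact: (embedding_continuous p1 hw mv v0 vV mk k0 kK kfin q10 q20 R10 R20 S1 S2).
exact: (embedding_compact p1 hw mv v0 vV mk k0 kK kfin q10 q20 S1 S2).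
Qed.
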